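(* Let $\Omega\subset\mathbb R^2$ be a bounded polygonal domain with conforming triangulation $\Omega_h$. Let $\lambda_h\in\mathbb C$, $(u_h,\boldsymbol\sigma_h,\hat u_h,\hat\sigma_{n,h})\in U_h$ with $u_h\ne0$, and $\varepsilon_h=(v_h,\boldsymbol\tau_h)\in V_h$ be a solution of the lowest order discrete ultra weak DPG eigenvalue problem $$\begin{aligned}&(\varepsilon_h,(v,\boldsymbol\tau))_V+b(u_h,\boldsymbol\sigma_h,\hat u_h,\hat\sigma_{n,h};v,\boldsymbol\tau)=\lambda_h(u_h,v)_{\Omega_h}&&\forall(v,\boldsymbol\tau)\in V_h,\\&b(w,\mathbf r,\hat w,\hat r;\varepsilon_h)=0&&\forall(w,\mathbf r,\hat w,\hat r)\in U_h.\end{aligned}$$ Then the error estimators $\eta=\|\varepsilon_h\|_V$ and $\tilde\eta$, given by $$\tilde\eta^2=\sum_{T\in\Omega_h}|T|^{1/2}\sum_{E\in\mathcal E(T)}\|[\nabla_hv_h]_E\|_{L^2(E)}^2=\sum_{T\in\Omega_h}|T|^{1/2}\sum_{E\in\mathcal E(T)}\|[\boldsymbol\tau_h]_E\|_{L^2(E)}^2,$$ are equivalent, i.e. there are constants $c,C>0$ independent of the mesh size such that $c\,\tilde\eta\le\eta\le C\,\tilde\eta$.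
   Context: $\Omega_h$ belongs to a shape-regular family of conforming triangulations; constants may depend on the domain and on shape regularity only. $\partial\Omega_h$ is the skeleton (the collection of element boundaries). The test space is $V=H^1(\Omega_h)\times\mathbf H(\mathrm{div};\Omega_h)$ (broken spaces) with $\|(v,\boldsymbol\tau)\|_V^2=\|v\|^2_{L^2(\Omega)}+\|\nabla_hv\|^2_{L^2(\Omega)}+\|\boldsymbol\tau\|^2_{L^2(\Omega)}+\|\mathrm{div}_h\boldsymbol\tau\|^2_{L^2(\Omega)}$ and associated inner product $(\cdot,\cdot)_V$; $\nabla_h,\mathrm{div}_h$ are the elementwise gradient and divergence. The bilinear form is $$b(u,\boldsymbol\sigma,\hat u,\hat\sigma_n;v,\boldsymbol\tau)=(\boldsymbol\sigma,\boldsymbol\tau)_{\Omega_h}-(u,\mathrm{div}\,\boldsymbol\tau)_{\Omega_h}+\langle\hat u,\boldsymbol\tau\cdot\mathbf n\rangle_{\partial\Omega_h}-(\boldsymbol\sigma,\nabla v)_{\Omega_h}+\langle v,\hat\sigma_n\rangle_{\partial\Omega_h},$$ with $(\cdot,\cdot)_{\Omega_h}$ the broken $L^2$ inner product and $\langle\cdot,\cdot\rangle_{\partial\Omega_h}$ the sum over $K$ of the duality pairings on $\partial K$. Discrete spaces: $U_h=P_0(\Omega_h)\times P_0(\Omega_h;\mathbb R^2)\times S^1_0(\partial\Omega_h)\times P_0(\partial\Omega_h)$ and $V_h=P_1(\Omega_h)\times RT_0(\Omega_h)$, where $P_j(\Omega_h)$ are discontinuous piecewise polynomials of degree $\le j$;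 $S^1_0(\partial\Omega_h)$ is the trace on $\partial\Omega_h$ of the continuous piecewise affine functions vanishing on $\partial\Omega$; $P_0(\partial\Omega_h)$ is the set of edgewise constant elements of $H^{-1/2}(\partial\Omega_h)$, the latter being the set of $\tau\in\prod_K H^{-1/2}(\partial K)$ for which there is $\boldsymbol\tau\in\mathbf H(\mathrm{div};\Omega)$ with $\tau|_{\partial K}=\boldsymbol\tau\cdot\mathbf n|_{\partial K}$ for all $K$; $RT_0(\Omega_h)$ is the discontinuous (elementwise) lowest order Raviart--Thomas space. $|T|$ is the area of $T$, $\mathcal E(T)$ the set of its edges, and $[\cdot]_E$ the jump across $E$ (on a boundary edge, the trace from the adjacent element). *)

(* Defs.v *)
From HB Require Import structures.
From mathcomp Require Import all_boot all_order all_algebra.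
From mathcomp Require Import all_classical all_reals all_analysis.
From mathcomp Require Import complex.

Set Implicit Arguments.
Unset Strict Implicit.
Unset Printing Implicit Defensive.

Import Order.TTheory GRing.Theory Num.Theory.
Import numFieldNormedType.Exports.

Local Open Scope classical_set_scope.
Local Open Scope complex_scope.
Local Open Scope ring_scope.

(* The eigenvalue is complex, so every function space is taken over [R[i]].
   The forms are linear in the trial argument and conjugate-linear in the test
   argument. *)

Section Plane.
Variable R : realType.
Implicit Types (x y z a b : R * R) (D : set (R * R)).

(* The norm of the normed module [R * R] is the maximum norm (it provides the
   topology); lengths are Euclidean. *)
Definition edot x y : R := x.1 * y.1 + x.2 * y.2.
Definition enorm x : R := Num.sqrt (edot x x).

Definition seg a b : set (R * R) :=
  [set x | exists2 t : R, 0 <= t <= 1 & x = (1 - t) *: a + t *: b].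

Definition leb2 : set (measurableTypeR R * measurableTypeR R) -> \bar R :=
  (lebesgue_measure \x lebesgue_measure)%E.

Definition abs2 (z : R[i]) : R := complex.Re z ^+ 2 + complex.Im z ^+ 2.

Definition cint2 D (f : R * R -> R[i]) : R[i] :=
  Rintegral leb2 D (fun x => complex.Re (f x)) +i*
  Rintegral leb2 D (fun x => complex.Im (f x)).

(* Line integral over the segment [a, b] with respect to arc length. *)
Definition rint_seg a b (f : R * R -> R) : R :=
  enorm (b - a) *
  Rintegral lebesgue_measure `[0, 1] (fun t : R => f ((1 - t) *: a + t *: b)).

Definition cint_seg a b (f : R * R -> R[i]) : R[i] :=
  rint_seg a b (fun x => complex.Re (f x)) +i*
  rint_seg a b (fun x => complex.Im (f x)).

Definition cpartial (w : R * R) (f : R * R -> R[i]) x : R[i] :=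
  'D_w (fun y => complex.Re (f y)) x +i* 'D_w (fun y => complex.Im (f y)) x.

Definition e1 : R * R := (1, 0).
Definition e2 : R * R := (0, 1).

Definition cgrad (f : R * R -> R[i]) x : R[i] * R[i] :=
  (cpartial e1 f x, cpartial e2 f x).

Definition cdiv (q : R * R -> R[i] * R[i]) x : R[i] :=
  cpartial e1 (fun y => (q y).1) x + cpartial e2 (fun y => (q y).2) x.

(* Hermitian product of C^2, and product of a complex by a real vector. *)
Definition hdot (p q : R[i] * R[i]) : R[i] := p.1 * conjc q.1 + p.2 * conjc q.2.
Definition ndot (p : R[i] * R[i]) (n : R * R) : R[i] :=
  p.1 * n.1%:C + p.2 * n.2%:C.

Definition smooth (phi : R * R -> R) : Prop :=
  forall (ws : seq (R * R)) x,
    differentiable (foldr (fun w (f : R * R -> R) y => 'D_w f y) phi ws) x.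

Definition rgrad (phi : R * R -> R) x : R * R := ('D_e1 phi x, 'D_e2 phi x).

Definition test_function (Omega : set (R * R)) (phi : R * R -> R) : Prop :=
  smooth phi /\
  exists A : set (R * R),
    [/\ compact A, A `<=` Omega & forall x, ~ A x -> phi x = 0].

Definition square_integrable D (f : R * R -> R[i]) : Prop :=
  let T := (measurableTypeR R * measurableTypeR R)%type in
  [/\ measurable_fun (D : set T) (fun x : T => complex.Re (f x)),
      measurable_fun (D : set T) (fun x : T => complex.Im (f x)) &
      (\int[leb2]_(x in D) (abs2 (f x))%:E < +oo)%E].

(* [q] belongs to H(div; Omega) and its distributional divergence is [d]. *)
Definition Hdiv (Omega : set (R * R)) (q : R * R -> R[i] * R[i])
    (d : R * R -> R[i]) : Prop :=
  [/\ square_integrable Omega (fun x => (q x).1),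
      square_integrable Omega (fun x => (q x).2),
      square_integrable Omega d &
      forall phi, test_function Omega phi ->
        cint2 Omega (fun x => ndot (q x) (rgrad phi x)) =
        - cint2 Omega (fun x => d x * (phi x)%:C)].

(* [Omega = (closure Omega)°] rules out slits and punctures. *)
Definition polygonal_domain (Omega : set (R * R)) : Prop :=
  [/\ Omega !=set0, open Omega, connected Omega,
      bounded_set Omega &
      Omega = (closure Omega)° /\
      exists (m : nat) (a b : 'I_m -> R * R),
        closure Omega `\` Omega = \bigcup_i seg (a i) (b i)].

(* Polynomials of degree at most [j] in two variables. *)
Definition polyP (j : nat) (f : R * R -> R[i]) : Prop :=
  exists c : nat -> nat -> R[i], forall x,
    f x = \sum_(k < j.+1) \sum_(l < j.+1 | (k + l <= j)%N)
            c k l * (x.1 ^+ k)%:C * (x.2 ^+ l)%:C.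

(* The lowest order Raviart--Thomas functions, P_0^2 + x P_0. *)
Definition polyRT0 (q : R * R -> R[i] * R[i]) : Prop :=
  exists (a : R[i] * R[i]) (b : R[i]), forall x,
    q x = (a.1 + b * x.1%:C, a.2 + b * x.2%:C).

End Plane.

(* A mesh is a finite family of triangles, each given by its three vertices;
   indices in ['I_3] are added modulo 3, and edge [i] is opposite vertex [i]. *)
Record mesh (R : realType) := Mesh {
  ntri : nat;
  vtx : 'I_ntri -> 'I_3 -> R * R
}.

Section Mesh.
Variables (R : realType) (M : mesh R).
Implicit Types (K L : 'I_(ntri M)) (i j : 'I_3).

Definition tri K : set (R * R) :=
  [set x | exists t : 'I_3 -> R,
    [/\ forall i, 0 <= t i, \sum_i t i = 1 & x = \sum_i t i *: vtx K i]].

Definition ea K i : R * R := vtx K (i + 1).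
Definition eb K i : R * R := vtx K (i + 2%:R).
Definition edge K i : set (R * R) := seg (ea K i) (eb K i).

Definition skeleton : set (R * R) := [set x | exists K i, edge K i x].

Definition nondegenerate K : Prop :=
  let p := vtx K 1 - vtx K 0 in let q := vtx K 2%:R - vtx K 0 in
  p.1 * q.2 - p.2 * q.1 != 0.

Definition conforming_triangulation (Omega : set (R * R)) : Prop :=
  [/\ forall K, nondegenerate K,
      closure Omega = \bigcup_K tri K &
      forall K L, K != L ->
        [\/ tri K `&` tri L = set0,
            exists i j, vtx K i = vtx L j /\ tri K `&` tri L = [set vtx K i] |
            exists i j, edge K i = edge L j /\ tri K `&` tri L = edge K i]].

(* The diameter of every triangle is at most [kappa] times the diameter of
   some disc contained in it. *)
Definition shape_regular (kappa : R) : Prop :=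
  forall K, exists z (r : R),
    [/\ 0 < r, [set x | enorm (x - z) <= r] `<=` tri K &
        forall x y, tri K x -> tri K y -> enorm (x - y) <= kappa * (2%:R * r)].

Definition area K : R := fine (leb2 (tri K)).

Definition outer_normal K i : R * R :=
  let d := eb K i - ea K i in
  let nu := (enorm d)^-1 *: (d.2, - d.1) in
  - Num.sg (edot nu (vtx K i - ea K i)) *: nu.

Definition rint_edge K i (f : R * R -> R) : R := rint_seg (ea K i) (eb K i) f.
Definition cint_edge K i (f : R * R -> R[i]) : R[i] :=
  cint_seg (ea K i) (eb K i) f.

(* Piecewise polynomial functions are families indexed by the triangles, each
   member being a polynomial on the whole plane; only its values on the closed
   triangle matter.  Traces are therefore given by evaluation. *)
Definition broken (V : Type) := 'I_(ntri M) -> R * R -> V.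

Definition bP (j : nat) (f : broken R[i]) : Prop := forall K, polyP j (f K).
Definition bP2 (j : nat) (f : broken (R[i] * R[i])) : Prop :=
  bP j (fun K x => (f K x).1) /\ bP j (fun K x => (f K x).2).
Definition bRT0 (f : broken (R[i] * R[i])) : Prop := forall K, polyRT0 (f K).

Definition conforming_P1_0 (Omega : set (R * R)) (w : R * R -> R[i]) : Prop :=
  [/\ {within closure Omega, continuous (fun x => complex.Re (w x))},
      {within closure Omega, continuous (fun x => complex.Im (w x))},
      forall K, exists2 p, polyP 1 p & {in tri K, w =1 p} &
      {in closure Omega `\` Omega, forall x, w x = 0}].

(* Only the values of [uhat] on the skeleton are meaningful. *)
Definition skel_S10 (Omega : set (R * R)) (uhat : R * R -> R[i]) : Prop :=
  exists2 w, conforming_P1_0 Omega w & {in skeleton, uhat =1 w}.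

(* [g K i] is the constant value on edge [i] of [K]. The last clause says that
   [g K] is the normal trace of [q] in H^{-1/2}(bd K): that trace is defined by
   Green's formula, and smooth functions are dense in H^1(K). *)
Definition skel_P0 (Omega : set (R * R)) (g : 'I_(ntri M) -> 'I_3 -> R[i]) :
    Prop :=
  exists q d, Hdiv Omega q d /\
    forall K (phi : R * R -> R), smooth phi ->
      \sum_i cint_edge K i (fun x => g K i * (phi x)%:C) =
      cint2 (tri K) (fun x => ndot (q x) (rgrad phi x)) +
      cint2 (tri K) (fun x => d x * (phi x)%:C).

Record trial := Trial {
  tu : broken R[i];
  tsigma : broken (R[i] * R[i]);
  tuhat : R * R -> R[i];
  tshat : 'I_(ntri M) -> 'I_3 -> R[i]
}.

Record test := Test {
  tv : broken R[i];
  ttau : broken (R[i] * R[i])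
}.

Definition in_Uh (Omega : set (R * R)) (U : trial) : Prop :=
  [/\ bP 0 (tu U), bP2 0 (tsigma U), skel_S10 Omega (tuhat U) &
      skel_P0 Omega (tshat U)].

Definition in_Vh (Y : test) : Prop := bP 1 (tv Y) /\ bRT0 (ttau Y).

Definition bgrad (v : broken R[i]) : broken (R[i] * R[i]) :=
  fun K => cgrad (v K).
Definition bdiv (tau : broken (R[i] * R[i])) : broken R[i] :=
  fun K => cdiv (tau K).

Definition ipL2 (f g : broken R[i]) : R[i] :=
  \sum_K cint2 (tri K) (fun x => f K x * conjc (g K x)).
Definition ipL2v (f g : broken (R[i] * R[i])) : R[i] :=
  \sum_K cint2 (tri K) (fun x => hdot (f K x) (g K x)).

Definition ipV (X Y : test) : R[i] :=
  ipL2 (tv X) (tv Y) + ipL2v (bgrad (tv X)) (bgrad (tv Y)) +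
  ipL2v (ttau X) (ttau Y) + ipL2 (bdiv (ttau X)) (bdiv (ttau Y)).

Definition normV (X : test) : R := Num.sqrt (complex.Re (ipV X X)).

(* For traces of the discrete functions the duality pairings on bd K are
   integrals. *)
Definition pair_uhat (uhat : R * R -> R[i]) (tau : broken (R[i] * R[i])) :
    R[i] :=
  \sum_K \sum_i cint_edge K i
    (fun x => uhat x * conjc (ndot (tau K x) (outer_normal K i))).
Definition pair_shat (v : broken R[i]) (shat : 'I_(ntri M) -> 'I_3 -> R[i]) :
    R[i] :=
  \sum_K \sum_i cint_edge K i (fun x => conjc (v K x) * shat K i).

Definition bform (U : trial) (Y : test) : R[i] :=
  ipL2v (tsigma U) (ttau Y) - ipL2 (tu U) (bdiv (ttau Y)) +
  pair_uhat (tuhat U) (ttau Y) - ipL2v (tsigma U) (bgrad (tv Y)) +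
  pair_shat (tv Y) (tshat U).

Definition discrete_solution (Omega : set (R * R)) (lambda : R[i])
    (U : trial) (X : test) : Prop :=
  [/\ in_Uh Omega U, in_Vh X,
      exists K x, tri K x /\ tu U K x != 0,
      forall Y, in_Vh Y -> ipV X Y + bform U Y = lambda * ipL2 (tu U) (tv Y) &
      forall W, in_Uh Omega W -> bform W X = 0].

Definition neighbour K i : option 'I_(ntri M) :=
  [pick L | (L != K) && `[< exists j, edge L j = edge K i >]].

(* The sign of the jump is the one seen from [K]. *)
Definition jump (q : broken (R[i] * R[i])) K i (x : R * R) : R[i] * R[i] :=
  if neighbour K i is Some L then q K x - q L x else q K x.

Definition jump_estimator2 (q : broken (R[i] * R[i])) : R :=
  \sum_K Num.sqrt (area K) *
    \sum_i rint_edge K i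
      (fun x => abs2 (jump q K i x).1 + abs2 (jump q K i x).2).

End Mesh.

(* Main.v *)
(* Testing the second equation with [w] and [r] gives div tau = 0 and
   tau = grad v, so that tau is piecewise constant and the two jump sums agree.
   Testing with the edgewise constants, each realized by glued lowest order
   Raviart--Thomas fields, shows that v is continuous at the interior edge
   midpoints and vanishes at the boundary ones; testing with continuous piecewise
   affine functions w vanishing on the boundary shows that (grad v, grad w) = 0.
   Because of the midpoint continuity the jump of v at an end of an edge is at
   most half the length of the edge times the jump of grad v. Let w take at each
   interior vertex the value of v on one of the adjacent triangles. Walking from
   triangle to triangle around the vertices bounds v - w, hence also
   |grad v|^2 = (grad v, grad (v - w)), by the jumps, and the Friedrichs
   inequality for w then bounds v. Conversely the jumps of grad v are bounded by
   grad v edge by edge. Real and imaginary parts are treated separately. *)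

(* A mesh is a bare list of vertex triples, so its combinatorics must be extracted from the
   intersection axiom and the covering of [closure Omega]: an edge has at most one neighbour across
   it, an edge without neighbour avoids [Omega], and the triangles around an interior vertex are
   linked through shared edges. At a boundary vertex the triangles may form several such chains
   (parts of the domain touching there), which is why w is 0 there and every chain is compared with
   a boundary edge of its own. The Friedrichs inequality and the glued fields rest on one identity,
   Green's formula for x minus a vertex on a single triangle. Passing to the mesh always means that
   a sum over pairs (triangle, edge) cancels because its terms change sign across the edge; this
   device also serves the midpoint continuity. The Friedrichs constant is a bound for |x| on the
   domain. The other factors are powers of kappa, which come from the inscribed discs, and counting
   factors; the number of triangles at a vertex is bounded by comparing areas, without angles. *)
Require Import Defs.
From mathcomp Require Import all_boot all_order all_algebra.
From mathcomp Require Import all_classical all_reals all_analysis.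
From mathcomp Require Import complex measurable_realfun.
From mathcomp Require Import ring lra.

Set Implicit Arguments.
Unset Strict Implicit.
Unset Printing Implicit Defensive.

Import Order.TTheory GRing.Theory Num.Theory.
Import numFieldNormedType.Exports.

Local Open Scope classical_set_scope.
Local Open Scope complex_scope.
Local Open Scope ring_scope.

(** * Affine change of variables *)

Section AffineMeasure.
Variable R : realType.
Local Notation mu := (@lebesgue_measure R).
Local Notation leb := (mu \x mu)%E.
Local Notation T1 := (measurableTypeR R).
Local Notation T2 := (measurableTypeR R * measurableTypeR R)%type.

Definition image_measure d d' (S1 : measurableType d) (S2 : measurableType d')
    (m : {measure set S1 -> \bar R}) (f : S1 -> S2)
    (mf : measurable_fun setT f) : {measure set S2 -> \bar R} :=
  measure_function_pushforward__canonical__measure_function_Measure m mf.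

Lemma measurable_affine (a c : R) :
  measurable_fun setT ((fun s => a * s + c) : T1 -> T1).
Proof.
by apply: measurable_realfun.measurable_funD => //;
  apply: measurable_realfun.measurable_funM.
Qed.

(** Uniqueness of Lebesgue measure: [|a|] times the image measure gives half-open intervals their
    length. For [a < 0] the preimage is closed at the other end, hence the two cases. *)
Lemma lebesgue_affine_preimage (a c : R) (B : set T1) : a != 0 ->
  measurable B ->
  mu ((fun s : R => (a * s + c)%R) @^-1` B) = ((`|a|^-1)%:E * mu B)%E.
Proof.
move=> a0 mB.
have aN0 : 0 < `|a| by rewrite normr_gt0.
have mphi := measurable_affine a c.
have E : mu B = (`|a|%:E * mu ((fun s : R => (a * s + c)%R) @^-1` B))%E.
  pose m' : {measure set T1 -> \bar R} :=
    mscale (NngNum (normr_ge0 a)) (image_measure mu mphi).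
  have -> : (`|a|%:E * mu ((fun s : R => (a * s + c)%R) @^-1` B))%E = m' B by [].
  apply: (@lebesgue_measure_unique R m') => // _ [[x y]] _ <-.
  change (mu `]x, y] = `|a|%:E * mu ((fun s : R => (a * s + c)%R) @^-1` `]x, y]))%E.
  move: a0; rewrite neq_lt => /orP[a0|a0].
    have -> : (fun s => a * s + c) @^-1` `]x, y] = `[(y - c) / a, (x - c)/a[%classic.
      apply/seteqP; split => s /=; rewrite !in_itv/=.
        rewrite ler_ndivrMr// ltr_ndivlMr//.
        rewrite [s * a]mulrC => /andP[? ?]; apply/andP; split; lra.
      rewrite ler_ndivrMr// ltr_ndivlMr//.
      rewrite [s * a]mulrC => /andP[? ?]; apply/andP; split; lra.
    rewrite !lebesgue_measure_itv/= !lte_fin ltr_nM2r ?invr_lt0// ltrD2r.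
    case: ifPn => // _; last by rewrite mule0.
    rewrite -!EFinD -EFinM; congr EFin.
    rewrite ltr0_norm//; field. by rewrite lt_eqF.
  have -> : (fun s => a * s + c) @^-1` `]x, y] = `](x - c) / a, (y - c)/a]%classic.
    apply/seteqP; split => s /=; rewrite !in_itv/=.
      rewrite ler_pdivlMr// ltr_pdivrMr//.
      rewrite [s * a]mulrC => /andP[? ?]; apply/andP; split; lra.
    rewrite ler_pdivlMr// ltr_pdivrMr//.
    rewrite [s * a]mulrC => /andP[? ?]; apply/andP; split; lra.
  rewrite !lebesgue_measure_itv/= !lte_fin ltr_pM2r ?invr_gt0// ltrD2r.
  case: ifPn => // _; last by rewrite mule0.
  rewrite -!EFinD -EFinM; congr EFin.
  rewrite gtr0_norm//; field. by rewrite gt_eqF.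
by rewrite E muleA -EFinM mulVf ?mul1e// gt_eqF.
Qed.

Lemma measurable_affine2 (a b c : R) :
  measurable_fun setT (fun u : T2 => a * u.1 + b * u.2 + c : T1).
Proof.
apply: measurable_realfun.measurable_funD => //.
apply: measurable_realfun.measurable_funD.
  apply: measurable_realfun.measurable_funM => //.
apply: measurable_realfun.measurable_funM => //.
Qed.

Lemma measurable_affine_pair (a b c a' b' c' : R) :
  measurable_fun setT (fun u : T2 =>
    (a * u.1 + b * u.2 + c : T1, a' * u.1 + b' * u.2 + c' : T1)).
Proof.
by apply/measurable_fun_pairP; split; exact: measurable_affine2.
Qed.

Definition hmap (a b c : R) (u : T2) : T2 := (a * u.1 + b * u.2 + c, u.2).
Definition vmap (a b c : R) (u : T2) : T2 := (u.1, a * u.1 + b * u.2 + c).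

(** A product measure is determined by its values on rectangles, and the horizontal sections of the
    preimage of a rectangle are affine preimages of its first factor. *)
Lemma leb2_hmap (a b c : R) (B : set T2) : a != 0 -> measurable B ->
  leb ((hmap a b c) @^-1` B) =
  ((`|a|^-1)%:E * leb B)%E.
Proof.
move=> a0 mB.
have mf : measurable_fun setT (hmap a b c).
  by apply/measurable_fun_pairP; split; [exact: measurable_affine2|exact: measurable_snd].
pose m' := mscale (NngNum (normr_ge0 a)) (image_measure leb mf) : {measure set T2 -> \bar R}.
have E : leb B = (`|a|%:E * leb ((hmap a b c) @^-1` B))%E.
  rewrite -[RHS]/(m' B).
  apply: product_measure_unique => // A1 A2 mA1 mA2.
  change (m' (A1 `*` A2)) with (`|a|%:E * leb ((hmap a b c) @^-1` (A1 `*` A2)))%E.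
  (* Sections at fixed second coordinate are wanted, since [hmap] leaves that coordinate alone; this
     exchanges the order of integration. *)
  rewrite (@product_measure_unique _ _ _ _ R mu mu (mu \x^ mu)%E); last 2 first.
  - by move=> *; exact: product_measure2E.
  - by rewrite -[X in measurable X]setTI; apply: (mf) => //; exact: measurableX.
  rewrite /= /product_measure2/=.
  transitivity (`|a|%:E * \int[mu]_y ((`|a|^-1)%:E * mu A1 * (\1_A2 y)%:E))%E.
    congr (_ * _)%E; apply: eq_integral => y _.
    rewrite /ysection/=.
    have [yA|yA] := boolP (y \in A2).
      rewrite indicE yA mule1 -(lebesgue_affine_preimage (b * y + c) a0 mA1).
      congr (mu _); apply/seteqP; split => x /=; rewrite inE/= addrA; first by case.
      by move=> ?; split=> //; exact: set_mem.
    rewrite indicE (negbTE yA) mule0 -(measure0 mu); congr (mu _).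
    apply/seteqP; split => x //=; rewrite inE/= => -[_].
    by move: yA; rewrite notin_setE.
  rewrite ge0_integralZl//=; last 2 first.
  - by apply/measurable_EFinP; exact: measurable_indic.
  - by rewrite mule_ge0// lee_fin invr_ge0.
  by rewrite integral_indic// setIT !muleA -EFinM mulfV ?mul1e// normr_eq0.
by rewrite E muleA -EFinM mulVf ?mul1e// normr_eq0.
Qed.

Lemma leb2_vmap (a b c : R) (B : set T2) : b != 0 -> measurable B ->
  leb ((vmap a b c) @^-1` B) =
  ((`|b|^-1)%:E * leb B)%E.
Proof.
move=> b0 mB.
have mf : measurable_fun setT (vmap a b c).
  by apply/measurable_fun_pairP; split; [exact: measurable_fst|exact: measurable_affine2].
pose m' := mscale (NngNum (normr_ge0 b)) (image_measure leb mf) : {measure set T2 -> \bar R}.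
have E : leb B = (`|b|%:E * leb ((vmap a b c) @^-1` B))%E.
  rewrite -[RHS]/(m' B).
  apply: product_measure_unique => // A1 A2 mA1 mA2.
  change (m' (A1 `*` A2)) with (`|b|%:E * leb ((vmap a b c) @^-1` (A1 `*` A2)))%E.
  rewrite /= /product_measure1/=.
  transitivity (`|b|%:E * \int[mu]_x ((`|b|^-1)%:E * mu A2 * (\1_A1 x)%:E))%E.
    congr (_ * _)%E; apply: eq_integral => x _.
    rewrite /xsection/=.
    have [xA|xA] := boolP (x \in A1).
      rewrite indicE xA mule1 -(lebesgue_affine_preimage (a * x + c) b0 mA2).
      congr (mu _); apply/seteqP; split => y /=; rewrite inE/= addrA [b * y + _]addrC;
        first by case.
      by move=> ?; split=> //; exact: set_mem.
    rewrite indicE (negbTE xA) mule0 -(measure0 mu); congr (mu _).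
    apply/seteqP; split => y //=; rewrite inE/= => -[].
    by move: xA; rewrite notin_setE.
  rewrite ge0_integralZl//=; last 2 first.
  - by apply/measurable_EFinP; exact: measurable_indic.
  - by rewrite mule_ge0// lee_fin invr_ge0.
  rewrite integral_indic// setIT !muleA -EFinM mulfV ?mul1e ?normr_eq0//.
  by rewrite muleC.
by rewrite E muleA -EFinM mulVf ?mul1e// normr_eq0.
Qed.

(* A linear map is the composite of a horizontal and a vertical one, after a
   column operation if [p1 = 0]. *)
Lemma leb2_affine (p1 p2 q1 q2 c1 c2 : R) (B : set T2) :
  p1 * q2 - p2 * q1 != 0 -> measurable B ->
  leb ((fun u : T2 => (p1 * u.1 + q1 * u.2 + c1, p2 * u.1 + q2 * u.2 + c2) : T2)
        @^-1` B) =
  ((`|p1 * q2 - p2 * q1|^-1)%:E * leb B)%E.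
Proof.
wlog p10 : p1 p2 q1 q2 B / p1 != 0 => [hwlog|D0 mB].
  have [p10 D0 mB|p10] := eqVneq p1 0; last by move=> *; apply: hwlog.
  have q10 : q1 != 0 by apply: contraNneq D0 => ->; rewrite p10 mul0r mulr0 subrr.
  have := hwlog (p1 - q1) (p2 - q2) q1 q2 B.
  rewrite p10 sub0r oppr_eq0 => /(_ q10).
  have DE : - q1 * q2 - (p2 - q2) * q1 = p1 * q2 - p2 * q1 by rewrite p10; ring.
  rewrite DE => /(_ D0 mB); rewrite p10 => <-.
  set C := (X in _ = leb X).
  have mC : measurable C.
    by rewrite -[X in measurable X]setTI; apply: measurable_affine_pair.
  (* The map with columns [p - q] and [q], applied after the shear [(u.1, u.1 + u.2)] of determinant
     1, is the original map. *)
  have := @leb2_vmap 1 1 0 C (oner_neq0 _) mC.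
  rewrite normr1 invr1 mul1e => <-; congr (leb _).
  apply/seteqP; split => u; rewrite /C/=.
    by congr (B (_ , _)); ring.
  by congr (B (_ , _)); ring.
have -> : (fun u : T2 => (p1 * u.1 + q1 * u.2 + c1, p2 * u.1 + q2 * u.2 + c2) : T2)
    @^-1` B = hmap p1 q1 c1 @^-1`
   (vmap (p2 / p1) ((p1 * q2 - p2 * q1) / p1) (c2 - p2 / p1 * c1) @^-1` B).
  apply/seteqP; split => u; rewrite /hmap /vmap/=.
    by congr (B (_ , _)); field.
  by congr (B (_ , _)); field.
have d0 : (p1 * q2 - p2 * q1) / p1 != 0 by rewrite mulf_neq0// invr_neq0.
rewrite leb2_hmap// ?leb2_vmap//; last first.
  rewrite -[X in measurable X]setTI.
  have : measurable_fun setT (vmap (p2 / p1) ((p1 * q2 - p2 * q1) / p1) (c2 - p2 / p1 * c1)).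
    by apply/measurable_fun_pairP; split; [exact: measurable_fst|exact: measurable_affine2].
  exact.
rewrite muleA -EFinM normrM normfV; congr (_%:E * _)%E.
by field; rewrite ?normr_eq0 ?p10 ?D0.
Qed.

End AffineMeasure.

(** * Green's formula on a triangle *)

Section Plane2.
Variable R : realType.
Local Notation mu := (@lebesgue_measure R).
Local Notation leb := (mu \x mu)%E.
Local Notation T1 := (measurableTypeR R).
Local Notation T2 := (measurableTypeR R * measurableTypeR R)%type.

(** Openness refers to the norm topology, measurability to the product sigma-algebra; countably many
    rational boxes connect the two. *)
Lemma open_measurable2 (U : set (R * R)) : open U -> measurable (U : set T2).
Proof.
move=> oU.
pose box (q : (rat * rat) * (rat * rat)) : set T2 :=
  `]ratr q.1.1, ratr q.1.2[%classic `*` `]ratr q.2.1, ratr q.2.2[%classic.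
pose F q : set T2 := if `[< box q `<=` U >] then box q else set0.
have -> : (U : set T2) = \bigcup_q F q.
  apply/seteqP; split => [[x y] Uxy|x [q _]]; last first.
    by rewrite /F; case: asboolP => // sub /sub.
  have [e /= e0 sub] : exists2 e : R, 0 < e & ball (x, y) e `<=` U.
    by move: oU; rewrite openE => /(_ _ Uxy) /nbhs_ballP[e e0 ?]; exists e.
  have xl : x - e < x by rewrite ltrBlDr ltrDl.
  have xr : x < x + e by rewrite ltrDl.
  have yl : y - e < y by rewrite ltrBlDr ltrDl.
  have yr : y < y + e by rewrite ltrDl.
  have [a /[!in_itv]/= /andP[a1 a2]] := rat_in_itvoo xl.
  have [b /[!in_itv]/= /andP[b1 b2]] := rat_in_itvoo xr.
  have [c /[!in_itv]/= /andP[c1 c2]] := rat_in_itvoo yl.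
  have [d /[!in_itv]/= /andP[d1 d2]] := rat_in_itvoo yr.
  exists ((a, b), (c, d)) => //; rewrite /F; case: asboolP => [_|].
    by split; rewrite /= in_itv/=; apply/andP; split.
  case=> -[u v] [/=]; rewrite !in_itv/= => /andP[ua ub] /andP[vc vd].
  apply: sub; split => /=; rewrite /ball/= ltr_norml; apply/andP; split; lra.
apply: countable_bigcupT_measurable => // q.
rewrite /F; case: ifP => // _; exact: measurableX.
Qed.

Lemma closed_measurable2 (A : set (R * R)) :
  closed A -> measurable (A : set T2).
Proof. by move/closed_openC/open_measurable2/measurableC; rewrite setCK. Qed.

Lemma continuous_measurable_fun2 (f : R * R -> R) :
  continuous f -> measurable_fun setT (f : T2 -> T1).
Proof.
move=> cf; apply: (measurability _ (RGenOpens.measurableE R)).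
move=> _ [_ [a [b ->] <-]]; rewrite setTI; apply: open_measurable2.
by move/continuousP : cf; apply; exact: interval_open.
Qed.

Definition rtri : set (R * R) := [set u | [/\ 0 <= u.1, 0 <= u.2 & u.1 + u.2 <= 1]].

Lemma closed_rtri : closed rtri.
Proof.
have -> : rtri = [set u | 0 <= u.1] `&` [set u | 0 <= u.2] `&` [set u | u.1 + u.2 <= 1].
  by apply/seteqP; split => u /=; [case|case=> -[]].
have c1 : continuous (fun u : R * R => u.1) by move=> u; exact: cvg_fst.
have c2 : continuous (fun u : R * R => u.2) by move=> u; exact: cvg_snd.
apply: closedI; [apply: closedI|].
- exact: (closed_comp (f := fun u : R * R => u.1) (D := [set x : R | 0 <= x])
    (fun x _ => c1 x) (@closed_ge _ _)).
- exact: (closed_comp (f := fun u : R * R => u.2) (D := [set x : R | 0 <= x])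
    (fun x _ => c2 x) (@closed_ge _ _)).
- apply: (closed_comp (f := fun u : R * R => u.1 + u.2) (D := [set x : R | x <= 1])
    _ (@closed_le _ _)).
  by move=> x _; apply: continuousD; [exact: c1|exact: c2].
Qed.

Lemma measurable_rtri : measurable (rtri : set T2).
Proof. by apply: closed_measurable2; exact: closed_rtri. Qed.

Lemma rtri_subset : rtri `<=` `[0, 1]%classic `*` `[0, 1]%classic.
Proof.
move=> [s t] [/= s0 t0 st]; split; rewrite /= in_itv/=; apply/andP; split => //.
  by apply: le_trans st; rewrite lerDl.
by apply: le_trans st; rewrite lerDr.
Qed.

Lemma leb_rtri_fin : (leb (rtri : set T2) < +oo)%E.
Proof.
apply: (@le_lt_trans _ _ (leb (`[0, 1]%classic `*` `[0, 1]%classic : set T2))).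
  apply: le_measure; rewrite ?inE; [exact: measurable_rtri|exact: measurableX|exact: rtri_subset].
rewrite [ltLHS](_ : _ = (mu `[0%R, 1%R] * mu `[0%R, 1%R])%E); last exact: product_measure1E.
rewrite lebesgue_measure_itv/= lte_fin ltr01.
by rewrite -EFinD -EFinM ltry.
Qed.

Lemma continuous_bounded_on (A : set (R * R)) (f : R * R -> R) :
  compact A -> continuous f -> [bounded f x | x in A].
Proof.
move=> cA cf; have : compact (f @` A).
  by apply: continuous_compact => //; apply: continuous_subspaceT.
move/compact_bounded => [M [Mr HM]]; exists M; split => // x Mx y Ay.
by apply: HM => //; exists y.
Qed.

Lemma compact_square : compact (`[0, 1]%classic `*` `[0, 1]%classic : set (R * R)).
Proof. by apply: compact_setX; exact: segment_compact. Qed.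

Lemma integrable_rtri (f : R * R -> R) : continuous f ->
  leb.-integrable (rtri : set T2) (EFin \o f).
Proof.
move=> cf; apply: measurable_bounded_integrable; [exact: measurable_rtri|exact: leb_rtri_fin| |].
  by apply: measurable_funTS; exact: continuous_measurable_fun2.
have [M [Mr HM]] := continuous_bounded_on compact_square cf.
by exists M; split => // x Mx y /rtri_subset; exact: HM.
Qed.

Lemma continuous_pair (T : topologicalType) (g h : T -> R) :
  continuous g -> continuous h -> continuous (fun t => (g t, h t)).
Proof.
move=> cg ch t.
exact: (@cvg_pair T R R (nbhs t) (nbhs (g t)) (nbhs (h t)) _ _ _ g h (cg t) (ch t)).
Qed.

Lemma continuous_pair1 (f : R * R -> R) (g h : R -> R) :
  continuous f -> continuous g -> continuous h -> continuous (fun t => f (g t, h t)).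
Proof.
move=> cf cg ch t.
by apply: (@continuous_comp _ _ _ (fun t => (g t, h t)) f); [exact: continuous_pair|exact: cf].
Qed.

Lemma integrable_itv01 (f : R -> R) : continuous f ->
  mu.-integrable `[0, 1]%classic (EFin \o f).
Proof.
move=> cf; apply: continuous_compact_integrable; first exact: segment_compact.
exact: continuous_subspaceT.
Qed.

(** The degenerate case [b = 0] is included because the horizontal chord of the reference triangle
    shrinks to a point at the apex. *)
Lemma FTC2_itv (g g' : R -> R) (b : R) : 0 <= b -> continuous g' ->
  (forall s, is_derive (s : R) (1 : R) g (g' s)) ->
  (\int[mu]_(s in `[0%R, b]) (g' s)%:E)%E = (g b - g 0)%:E.
Proof.
rewrite le_eqVlt => /predU1P[<- _ _|b0 cg' dg].
  by rewrite set_itv1 integral_set1 subrr.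
have cg : continuous g.
  move=> s; apply: differentiable_continuous; apply/derivable1_diffP.
  by have := dg s; case.
rewrite (@continuous_FTC2 _ g' g) ?EFinB//.
- exact: continuous_subspaceT.
- split; first by move=> s _; have := dg s; case.
  + exact/cvg_at_right_filter/cg.
  + exact/cvg_at_left_filter/cg.
- by move=> s _; rewrite derive1E; have := dg s; case.
Qed.

(** Fubini: at height [t] the section of the triangle is the interval from 0 to [1 - t], to which
    the fundamental theorem applies. *)
Lemma rtri_green (g g' : R * R -> R) : continuous g -> continuous g' ->
  (forall s t, is_derive (s : R) (1 : R) (fun s => g (s, t)) (g' (s, t))) ->
  Rintegral leb (rtri : set T2) g' =
  Rintegral mu `[0, 1]%classic (fun t => g (1 - t, t) - g (0, t)).
Proof.
move=> cg cg' dg; rewrite /Rintegral; congr fine.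
have I := iffLR (integrable_mkcond _ measurable_rtri) (integrable_rtri cg').
rewrite integral_mkcond -(integral21_prod_meas1 I).
rewrite [RHS]integral_mkcond; apply: eq_integral => t _.
rewrite /fubini_G patchE; case: ifPn => [|]; rewrite ?inE ?notin_setE/= in_itv/=.
  move=> /andP[t0 t1].
  rewrite -(@FTC2_itv (fun s => g (s, t)) (fun s => g' (s, t)) (1 - t)) ?subr_ge0//; last first.
    by apply: continuous_pair1 => // s; [exact: cvg_id|exact: cvg_cst].
  rewrite [RHS]integral_mkcond; apply: eq_integral => s _.
  rewrite !patchE; congr (if _ then _ else _); apply/idP/idP.
    by rewrite !inE/= in_itv/= => -[/= s0 _ st]; apply/andP; split=> //; lra.
  by rewrite !inE/= in_itv/= => /andP[s0 s1]; split => //=; lra.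
move=> /negP t01; apply: integral0_eq => s _; rewrite patchE ifN// notin_setE => -[/= s0 t0 st].
by case/negP: t01; apply/andP; split => //; lra.
Qed.

Definition aff2 (c p q : R * R) (u : R * R) : R * R := c + (u.1 *: p + u.2 *: q).

Definition cross (p q : R * R) : R := p.1 * q.2 - p.2 * q.1.

Lemma aff2E c p q u :
  aff2 c p q u = (p.1 * u.1 + q.1 * u.2 + c.1, p.2 * u.1 + q.2 * u.2 + c.2).
Proof. by rewrite /aff2 -!(mulrC u.1) -!(mulrC u.2) addrC. Qed.

Lemma continuous_affine (a b c : R) : continuous (fun u : R * R => a * u.1 + b * u.2 + c).
Proof.
move=> u; apply: cvgD; last exact: cvg_cst.
apply: cvgD; apply: cvgM; try exact: cvg_cst.
  exact: cvg_fst.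
exact: cvg_snd.
Qed.

Lemma continuous_aff2 c p q : continuous (aff2 c p q).
Proof.
have -> : aff2 c p q = fun u => (p.1 * u.1 + q.1 * u.2 + c.1, p.2 * u.1 + q.2 * u.2 + c.2).
  by apply/funext => u; exact: aff2E.
by apply: continuous_pair; exact: continuous_affine.
Qed.

Lemma Rintegral_aff2 (c p q : R * R) (D : set T2) (f : R * R -> R) :
  cross p q != 0 -> measurable D -> continuous f ->
  leb.-integrable (aff2 c p q @^-1` D : set T2) (EFin \o (f \o aff2 c p q)) ->
  Rintegral leb D f =
  `|cross p q| * Rintegral leb (aff2 c p q @^-1` D : set T2) (f \o aff2 c p q).
Proof.
move=> d0 mD cf intf.
have mf : measurable_fun setT (aff2 c p q : T2 -> T2).
  have -> : (aff2 c p q : T2 -> T2) = fun u : T2 =>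
    (p.1 * u.1 + q.1 * u.2 + c.1 : T1, p.2 * u.1 + q.2 * u.2 + c.2 : T1).
    by apply/funext => u; exact: aff2E.
  exact: measurable_affine_pair.
have mfE : measurable_fun setT (fun x : T2 => (f x)%:E).
  by apply/measurable_EFinP; exact: continuous_measurable_fun2.
pose m' := image_measure leb mf.
have E A : measurable A -> A `<=` D -> leb A = mscale (NngNum (normr_ge0 (cross p q))) m' A.
  move=> mA _.
  change (leb A = (`|cross p q|%:E * leb (aff2 c p q @^-1` A))%E).
  have -> : aff2 c p q @^-1` A = (fun u : T2 =>
    (p.1 * u.1 + q.1 * u.2 + c.1, p.2 * u.1 + q.2 * u.2 + c.2) : T2) @^-1` A.
    by apply/seteqP; split => u /=; rewrite aff2E.
  by rewrite leb2_affine// muleA -EFinM mulfV ?mul1e// normr_eq0.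
rewrite /Rintegral (eq_measure_integral _ E).
(* The factor is pulled out of the positive and the negative part separately; integrability allows
   the two to be recombined. *)
rewrite integralE !ge0_integral_mscale//; last 2 first.
  - exact/measurable_funeneg/measurable_funTS.
  - exact/measurable_funepos/measurable_funTS.
rewrite /= -muleBr//; last first.
  by rewrite integrable_add_def//; exact: integrable_pushforward.
rewrite -integralE.
rewrite /m' (integral_pushforward mf)//.
rewrite fineM//.
apply: integrable_fin_num => //; rewrite -[X in measurable X]setTI.
exact: (mf measurableT _ mD).
Qed.

End Plane2.

Section Green.
Variable R : realType.
Local Notation mu := (@lebesgue_measure R).
Local Notation leb := (mu \x mu)%E.
Local Notation T1 := (measurableTypeR R).
Local Notation T2 := (measurableTypeR R * measurableTypeR R)%type.
Implicit Types c p q x : R * R.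

Definition ptri c p q : set (R * R) := aff2 c p q @` (@rtri R).

Lemma aff2_inj c p q : cross p q != 0 -> injective (aff2 c p q).
Proof.
move=> d0 [a b] [a' b']; rewrite !aff2E /= => -[h1 h2].
have {h1}E1 : p.1 * (a - a') + q.1 * (b - b') = 0 by lra.
have {h2}E2 : p.2 * (a - a') + q.2 * (b - b') = 0 by lra.
have Ea : cross p q * (a - a') = 0.
  rewrite /cross.
  transitivity (q.2 * (p.1 * (a - a') + q.1 * (b - b')) - q.1 * (p.2 * (a - a') +
    q.2 * (b - b'))); first ring.
  by rewrite E1 E2; ring.
have Eb : cross p q * (b - b') = 0.
  rewrite /cross.
  transitivity (p.1 * (p.2 * (a - a') + q.2 * (b - b')) - p.2 * (p.1 * (a - a') +
    q.1 * (b - b'))); first ring.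
  by rewrite E1 E2; ring.
move/eqP: Ea; rewrite mulf_eq0 (negbTE d0)/= subr_eq0 => /eqP ->.
by move/eqP: Eb; rewrite mulf_eq0 (negbTE d0)/= subr_eq0 => /eqP ->.
Qed.

Lemma ptri_preimage c p q : cross p q != 0 ->
  aff2 c p q @^-1` ptri c p q = (@rtri R).
Proof.
move=> d0; apply/seteqP; split => u /=; last by exists u.
by case=> v rv /(aff2_inj d0) <-.
Qed.

Lemma ptri_swap c p q : ptri c q p = ptri c p q.
Proof.
apply/seteqP; split => _ [u [u1 u2 u3] <-]; exists (u.2, u.1) => //=;
  rewrite /aff2/=; try (by split => //=; rewrite addrC).
all: by rewrite [_ *: _ + _]addrC.
Qed.

Lemma compact_ptri c p q : compact (ptri c p q).
Proof.
apply: continuous_compact.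
  exact/continuous_subspaceT/continuous_aff2.
by apply: (subclosed_compact (@closed_rtri R) (@compact_square R)); exact: rtri_subset.
Qed.

Lemma measurable_ptri c p q : measurable (ptri c p q : set T2).
Proof.
apply: closed_measurable2; apply: compact_closed; last exact: compact_ptri.
exact: norm_hausdorff.
Qed.

Lemma leb_ptri c p q : cross p q != 0 ->
  leb (ptri c p q : set T2) = (`|cross p q|%:E * leb (@rtri R : set T2))%E.
Proof.
move=> d0; rewrite -(ptri_preimage c d0).
have -> : aff2 c p q @^-1` ptri c p q = (fun u : T2 =>
  (p.1 * u.1 + q.1 * u.2 + c.1, p.2 * u.1 + q.2 * u.2 + c.2) : T2) @^-1` ptri c p q.
  by apply/seteqP; split => u /=; rewrite aff2E.
rewrite leb2_affine//; last exact: measurable_ptri.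
by rewrite muleA -EFinM mulfV ?mul1e// normr_eq0.
Qed.

Lemma leb_ptri_fin c p q : cross p q != 0 -> (leb (ptri c p q : set T2) < +oo)%E.
Proof.
move=> d0; rewrite leb_ptri// lte_mul_pinfty//; last exact: leb_rtri_fin.
Qed.

Lemma integrable_ptri c p q (f : R * R -> R) : cross p q != 0 -> continuous f ->
  leb.-integrable (ptri c p q : set T2) (EFin \o f).
Proof.
move=> d0 cf; apply: measurable_bounded_integrable; [exact: measurable_ptri|exact: leb_ptri_fin| |].
  by apply: measurable_funTS; exact: continuous_measurable_fun2.
by apply: continuous_bounded_on => //; exact: compact_ptri.
Qed.

Lemma is_derive_line (F : R * R -> R) (x0 p : R * R) (s : R) (d : R) :
  is_derive (x0 + s *: p) p F d ->
  is_derive (s : R) (1 : R) (fun s => F (x0 + s *: p)) d.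
Proof.
move=> dF.
have E : (fun h : R => h^-1 *: (((fun s =>
  F (x0 + s *: p)) \o shift s) (h *: (1 : R)) - F (x0 + s *: p)))
   = (fun h : R => h^-1 *: ((F \o shift (x0 + s *: p)) (h *: p) - F (x0 + s *: p))).
  apply/funext => h /=; congr (_ *: (F _ - _)).
  by rewrite /GRing.scale/= mulr1 -/(GRing.scale _ _) scalerDl addrCA.
split; first by rewrite /derivable E; have := dF; case.
by rewrite /derive E; have := dF; case.
Qed.

(** Fubini along chords parallel to [p]: each runs from the side through [c] in direction [q] to the
    side opposite [c]. *)
Lemma green_ptri c p q (F F' : R * R -> R) : cross p q != 0 ->
  continuous F -> continuous F' -> (forall x, is_derive x p F (F' x)) ->
  Rintegral leb (ptri c p q : set T2) F' =
  `|cross p q| * Rintegral mu `[0, 1]%classic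
     (fun t => F (c + (1 - t) *: p + t *: q) - F (c + t *: q)).
Proof.
move=> d0 cF cF' dF.
rewrite (@Rintegral_aff2 _ c p q)//; last 2 first.
- exact: measurable_ptri.
- rewrite ptri_preimage//; apply: integrable_rtri => u.
  by apply: continuous_comp; [exact: continuous_aff2|exact: cF'].
have dG (s t : R) : is_derive (s : R) (1 : R)
    (fun s => (F \o aff2 c p q) (s, t)) ((F' \o aff2 c p q) (s, t)).
  have -> : (fun s => (F \o aff2 c p q) (s, t)) = (fun s => F (c + t *: q + s *: p)).
    by apply/funext => r; rewrite /= /aff2/= [r *: p + _]addrC addrA.
  apply: is_derive_line.
  have -> : c + t *: q + s *: p = aff2 c p q (s, t) by rewrite /aff2/= [s *: p + _]addrC addrA.
  exact: dF.
rewrite ptri_preimage// (rtri_green _ _ dG).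
- congr (_ * _); apply: eq_Rintegral => t _; rewrite /= /aff2/= scale0r add0r.
  by rewrite addrA.
- by move=> u; apply: continuous_comp; [exact: continuous_aff2|exact: cF].
- by move=> u; apply: continuous_comp; [exact: continuous_aff2|exact: cF'].
Qed.

(** The gradient is carried as explicit data, so that affine functions and smooth test functions are
    treated alike and products need only the Leibniz rule. *)
Definition C1grad (phi D1 D2 : R * R -> R) : Prop :=
  [/\ continuous phi, continuous D1, continuous D2 &
    forall x w : R * R, is_derive x w phi (w.1 * D1 x + w.2 * D2 x)].

Lemma C1grad_affine (a b k : R) :
  C1grad (fun x => a * x.1 + b * x.2 + k) (fun=> a) (fun=> b).
Proof.
split; [exact: continuous_affine|exact: cst_continuous|exact: cst_continuous|].
move=> x w.
have E : (fun h : R => h^-1 *: (((fun x : R * R =>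
  a * x.1 + b * x.2 + k) \o shift x) (h *: w) - (a * x.1 + b * x.2 + k)))
   @ 0^' --> w.1 * a + w.2 * b.
  apply: (@cvg_trans _ ((fun=> w.1 * a + w.2 * b) @ (0 : R)^')); last exact: cvg_cst.
  apply: near_eq_cvg; near=> h.
  have h0 : h != 0 by near: h; exact: nbhs_dnbhs_neq.
  rewrite /= /GRing.scale/=; field.
  exact: h0.
split; first by apply/cvg_ex; eexists; exact: E.
by apply/cvg_lim => //; exact: E.
Unshelve. all: by end_near.
Qed.

Lemma C1gradM phi D1 D2 psi E1 E2 : C1grad phi D1 D2 -> C1grad psi E1 E2 ->
  C1grad (fun x => phi x * psi x) (fun x => phi x * E1 x + psi x * D1 x)
    (fun x => phi x * E2 x + psi x * D2 x).
Proof.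
move=> [c d1 d2 d] [c' e1 e2 e]; split.
- by move=> x; apply: cvgM; [exact: c|exact: c'].
- move=> x; apply: cvgD; apply: cvgM; [exact: c|exact: e1|exact: c'|exact: d1].
- move=> x; apply: cvgD; apply: cvgM; [exact: c|exact: e2|exact: c'|exact: d2].
- move=> x w; have := is_deriveM (d x w) (e x w).
  rewrite (_ : phi x *: _ + _ = w.1 * (phi x * E1 x + psi x * D1 x) +
     w.2 * (phi x * E2 x + psi x * D2 x)); first exact.
  by rewrite /GRing.scale/=; ring.
Qed.

(** The empty list of directions gives differentiability of [phi], the one-element lists give
    continuity of the partial derivatives. *)
Lemma smooth_C1grad (phi : R * R -> R) : smooth phi ->
  C1grad phi (fun x => 'D_(e1 R) phi x) (fun x => 'D_(e2 R) phi x).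
Proof.
move=> sm; split.
- by move=> x; apply: differentiable_continuous; exact: (sm [::] x).
- by move=> x; apply: differentiable_continuous; exact: (sm [:: e1 R] x).
- by move=> x; apply: differentiable_continuous; exact: (sm [:: e2 R] x).
- move=> x w; have dx := sm [::] x; rewrite /= in dx.
  split; first exact: diff_derivable.
  rewrite !deriveE//.
  have {1}-> : w = w.1 *: e1 R + w.2 *: e2 R.
    by case: w => a b; rewrite /e1 /e2; congr pair;
      rewrite /= /GRing.scale/= ?mulr1 ?mulr0 ?addr0 ?add0r.
  by rewrite linearD !linearZ.
Qed.

Lemma Rintegral01_onem (f : R -> R) : continuous f ->
  Rintegral mu `[0, 1]%classic (fun t => f (1 - t)) = Rintegral mu `[0, 1]%classic f.
Proof.
move=> cf; have := @Rintegration_by_substitution_onem R f 1.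
rewrite /unstable.onem subrr => <- //; first by rewrite ler01 lexx.
exact: continuous_subspaceT.
Qed.

(** The divergence theorem for the field [x - c] multiplied by [phi]. Since [x - c] is [l1 x] times
    [p] plus [l2 x] times [q], the divergence is the [p]-derivative of [l1 phi] plus the
    [q]-derivative of [l2 phi]. After [green_ptri] the sides through [c] contribute nothing, because
    [l1] or [l2] vanishes there, and on the opposite side [l1 + l2 = 1]. *)
Lemma rt0_green c p q phi D1 D2 : cross p q != 0 -> C1grad phi D1 D2 ->
  Rintegral leb (ptri c p q : set T2)
    (fun x => (x - c).1 * D1 x + (x - c).2 * D2 x + 2 * phi x) =
  `|cross p q| * Rintegral mu `[0, 1]%classic
     (fun t => phi (c + (1 - t) *: p + t *: q)).
Proof.
move=> d0 Cphi; have [cphi cD1 cD2 dphi] := Cphi.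
pose l1 x := cross (x - c) q / cross p q.
pose l2 x := cross p (x - c) / cross p q.
pose D := cross p q.
have C1 : C1grad l1 (fun=> q.2 / D) (fun=> - q.1 / D).
  have -> : l1 = fun x => q.2 / D * x.1 + (- q.1 / D) * x.2 + (- (c.1 * q.2 - c.2 * q.1) / D).
    by apply/funext => x; rewrite /l1 -/D /cross /=; field.
  exact: C1grad_affine.
have C2 : C1grad l2 (fun=> - p.2 / D) (fun=> p.1 / D).
  have -> : l2 = fun x => (- p.2 / D) * x.1 + (p.1 / D) * x.2 + (- (p.1 * c.2 - p.2 * c.1) / D).
    by apply/funext => x; rewrite /l2 -/D /cross /=; field.
  exact: C1grad_affine.
have [cF1 cF11 cF12 dF1] := C1gradM C1 Cphi.
have [cF2 cF21 cF22 dF2] := C1gradM C2 Cphi.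
have cont2 (f g : R * R -> R) (a b : R) : continuous f -> continuous g ->
    continuous (fun x => a * f x + b * g x).
  by move=> cf cg x; apply: cvgD; apply: cvgM; try exact: cvg_cst; [exact: cf|exact: cg].
have d0' : cross q p != 0.
  by rewrite (_ : cross q p = - cross p q) ?oppr_eq0// /cross; ring.
have G1 := green_ptri c d0 cF1 (cont2 _ _ _ _ cF11 cF12) (fun x => dF1 x p).
have G2 := green_ptri c d0' cF2 (cont2 _ _ _ _ cF21 cF22) (fun x => dF2 x q).
rewrite (ptri_swap c p q) in G2.
transitivity (Rintegral leb (ptri c p q : set T2) (fun x =>
  (p.1 * (l1 x * D1 x + phi x * (q.2 / D)) + p.2 * (l1 x * D2 x + phi x * (- q.1 / D))) +
  (q.1 * (l2 x * D1 x + phi x * (- p.2 / D)) + q.2 * (l2 x * D2 x + phi x * (p.1 / D))))).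
  apply: eq_Rintegral => x _; rewrite /l1 /l2 -/D.
  have D0 : p.1 * q.2 - p.2 * q.1 != 0 := d0.
  by rewrite /D /cross /=; field.
rewrite RintegralD; last 3 first.
- exact: measurable_ptri.
- by apply: integrable_ptri => //; exact: cont2.
- by apply: integrable_ptri => //; exact: cont2.
rewrite {}G1 {}G2.
have -> : `|cross q p| = `|cross p q|.
  by rewrite -normrN; congr Num.norm; rewrite /cross; ring.
rewrite -mulrDr; congr (_ * _).
have cont3 (f : R * R -> R) (x0 : R * R) (g h : R -> R) : continuous f -> continuous g ->
  continuous h ->
    continuous (fun t => f (x0 + g t *: p + h t *: q)).
  move=> cf cg ch.
  have -> : (fun t => f (x0 + g t *: p + h t *: q)) = (fun t => (f \o aff2 x0 p q) (g t, h t)).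
    by apply/funext => t; rewrite /= /aff2/= addrA.
  apply: continuous_pair1 => // u; apply: continuous_comp; [exact: continuous_aff2|exact: cf].
have l1E t : l1 (c + (1 - t) *: p + t *: q) = 1 - t.
  by rewrite /l1 /cross/= ; rewrite /GRing.scale/=; field.
have l10 t : l1 (c + t *: q) = 0.
  by rewrite /l1 /cross/= ; rewrite /GRing.scale/=; field.
have l2E t : l2 (c + (1 - t) *: q + t *: p) = 1 - t.
  by rewrite /l2 /cross/= ; rewrite /GRing.scale/=; field.
have l20 t : l2 (c + t *: p) = 0.
  by rewrite /l2 /cross/= ; rewrite /GRing.scale/=; field.
have c1m : continuous (fun t : R => 1 - t).
  by move=> t; apply: cvgB; [exact: cvg_cst|exact: cvg_id].
have cidt : continuous (fun t : R => t) by move=> t; exact: cvg_id.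
under eq_Rintegral do rewrite l1E l10 mul0r subr0.
under [X in _ + X]eq_Rintegral do rewrite l2E l20 mul0r subr0.
have cphi1 := cont3 phi c _ _ cphi c1m cidt.
(* The chords in direction [q] parametrize the opposite side from [c + q] to [c + p]; reversing [t]
   brings both integrals to the same parametrization. *)
have -> : Rintegral mu `[0, 1]%classic (fun t => (1 - t) * phi (c + (1 - t) *: q + t *: p)) =
  Rintegral mu `[0, 1]%classic (fun t => t * phi (c + (1 - t) *: p + t *: q)).
  rewrite -[RHS]Rintegral01_onem; last by move=> t; apply: cvgM; [exact: cvg_id|exact: cphi1].
  apply: eq_Rintegral => t _; congr (_ * phi _).
  by rewrite subKr addrAC.
rewrite -RintegralD//.
- by apply: eq_Rintegral => t _; ring.
- by apply: integrable_itv01 => t; apply: cvgM; [exact: c1m|exact: cphi1].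
- by apply: integrable_itv01 => t; apply: cvgM; [exact: cvg_id|exact: cphi1].
Qed.

End Green.

(** * Barycentric coordinates *)

Section Barycentric.
Variables (R : realType) (M : mesh R).
Implicit Types (K L : 'I_(ntri M)) (i j k : 'I_3) (x y z : R * R).

Lemma pair_eqP x y : x.1 = y.1 -> x.2 = y.2 -> x = y.
Proof. by case: x y => [? ?] [? ?] /= -> ->. Qed.

Lemma I3_ind (P : 'I_3 -> Prop) : P 0 -> P 1 -> P 2%:R -> forall i, P i.
Proof.
move=> P0 P1 P2 [[|[|[|//]]] h].
- by rewrite (_ : Ordinal h = 0)//; exact: val_inj.
- by rewrite (_ : Ordinal h = 1)//; exact: val_inj.
- by rewrite (_ : Ordinal h = 2%:R)//; exact: val_inj.
Qed.

Lemma I3E : ((0 : 'I_3) + 1 = 1) * ((1 : 'I_3) + 1 = 2%:R) * ((2%:R : 'I_3) + 1 = 0) *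
  ((0 : 'I_3) + 2%:R = 2%:R) * ((1 : 'I_3) + 2%:R = 0) * ((2%:R : 'I_3) + 2%:R = 1) .
Proof. by do !split; exact: val_inj. Qed.

Lemma I3_shift_ind (P : 'I_3 -> Prop) i : P i -> P (i + 1) -> P (i + 2%:R) -> forall j, P j.
Proof.
by elim/I3_ind: i; rewrite !I3E => *; apply: I3_ind.
Qed.

Lemma sum_I3 (V : zmodType) (F : 'I_3 -> V) i : \sum_j F j = F i + F (i + 1) + F (i + 2%:R).
Proof.
have E : \sum_j F j = F 0 + F 1 + F 2%:R.
  rewrite !big_ord_recr big_ord0/= add0r; congr (F _ + F _ + F _); exact: val_inj.
rewrite E; elim/I3_ind: i; rewrite !I3E //.
  by rewrite [RHS]addrC addrA.
by rewrite -[RHS]addrA [RHS]addrC.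
Qed.

(** Twice the signed area; the vertices may be listed in either orientation, so the sign is free. *)
Definition det K : R := cross (vtx K 1 - vtx K 0) (vtx K 2%:R - vtx K 0).

(** The barycentric coordinate of vertex [i] as a quotient of signed areas; it vanishes on the line
    carrying edge [i]. *)
Definition bary K i x : R := cross (ea K i - x) (eb K i - x) / det K.

(** With [bgy], the constant gradient of [bary K i]. *)
Definition bgx K i : R := ((ea K i).2 - (eb K i).2) / det K.
Definition bgy K i : R := ((eb K i).1 - (ea K i).1) / det K.

Lemma baryE K i x : bary K i x = bgx K i * x.1 + bgy K i * x.2 + cross (ea K i) (eb K i) / det K.
Proof. by rewrite /bary /bgx /bgy /cross/=; ring. Qed.

Lemma det_cyc K i : cross (vtx K (i + 1) - vtx K i) (vtx K (i + 2%:R) - vtx K i) = det K.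
Proof. by elim/I3_ind: i; rewrite !I3E /det /cross/=; ring. Qed.

Lemma bary_sum K i x : det K != 0 ->
  bary K i x + bary K (i + 1) x + bary K (i + 2%:R) x = 1.
Proof.
move=> d0; suff E : \sum_j bary K j x = 1 by rewrite -E (sum_I3 _ i).
rewrite (sum_I3 _ 0) !I3E /bary /ea /eb !I3E -!mulrDl -[RHS](mulfV d0); congr (_ / _).
by rewrite /det /cross/=; ring.
Qed.

Lemma bary_recon K i x : det K != 0 ->
  x = bary K i x *: vtx K i + bary K (i + 1) x *: vtx K (i + 1) +
      bary K (i + 2%:R) x *: vtx K (i + 2%:R).
Proof.
move=> d0; have E : x = \sum_j bary K j x *: vtx K j; last first.
  by rewrite {1}E (sum_I3 _ i).
rewrite (sum_I3 _ 0) !I3E /bary /ea /eb !I3E.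
have := d0; rewrite /det /cross/= => D.
by apply: pair_eqP; rewrite /= /GRing.scale/=; field.
Qed.

Lemma bary_comb K i j (t : 'I_3 -> R) : \sum_k t k = 1 ->
  det K != 0 -> bary K i (\sum_k t k *: vtx K k) = t i.
Proof.
move=> t1 d0; move: t1; rewrite !(sum_I3 _ i) => t1.
have {t1}-> : t i = 1 - t (i + 1) - t (i + 2%:R) by rewrite -t1; ring.
rewrite /bary; apply: (canLR (mulfK d0)).
by rewrite -(det_cyc K i) /cross /ea /eb /= /GRing.scale/=; ring.
Qed.

Lemma triP K x : det K != 0 -> tri K x <-> (forall i, 0 <= bary K i x).
Proof.
move=> d0; split => [[t [t0 t1 ->]] i|h].
  by rewrite bary_comb.
exists (fun i => bary K i x); split => //.
  by rewrite (sum_I3 _ 0) bary_sum.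
by rewrite (sum_I3 _ 0) -bary_recon.
Qed.

Lemma bary_vtx K i : det K != 0 -> bary K i (vtx K i) = 1.
Proof. by move=> d0; rewrite /bary -(det_cyc K i) mulfV// det_cyc. Qed.

Lemma bary_vtx1 K i : bary K i (vtx K (i + 1)) = 0.
Proof. by rewrite /bary /ea subrr /cross/= !mul0r subr0 mul0r. Qed.

Lemma bary_vtx2 K i : bary K i (vtx K (i + 2%:R)) = 0.
Proof. by rewrite /bary /eb subrr /cross/= !mulr0 subr0 mul0r. Qed.

Lemma tri_vtx K i : tri K (vtx K i).
Proof.
exists (fun j => (j == i)%:R); split => //.
- by rewrite (bigD1 i)//= eqxx big1 ?addr0// => j /negPf ->.
- rewrite (bigD1 i)//= eqxx scale1r big1 ?addr0// => j /negPf ->.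
  by rewrite scale0r.
Qed.

(** Any vertex may serve as base point, so that Green's formula for [x - c] is available at all
    three. *)
Lemma tri_ptri K i : det K != 0 ->
  tri K = ptri (vtx K i) (vtx K (i + 1) - vtx K i) (vtx K (i + 2%:R) - vtx K i).
Proof.
move=> d0; apply/seteqP; split => x.
  move/(triP _ d0) => h; exists (bary K (i + 1) x, bary K (i + 2%:R) x).
    split => //=; have := bary_sum i x d0; have := h i; lra.
  rewrite {3}(bary_recon i x d0) /aff2/=.
  have -> : bary K i x = 1 - bary K (i + 1) x - bary K (i + 2%:R) x.
    by rewrite -(bary_sum i x d0); ring.
  by apply: pair_eqP; rewrite /= /GRing.scale/=; ring.
case=> -[s t] [/= s0 t0 st] <-.
apply/(triP _ d0).
have E : aff2 (vtx K i) (vtx K (i + 1) - vtx K i) (vtx K (i + 2%:R) - vtx K i) (s, t) =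
  (1 - s - t) *: vtx K i + s *: vtx K (i + 1) + t *: vtx K (i + 2%:R).
  by apply: pair_eqP; rewrite /aff2/= /GRing.scale/=; ring.
have Ei : bary K i ((1 - s - t) *: vtx K i + s *: vtx K (i + 1) + t *: vtx K (i + 2%:R)) =
  1 - s - t.
  rewrite /bary; apply: (canLR (mulfK d0)).
  by rewrite -(det_cyc K i) /cross /ea /eb /= /GRing.scale/=; ring.
have E1 : bary K (i+1) ((1 - s - t) *: vtx K i + s *: vtx K (i + 1) + t *: vtx K (i + 2%:R)) = s.
  rewrite /bary; apply: (canLR (mulfK d0)).
  rewrite -(det_cyc K i).
  by elim/I3_ind: i {E Ei}; rewrite /cross /ea /eb !I3E /= /GRing.scale/=; ring.
have E2 : bary K (i+2%:R) ((1 - s - t) *: vtx K i + s *: vtx K (i + 1) + t *: vtx K (i + 2%:R)) = t.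
  rewrite /bary; apply: (canLR (mulfK d0)).
  rewrite -(det_cyc K i).
  by elim/I3_ind: i {E Ei E1}; rewrite /cross /ea /eb !I3E /= /GRing.scale/=; ring.
rewrite E; apply: (I3_shift_ind (i := i)); rewrite ?Ei ?E1 ?E2//; lra.
Qed.

End Barycentric.

(** * Edges, vertices and boundary of a conforming triangulation *)

Section Topology.
Variables (R : realType) (M : mesh R) (Omega : set (R * R)).
Hypotheses (Oopen : open Omega) (Oreg : Omega = (closure Omega)°).
Hypothesis Mconf : conforming_triangulation M Omega.
Implicit Types (K L : 'I_(ntri M)) (i j k : 'I_3) (x y z : R * R).

Lemma det_neq0 K : det K != 0.
Proof. by case: Mconf => + _ _; exact. Qed.
Local Hint Resolve det_neq0 : core.

Lemma tri_closure K : tri K `<=` closure Omega.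
Proof. by case: Mconf => _ -> _ x Kx; exists K. Qed.

Lemma closure_tri x : closure Omega x -> exists K, tri K x.
Proof. by case: Mconf => _ -> _ [K _ Kx]; exists K. Qed.

Lemma I3_neq i : ((i + 1 == i) = false) * ((i + 2%:R == i) = false) *
  ((i + 1 == i + 2%:R) = false) * ((i + 2%:R == i + 1) = false) *
  ((i == i + 1) = false) * ((i == i + 2%:R) = false).
Proof. by elim/I3_ind: i; rewrite !I3E. Qed.

Lemma bary_continuous K i : continuous (bary K i).
Proof.
have -> : bary K i = (fun x => bgx K i * x.1 + bgy K i * x.2 + cross (ea K i) (eb K i) / det K).
  by apply/funext => x; exact: baryE.
exact: continuous_affine.
Qed.

Lemma bary_aff K i (s t : R) x y : s + t = 1 ->
  bary K i (s *: x + t *: y) = s * bary K i x + t * bary K i y.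
Proof.
move=> st; have -> : s = 1 - t by rewrite -st addrK.
by rewrite !baryE /= /GRing.scale/=; ring.
Qed.

Lemma near_bary_gt0 K i x : 0 < bary K i x -> \forall y \near x, 0 < bary K i y.
Proof. by move=> h; apply: (cvgr_gt _ (@bary_continuous K i x)). Qed.

Lemma tri_closed K : closed (tri K).
Proof.
rewrite (tri_ptri 0 (det_neq0 K)); apply: compact_closed; last exact: compact_ptri.
exact: norm_hausdorff.
Qed.

Lemma bary_ea K i j : bary K j (ea K i) = (j == i + 1)%:R.
Proof.
rewrite /ea; have [->|] := eqVneq; first by rewrite bary_vtx.
elim/I3_ind: i; elim/I3_ind: j; rewrite !I3E ?eqxx// => _.
- by have := bary_vtx1 K 0; rewrite !I3E.
- by have := bary_vtx2 K 2%:R; rewrite !I3E.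
- by have := bary_vtx2 K 0; rewrite !I3E.
- by have := bary_vtx1 K 1; rewrite !I3E.
- by have := bary_vtx2 K 1; rewrite !I3E.
- by have := bary_vtx1 K 2%:R; rewrite !I3E.
Qed.

Lemma bary_vtxE K i j : bary K j (vtx K i) = (j == i)%:R.
Proof.
have -> : i = i + 2%:R + 1 by elim/I3_ind: i; rewrite !I3E.
exact: bary_ea.
Qed.

Lemma bary_eb K i j : bary K j (eb K i) = (j == i + 2%:R)%:R.
Proof. exact: bary_vtxE. Qed.

Lemma bary_inj K x y : (forall i, bary K i x = bary K i y) -> x = y.
Proof. by move=> h; rewrite (bary_recon 0 x (det_neq0 K)) !h -bary_recon. Qed.

Lemma edgeP K i x : edge K i x <-> bary K i x = 0 /\ forall j, 0 <= bary K j x.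
Proof.
split=> [[t /andP[t0 t1] ->]|[h0 h]].
  have h j : bary K j ((1 - t) *: ea K i + t *: eb K i) =
    (1 - t) * (j == i + 1)%:R + t * (j == i + 2%:R)%:R.
    by rewrite bary_aff ?subrK// bary_ea bary_eb.
  split => [|j]; rewrite h.
    by elim/I3_ind: i {h}; rewrite !I3E !mulr0 addr0.
  by rewrite addr_ge0// mulr_ge0// ?subr_ge0// ler0n.
exists (bary K (i + 2%:R) x).
  rewrite h/=; have := bary_sum i x (det_neq0 K); have := h (i + 1); lra.
rewrite {1}(bary_recon i x (det_neq0 K)) h0 scale0r add0r.
have := bary_sum i x (det_neq0 K); rewrite h0 add0r => <-.
by rewrite addrK.
Qed.

Lemma edge_tri K i : edge K i `<=` tri K.
Proof. by move=> x /edgeP[_ h]; apply/triP. Qed.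

(** Conformity leaves a common vertex or a common edge, and either lies on an edge of [K]. This
    refutes any point interior to one triangle and contained in another. *)
Lemma overlap K L x : K != L -> tri K x -> tri L x -> exists i, bary K i x = 0.
Proof.
move=> KL Kx Lx; case: Mconf => _ _ /(_ _ _ KL)[h|[i [j [_ h]]]|[i [j [_ h]]]].
- by have : (tri K `&` tri L) x by []; rewrite h.
- have : (tri K `&` tri L) x by []; rewrite h /= => ->.
  by exists (i + 1); rewrite bary_vtxE; elim/I3_ind: i {h}; rewrite !I3E.
- have : (tri K `&` tri L) x by []; rewrite h => /edgeP[+ _]; by exists i.
Qed.

(** End points are extreme points. If [s] and [t] are the parameters of [a] and [b] on the other
    segment, both 0 and 1 are convex combinations of [s] and [t], which themselves lie between 0 and
    1; this forces them to be 0 and 1 in some order. *)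
Lemma seg_inj (a b c d : R * R) : a != b -> seg a b = seg c d ->
  (a = c /\ b = d) \/ (a = d /\ b = c).
Proof.
move=> ab E.
have sa : seg a b a by exists 0; rewrite ?lexx ?ler01// subr0 scale1r scale0r addr0.
have sb : seg a b b by exists 1; rewrite ?lexx ?ler01// subrr scale1r scale0r add0r.
have sc : seg c d c by exists 0; rewrite ?lexx ?ler01// subr0 scale1r scale0r addr0.
have sd : seg c d d by exists 1; rewrite ?lexx ?ler01// subrr scale1r scale0r add0r.
rewrite E in sa sb; rewrite -E in sc sd.
move: sa sb sc sd => [s /andP[s0 s1] sE] [t /andP[t0 t1] tE] [u /andP[u0 u1] uE] [v /andP[v0 v1]
  vE].
have dc : d != c.
  by apply: contra_neq ab => dc; rewrite sE tE dc -!scalerDl !subrK.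
have st : (1 - u) * s + u * t = 0.
  have : ((1 - u) * s + u * t) *: (d - c) = 0.
    transitivity ((1 - u) *: a + u *: b - c); last by rewrite -uE subrr.
    rewrite sE tE.
    by apply: pair_eqP; rewrite /= /GRing.scale/=; ring.
  by move/eqP; rewrite scaler_eq0 subr_eq0 (negbTE dc) orbF => /eqP.
have st1 : (1 - v) * s + v * t = 1.
  have : ((1 - v) * s + v * t - 1) *: (d - c) = 0.
    transitivity ((1 - v) *: a + v *: b - d); last by rewrite -vE subrr.
    rewrite sE tE.
    by apply: pair_eqP; rewrite /= /GRing.scale/=; ring.
  by move/eqP; rewrite scaler_eq0 [_ || (d - c == 0)]orbC subr_eq0 (negbTE dc)/= subr_eq0 => /eqP.
have h1 : s = 0 /\ t = 1 \/ s = 1 /\ t = 0.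
  have p1 : 0 <= (1 - u) * s by rewrite mulr_ge0// subr_ge0.
  have p2 : 0 <= u * t by rewrite mulr_ge0.
  have /eqP : (1 - u) * s = 0 by lra.
  have /eqP : u * t = 0 by lra.
  rewrite !mulf_eq0 subr_eq0 => /orP[] /eqP h /orP[] /eqP h'.
  - by move: st1; rewrite h h' in p1 p2 *; lra.
  - by left; split => //; move: st1; rewrite h' mulr0 add0r; nra.
  - by right; split => //; move: st1; rewrite h mulr0 addr0; nra.
  - by move: st1; rewrite h h' !mulr0; lra.
case: h1 => -[hs ht]; [left|right]; rewrite sE tE hs ht.
  by rewrite subr0 subrr !scale1r !scale0r addr0 add0r.
by rewrite subr0 subrr !scale1r !scale0r addr0 add0r.
Qed.

Lemma ea_neq_eb K i : ea K i != eb K i.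
Proof.
apply/eqP => h; have := bary_ea K i (i + 1); rewrite h bary_eb eqxx.
by elim/I3_ind: i {h}; rewrite !I3E/= => /eqP; rewrite eq_sym oner_eq0.
Qed.

Lemma edge_eqP K i L j : edge K i = edge L j ->
  (ea K i = ea L j /\ eb K i = eb L j) \/ (ea K i = eb L j /\ eb K i = ea L j).
Proof. exact/seg_inj/ea_neq_eb. Qed.

Lemma bary_line K i x : bary K i x = 0 ->
  x = bary K (i + 1) x *: ea K i + bary K (i + 2%:R) x *: eb K i.
Proof.
move=> h0; rewrite {1}(bary_recon i x (det_neq0 K)) h0 scale0r add0r.
by [].
Qed.

(** The order of the end points is fixed before [x], and [x] ranges over the whole line:
    [fan_covers] applies one and the same alternative to two points, one possibly beyond the
    edge. *)
Lemma edge_eq_bary_or K i L j : edge K i = edge L j ->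
  (forall x, bary K i x = 0 -> [/\ bary L j x = 0,
    bary L (j + 1) x = bary K (i + 1) x & bary L (j + 2%:R) x = bary K (i + 2%:R) x]) \/
  (forall x, bary K i x = 0 -> [/\ bary L j x = 0,
    bary L (j + 1) x = bary K (i + 2%:R) x & bary L (j + 2%:R) x = bary K (i + 1) x]).
Proof.
move=> E; have H x : bary K i x = 0 -> bary K (i + 1) x + bary K (i + 2%:R) x = 1.
  by move=> h0; have := bary_sum i x (det_neq0 K); rewrite h0 add0r.
case: (edge_eqP E) => -[ha hb]; [left|right] => x h0; have s1 := H _ h0;
  rewrite {1 2 4}(bary_line h0) ha hb !bary_aff// !bary_ea !bary_eb !I3_neq !eqxx !mulr0 !mulr1
    ?addr0 ?add0r.
  by split.
by split.
Qed.

Lemma edge_eq_bary K i L j x : edge K i = edge L j -> bary K i x = 0 ->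
  bary L j x = 0 /\
  ((bary L (j + 1) x = bary K (i + 1) x /\ bary L (j + 2%:R) x = bary K (i + 2%:R) x) \/
   (bary L (j + 1) x = bary K (i + 2%:R) x /\ bary L (j + 2%:R) x = bary K (i + 1) x)).
Proof.
move=> /edge_eq_bary_or[] H /H[h0 h1 h2]; split=> //; [left|right]; by split.
Qed.

Lemma continuous_segment x y : continuous (fun t : R => (1 - t) *: x + t *: y).
Proof.
have -> : (fun t : R => (1 - t) *: x + t *: y) =
    (fun t => ((1 - t) * x.1 + t * y.1, (1 - t) * x.2 + t * y.2)) by [].
apply: continuous_pair => t; (apply: cvgD; apply: cvgM;
  [apply: cvgB|..]; by [exact: cvg_cst|exact: cvg_id]).
Qed.

Lemma cvg_line x y : (1 - e) *: x + e *: y @[e --> (0 : R)^'+] --> x.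
Proof.
have := cvg_at_right_filter (@continuous_segment x y 0).
by rewrite subr0 scale1r scale0r addr0.
Qed.

(** Both coordinates are affine and vanish on the common line, so they are proportional; the overlap
    property forces a negative factor. *)
Lemma opposite K i L j x : K != L -> edge K i = edge L j ->
  bary K i x * bary L j x <= 0.
Proof.
move=> KL E.
have [s [s2 sE]] : exists s : R, s ^+ 2 = 1 /\
    forall y, bary L j y * det L = s * (bary K i y * det K).
  rewrite /bary; case: (edge_eqP E) => -[-> ->].
    by exists 1; rewrite expr1n; split=> // y; rewrite !mulfVK ?mul1r.
  exists (-1); rewrite sqrrN expr1n; split=> // y; rewrite !mulfVK//.
  by rewrite /cross; ring.
have key : s * det K * det L < 0.
  rewrite ltNge; apply/negP => h.
  have sK : s * det K / det L > 0.
    have d2 : 0 < det L ^+ 2 by rewrite exprn_even_gt0//= det_neq0.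
    have dE : s * det K * det L = s * det K / det L * det L ^+ 2 by field.
    rewrite -(pmulr_lgt0 _ d2) -dE.
    rewrite lt_neqAle h andbT eq_sym !mulf_neq0//.
    by apply/eqP => s0; move: s2; rewrite s0 expr0n => /eqP; rewrite eq_sym oner_eq0.
  have sE' y : bary L j y = s * det K / det L * bary K i y.
    by apply: (mulIf (det_neq0 L)); rewrite sE; field.
  pose m := 2^-1 *: ea K i + 2^-1 *: eb K i.
  have half : 2^-1 + 2^-1 = 1 :> R by field.
  have mK k : bary K k m = 2^-1 * (k == i + 1)%:R + 2^-1 * (k == i + 2%:R)%:R.
    by rewrite /m bary_aff// bary_ea bary_eb.
  have h0 : bary K i m = 0.
    by rewrite mK; elim/I3_ind: i {E sE sE' m mK}; rewrite !I3E !mulr0 addr0.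
  have h1 : bary K (i + 1) m = 2^-1.
    by rewrite mK; elim/I3_ind: i {E sE sE' m mK h0}; rewrite !I3E/= mulr0 mulr1 addr0.
  have h2 : bary K (i + 2%:R) m = 2^-1.
    by rewrite mK; elim/I3_ind: i {E sE sE' m mK h0 h1}; rewrite !I3E/= mulr0 mulr1 add0r.
  have [_ hL] := edge_eq_bary E h0.
  have {hL}[hL1 hL2] : bary L (j + 1) m = 2^-1 /\ bary L (j + 2%:R) m = 2^-1.
    by case: hL => -[-> ->]; rewrite h1 h2.
  have pos : 0 < 2^-1 :> R by rewrite invr_gt0.
  (* From the edge midpoint towards the third vertex of [K]: with a positive factor, the first
     points reached would be interior to both triangles. *)
  pose g (e : R) := (1 - e) *: m + e *: vtx K i.
  have cg : g e @[e --> 0^'+] --> m. exact: cvg_line.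
  have near1 (N : 'I_(ntri M)) k : 0 < bary N k m -> \forall e \near 0^'+, 0 < bary N k (g e).
    by move=> hN; exact: cg (near_bary_gt0 hN).
  have : \forall e \near (0:R)^'+, False.
    near=> e.
    have e0 : 0 < e by near: e; exact: nbhs_right_gt.
    have K0 : 0 < bary K i (g e) by rewrite bary_aff ?subrK// h0 mulr0 add0r bary_vtxE eqxx mulr1.
    have K1 : 0 < bary K (i + 1) (g e) by near: e; apply: near1; rewrite h1.
    have K2 : 0 < bary K (i + 2%:R) (g e) by near: e; apply: near1; rewrite h2.
    have L0 : 0 < bary L j (g e) by rewrite sE' mulr_gt0.
    have L1 : 0 < bary L (j + 1) (g e) by near: e; apply: near1; rewrite hL1.
    have L2 : 0 < bary L (j + 2%:R) (g e) by near: e; apply: near1; rewrite hL2.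
    have Kp : forall k, 0 < bary K k (g e) by exact: (I3_shift_ind (i := i)).
    have Lp : forall k, 0 < bary L k (g e) by exact: (I3_shift_ind (i := j)).
    have [k k0] : exists k, bary K k (g e) = 0.
      by apply: (overlap KL); apply/triP => // k; exact: ltW.
    by have := Kp k; rewrite k0 ltxx.
  by move/filter_ex => [].
have : bary K i x * bary L j x * (det L) ^+ 2 <= 0.
  rewrite (_ : _ * _ = (bary K i x) ^+ 2 * (s * det K * det L)).
    by apply: mulr_ge0_le0; [exact: sqr_ge0|exact: ltW].
  by rewrite expr2 mulrA -(mulrA (bary K i x)) sE; ring.
by rewrite pmulr_lle0// exprn_even_gt0//= det_neq0.
Unshelve. all: by end_near.
Qed.

(** Two triangles across the edge from [K] would lie on the same side of it, against [opposite]; the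
    vertex of [K] off the edge is the test point. *)
Lemma shared_edge_unique K L L' i j j' : L != K -> L' != K ->
  edge L j = edge K i -> edge L' j' = edge K i -> L = L'.
Proof.
move=> LK LK' E E'; apply/eqP/negPn/negP => LL'.
have h1 := @opposite _ _ _ _ (vtx K i) LK E.
have h2 := @opposite _ _ _ _ (vtx K i) LK' E'.
have h3 := @opposite _ _ _ _ (vtx K i) LL' (etrans E (esym E')).
rewrite bary_vtxE eqxx mulr1 in h1; rewrite bary_vtxE eqxx mulr1 in h2.
have n1 : bary L j (vtx K i) != 0.
  by apply/eqP => /(edge_eq_bary E)[]; rewrite bary_vtxE eqxx => /eqP; rewrite oner_eq0.
have n2 : bary L' j' (vtx K i) != 0.
  by apply/eqP => /(edge_eq_bary E')[]; rewrite bary_vtxE eqxx => /eqP; rewrite oner_eq0.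
have : 0 < bary L j (vtx K i) * bary L' j' (vtx K i).
  by rewrite nmulr_rgt0 lt_neqAle ?n1 ?n2.
by rewrite ltNge h3.
Qed.

(** By [shared_edge_unique] at most one triangle qualifies, so the [pick] in [neighbour] involves no
    choice. *)
Lemma neighbourP K i L : neighbour K i = Some L <->
  L != K /\ exists j, edge L j = edge K i.
Proof.
rewrite /neighbour; case: pickP => [L' /andP[LK /asboolP[j E]]|h].
  split => [[<-]|[LK' [j' E']]]; first by split => //; exists j.
  by congr Some; apply: (shared_edge_unique LK LK' E E').
split => // -[LK h']; have := h L; rewrite LK/=; by move/asboolP.
Qed.

Lemma neighbour_sym K i L j : L != K -> edge L j = edge K i -> neighbour L j = Some K.
Proof. by move=> LK E; apply/neighbourP; rewrite eq_sym; split => //; exists i. Qed.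

Lemma neighbour_none K i L j : neighbour K i = None -> edge L j = edge K i -> L = K.
Proof.
move=> h E; apply/eqP/negPn/negP => LK.
by have /neighbourP := conj LK (ex_intro (fun j => edge L j = edge K i) j E); rewrite h.
Qed.

Lemma tri_interior K x : (forall i, 0 < bary K i x) -> (tri K)° x.
Proof.
move=> h; have : \forall y \near x, forall i, 0 < bary K i y.
  by near=> y; apply: I3_ind; near: y; exact: near_bary_gt0.
by apply: filterS => y hy; apply/triP => // i; exact: ltW.
Unshelve. all: by end_near.
Qed.

(** A neighbourhood covered by triangles lies in [closure Omega], and [Omega] is the interior of its
    closure. *)
Lemma nbhs_Omega x : (\forall y \near x, exists K, tri K y) -> Omega x.
Proof.
move=> h; rewrite Oreg; apply: filterS h => y [K Ky]; exact: tri_closure Ky.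
Qed.

Lemma interior_Omega K x : (forall i, 0 < bary K i x) -> Omega x.
Proof.
by move/tri_interior => h; apply: nbhs_Omega; apply: filterS h => y; exists K.
Qed.

Lemma near_ge0_shared K L i j y : K != L -> edge K i = edge L j ->
  0 <= bary K i y \/ 0 <= bary L j y.
Proof.
move=> KL E; have := opposite y KL E; case: (leP 0 (bary K i y)) => [|h]; first by left.
by rewrite nmulr_rle0//; right.
Qed.

(** Near [x] the other coordinates stay positive, and by [opposite] one of the two coordinates
    belonging to the common edge is nonnegative; so the two triangles cover a neighbourhood. *)
Lemma shared_edge_Omega K i L x : neighbour K i = Some L -> bary K i x = 0 ->
  0 < bary K (i + 1) x -> 0 < bary K (i + 2%:R) x -> Omega x.
Proof.
move=> /neighbourP[LK [j E]] h0 h1 h2.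
have KL : K != L by rewrite eq_sym.
have [_ hL] := edge_eq_bary (esym E) h0.
have [l1 l2] : 0 < bary L (j + 1) x /\ 0 < bary L (j + 2%:R) x.
  by case: hL => -[-> ->].
apply: nbhs_Omega; near=> y.
have k1 : 0 < bary K (i + 1) y by near: y; exact: near_bary_gt0.
have k2 : 0 < bary K (i + 2%:R) y by near: y; exact: near_bary_gt0.
have m1 : 0 < bary L (j + 1) y by near: y; exact: near_bary_gt0.
have m2 : 0 < bary L (j + 2%:R) y by near: y; exact: near_bary_gt0.
have [h|h] := near_ge0_shared y KL (esym E).
  by exists K; apply/triP => //; apply: (I3_shift_ind (i := i)) => //; exact: ltW.
by exists L; apply/triP => //; apply: (I3_shift_ind (i := j)) => //; exact: ltW.
Unshelve. all: by end_near.
Qed.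

Lemma bary_shrink K x y i (e : R) :
  bary K i ((1 - e) *: x + e *: y) = (1 - e) * bary K i x + e * bary K i y.
Proof. by rewrite bary_aff ?subrK. Qed.

(** Were [x] in [Omega], either a second triangle contains it, and conformity makes that one a
    neighbour across this very edge, or [K] is the only triangle near [x] and the far side of the
    edge stays uncovered. *)
Lemma boundary_edge_interior K i x : neighbour K i = None -> bary K i x = 0 ->
  0 < bary K (i + 1) x -> 0 < bary K (i + 2%:R) x -> ~ Omega x.
Proof.
move=> nb h0 h1 h2 Ox.
have pos k : k != i -> 0 < bary K k x.
  by move: k; apply: (I3_shift_ind (i := i)) => //; rewrite eqxx.
have [[L [LK Lx]]|noL] := pselect (exists L, L != K /\ tri L x).
  have Kx : tri K x.
    by apply/triP => // k; have [->|/pos/ltW] := eqVneq k i; rewrite ?h0.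
  have KL : K != L by rewrite eq_sym.
  case: Mconf => _ _ /(_ _ _ KL)[h|[k [j [_ h]]]|[k [j [E h]]]].
  - by have : (tri K `&` tri L) x by []; rewrite h.
  - have : (tri K `&` tri L) x by []; rewrite h /= => xE.
    have [ki|ki] := eqVneq k i.
      by move: h1; rewrite xE bary_vtxE ki; elim/I3_ind: i {nb h0 h2 pos ki}; rewrite !I3E ltxx.
    have {}h1 : k = i + 1.
      by apply/eqP/negPn/negP => n; move: h1; rewrite xE bary_vtxE eq_sym (negbTE n) ltxx.
    by move: h2; rewrite xE bary_vtxE h1 I3_neq ltxx.
  - have : (tri K `&` tri L) x by []; rewrite h => /edgeP[xk _].
    have ki : k = i.
      by apply/eqP/negPn/negP => /pos; rewrite xk ltxx.
    by move/eqP: LK; apply; apply: (neighbour_none nb (j := j)); rewrite -E ki.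
have cl : closed (\bigcup_(L in [set L | L != K]) tri L).
  by apply: closed_bigcup => [|L _]; [exact: finite_finset|exact: tri_closed].
have nx : \forall y \near x, ~ (\bigcup_(L in [set L | L != K]) tri L) y.
  have := closed_openC cl; rewrite openE; apply.
  by case=> L LK Lx; apply: noL; exists L.
have nO : \forall y \near x, Omega y by move: Oopen; rewrite openE; exact.
(* Moving away from vertex [i] gives [bary K i] the value [- e], so the point has left [K]. *)
pose g (e : R) := (1 - e) *: x + e *: (x + (x - vtx K i)).
have cg : g e @[e --> 0^'+] --> x by exact: cvg_line.
have : \forall e \near (0:R)^'+, False.
  near=> e.
  have e0 : 0 < e by near: e; exact: nbhs_right_gt.
  have Og : Omega (g e) by near: e; exact: cg nO.
  have ng : ~ (\bigcup_(L in [set L | L != K]) tri L) (g e) by near: e; exact: cg nx.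
  have [L Lg] : exists L, tri L (g e) by apply: closure_tri; exact: subset_closure.
  have [LK|LK] := eqVneq L K; last by apply: ng; exists L.
  move: Lg; rewrite LK => /(triP _ (det_neq0 K)) /(_ i).
  rewrite bary_shrink h0 mulr0 add0r.
  have -> : x + (x - vtx K i) = 2 *: x + (-1) *: vtx K i.
    by apply: pair_eqP; rewrite /= /GRing.scale/=; ring.
  rewrite bary_aff; last by ring.
  by rewrite h0 bary_vtxE eqxx mulr0 add0r mulr1 mulrN1 oppr_ge0 leNgt e0.
by move/filter_ex => [].
Unshelve. all: by end_near.
Qed.

(** Every point of the edge, its ends included, is a limit of points of the relative interior, and
    [Omega] is open. *)
Lemma boundary_edge K i x : neighbour K i = None -> edge K i x -> ~ Omega x.
Proof.
move=> nb /edgeP[h0 h] Ox.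
pose m := 2^-1 *: ea K i + 2^-1 *: eb K i.
have half : 2^-1 + 2^-1 = 1 :> R by field.
have pos : 0 < 2^-1 :> R by rewrite invr_gt0.
have mK k : bary K k m = 2^-1 * (k == i + 1)%:R + 2^-1 * (k == i + 2%:R)%:R.
  by rewrite /m bary_aff// bary_ea bary_eb.
have [m0 [m1 m2]] : bary K i m = 0 /\ 0 < bary K (i + 1) m /\ 0 < bary K (i + 2%:R) m.
  by rewrite !mK; elim/I3_ind: i {nb h0 m mK}; rewrite !I3E/= !mulr0 !mulr1 ?addr0 ?add0r.
have cg := @cvg_line x m.
have nO : \forall y \near x, Omega y by move: Oopen; rewrite openE; exact.
have : \forall e \near (0:R)^'+, False.
  near=> e.
  have e0 : 0 < e by near: e; exact: nbhs_right_gt.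
  have e1 : e < 1 by near: e; exact: nbhs_right_lt.
  have Og : Omega ((1 - e) *: x + e *: m) by near: e; exact: cg nO.
  apply: (boundary_edge_interior nb _ _ _ Og); rewrite bary_shrink.
  - by rewrite h0 m0 !mulr0 addr0.
  - by apply: ltr_wpDl; [rewrite mulr_ge0// subr_ge0 ltW|exact: mulr_gt0].
  - by apply: ltr_wpDl; [rewrite mulr_ge0// subr_ge0 ltW|exact: mulr_gt0].
by move/filter_ex => [].
Unshelve. all: by end_near.
Qed.

(** For a vertex [z] of [K] this is the infinite sector with apex [z] spanned by [K]: the coordinate
    of [z] itself is left free. *)
Definition cone z K : set (R * R) :=
  [set y | forall j, bary K j z = 0 -> 0 <= bary K j y].

Lemma cone_closed z K : closed (cone z K).
Proof.
have -> : cone z K = \bigcap_(j in [set j | bary K j z = 0]) [set y | 0 <= bary K j y].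
  by apply/seteqP; split => y h j; exact: h.
apply: closed_bigI => j _.
apply: (closed_comp (f := bary K j) (D := [set t : R | 0 <= t])); last exact: closed_ge.
by move=> y _; exact: bary_continuous.
Qed.

Definition at_vertex z K : Prop := exists k, vtx K k = z.

(** The coordinate left free by the cone is 1 at [z], hence positive nearby. The mesh is finite, so
    one neighbourhood serves all triangles. *)
Lemma near_cone z : \forall y \near z, forall K, at_vertex z K -> cone z K y -> tri K y.
Proof.
have H K : \forall y \near z, at_vertex z K -> cone z K y -> tri K y.
  have [[k kz]|nk] := pselect (at_vertex z K); last by near=> y.
  have pk : 0 < bary K k z by rewrite -kz bary_vtxE eqxx.
  near=> y => _ cy; apply/triP => // j.
  have [->|jk] := eqVneq j k.
    by apply: ltW; near: y; exact: near_bary_gt0.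
  by apply: cy; rewrite -kz bary_vtxE (negbTE jk).
pose f K : set (R * R) := fun y => at_vertex z K -> cone z K y -> tri K y.
have H' : forall K, \forall y \near z, f K y := H.
exact: filter_forall H'.
Unshelve. all: by end_near.
Qed.

Lemma vertex_eq K k z : vtx K k = z ->
  forall j, bary K j z = 0 <-> j != k.
Proof.
move=> <- j; rewrite bary_vtxE; case: eqVneq => _; split => //.
by move/eqP; rewrite oner_eq0.
Qed.

(** The two lines bounding a sector meet only at its apex. *)
Lemma cone_apex z K y i : at_vertex z K -> cone z K y -> y != z ->
  bary K i z = 0 -> bary K i y = 0 ->
  forall j, j != i -> bary K j z = 0 -> 0 < bary K j y.
Proof.
move=> [k kz] cy yz iz iy j ji jz.
rewrite lt_neqAle cy// andbT eq_sym; apply: contra_neqN yz => /eqP jy.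
have zk := vertex_eq kz.
have ik : i != k by apply/zk.
have jk : j != k by apply/zk.
have all0 l : l != k -> bary K l y = 0.
  have [->//|li] := eqVneq l i; have [->//|lj] := eqVneq l j.
  by move: ik jk ji li lj; elim/I3_ind: i {iz iy}; elim/I3_ind: j {jz jy}; elim/I3_ind: k {kz zk};
    elim/I3_ind: l; rewrite ?eqxx.
have sy := bary_sum k y (det_neq0 K).
rewrite (all0 (k + 1)) ?I3_neq// (all0 (k + 2%:R)) ?I3_neq// in sy.
apply: (bary_inj (K := K)) => l; rewrite -kz bary_vtxE.
have [->|lk] := eqVneq l k; last by rewrite all0.
by rewrite -sy !addr0.
Qed.

Lemma edge_vertex_bary K i z : at_vertex z K -> edge K i z <-> bary K i z = 0.
Proof.
move=> [k <-]; split => [/edgeP[]//|h]; apply/edgeP; split => // j.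
by rewrite bary_vtxE ler0n.
Qed.

Lemma shared_vertex K i L j z : edge K i = edge L j -> at_vertex z K -> edge K i z ->
  at_vertex z L.
Proof.
move=> E zK Ez; have iz := (edge_vertex_bary i zK).1 Ez.
have : z = ea K i \/ z = eb K i.
  case: zK => k kz; have := (vertex_eq kz i).1 iz.
  rewrite -kz /ea /eb; elim/I3_ind: i {E Ez iz}; elim/I3_ind: k {kz}; rewrite !I3E ?eqxx//;
    by [left|right].
by case=> ->; case: (edge_eqP E) => -[ha hb]; rewrite ?ha ?hb;
  [exists (j + 1)|exists (j + 2%:R)|exists (j + 2%:R)|exists (j + 1)].
Qed.

(* The union of the cones is closed, and open away from [z]: a segment that
   misses [z] and starts in it stays in it. *)
Lemma fan_covers (C : set 'I_(ntri M)) z K0 : C K0 ->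
  (forall K, C K -> at_vertex z K) ->
  (forall K i, C K -> edge K i z ->
    exists L j, [/\ C L, L != K & edge L j = edge K i]) ->
  forall y, exists2 K, C K & cone z K y.
Proof.
move=> CK0 Cz Cn y.
pose X := \bigcup_(K in C) cone z K.
suff : X y by case=> K CK cy; exists K.
have clX : closed X.
  by apply: closed_bigcup => [|K _]; [exact: finite_finset|exact: cone_closed].
have opX x : X x -> x != z -> X° x.
  move=> [K CK cx] xz.
  have zK := Cz _ CK.
  (* Either [x] is on a bounding ray, and then the cones of [K] and of the neighbour across it
     together contain all nearby points, or [x] is interior to the cone of [K]. *)
  have [[i [iz ix]]|none] := pselect (exists i, bary K i z = 0 /\ bary K i x = 0).
    have [L [j [CL LK E]]] := Cn _ _ CK ((edge_vertex_bary i zK).2 iz).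
    have KL : K != L by rewrite eq_sym.
    have zL : at_vertex z L.
      by apply: (shared_vertex (esym E) zK); apply/edge_vertex_bary.
    have posK := cone_apex zK cx xz iz ix.
    have posL l : l != j -> bary L l z = 0 -> 0 < bary L l x.
      have n1 : i + 1 != i by elim/I3_ind: i {iz ix E posK}; rewrite !I3E.
      have n2 : i + 2%:R != i by elim/I3_ind: i {iz ix E posK n1}; rewrite !I3E.
      have p1 : bary K (i + 1) z = 0 -> 0 < bary K (i + 1) x.
        by apply: posK; rewrite I3_neq.
      have p2 : bary K (i + 2%:R) z = 0 -> 0 < bary K (i + 2%:R) x.
        by apply: posK; rewrite I3_neq.
      case: (edge_eq_bary_or (esym E)) => H; have [_ z1 z2] := H _ iz;
        have [_ x1 x2] := H _ ix;
        move: l; apply: (I3_shift_ind (i := j)); rewrite ?eqxx// => _.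
      - by rewrite z1 x1.
      - by rewrite z2 x2.
      - by rewrite z1 x1.
      - by rewrite z2 x2.
    have near1 (N : 'I_(ntri M)) n : (forall l, l != n -> bary N l z = 0 -> 0 < bary N l x) ->
        \forall y' \near x, forall l, l != n -> bary N l z = 0 -> 0 < bary N l y'.
      move=> H; near=> y'; apply: I3_ind; near: y'.
      - have [h|h] := pselect (0 != n /\ bary N 0 z = 0); last by near=> y' => a b; case: h.
        by have := near_bary_gt0 (H 0 h.1 h.2); apply: filterS.
      - have [h|h] := pselect (1 != n /\ bary N 1 z = 0); last by near=> y' => a b; case: h.
        by have := near_bary_gt0 (H 1 h.1 h.2); apply: filterS.
      - have [h|h] := pselect (2%:R != n /\ bary N 2%:R z = 0); last by near=> y' => a b; case: h.
        by have := near_bary_gt0 (H 2%:R h.1 h.2); apply: filterS.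
    near=> y'.
    have nK : forall l, l != i -> bary K l z = 0 -> 0 < bary K l y'.
      by near: y'; exact: near1.
    have nL : forall l, l != j -> bary L l z = 0 -> 0 < bary L l y'.
      by near: y'; exact: near1.
    have [h|h] := near_ge0_shared y' KL (esym E).
      by exists K => // l lz; have [->//|li] := eqVneq l i; exact/ltW/nK.
    by exists L => // l lz; have [->//|lj] := eqVneq l j; exact/ltW/nL.
  have posK l : bary K l z = 0 -> 0 < bary K l x.
    move=> lz; rewrite lt_neqAle cx// andbT; apply/eqP => lx; apply: none; exists l.
    by rewrite lz lx.
  pose f l : set (R * R) := fun y' => bary K l z = 0 -> 0 <= bary K l y'.
  have nf l : \forall y' \near x, f l y'.
    have [h|h] := pselect (bary K l z = 0); last by near=> y' => ?.
    by have := near_bary_gt0 (posK _ h); apply: filterS => y' /ltW h' _.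
  have nf' : \forall y' \near x, forall l, f l y' by exact: filter_forall nf.
  by apply: filterS nf' => y' h; exists K.
have [->|yz] := eqVneq y z.
  by exists K0 => // j ->.
(* The two sides of [K0] at [z] are linearly independent, so one of their far ends is off the line
   through [z] and [y]; the segment from there to [y] cannot meet [z]. *)
have [x [Xx xc]] : exists x, X x /\ cross (x - z) (y - z) != 0.
  have [k kz] := Cz _ CK0.
  have inX l : X (vtx K0 l).
    by exists K0 => // j _; rewrite bary_vtxE ler0n.
  have [h1|h1] := eqVneq (cross (vtx K0 (k + 1) - z) (y - z)) 0; last by exists (vtx K0 (k + 1)).
  have [h2|h2] := eqVneq (cross (vtx K0 (k + 2%:R) - z) (y - z)) 0;
    last by exists (vtx K0 (k + 2%:R)).
  exfalso; have := det_neq0 K0; rewrite -(det_cyc K0 k) kz.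
  set p := _ - z in h1 *; set q := _ - z in h2 *; set w := y - z in h1 h2.
  move=> pq.
  have w1 : cross p q * w.1 = 0.
    transitivity (p.1 * - cross q w + q.1 * cross p w); first by rewrite /cross; ring.
    by rewrite h1 h2 oppr0 !mulr0 addr0.
  have w2 : cross p q * w.2 = 0.
    transitivity (p.2 * - cross q w + q.2 * cross p w); first by rewrite /cross; ring.
    by rewrite h1 h2 oppr0 !mulr0 addr0.
  move: w1 w2 => /eqP + /eqP; rewrite !mulf_eq0 (negbTE pq)/= => /eqP w1 /eqP w2.
  have : w = 0 by apply: pair_eqP.
  by move/eqP; rewrite subr_eq0 (negbTE yz).
pose g (t : R) := (1 - t) *: x + t *: y.
have cg : continuous g by exact: continuous_segment.
have gz t : 0 <= t <= 1 -> g t != z.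
  move=> t01; apply/eqP => gt.
  have [t1|t1] := eqVneq t 1; first by move: gt yz;
    rewrite /g t1 subrr scale0r scale1r add0r => ->; rewrite eqxx.
  have : cross (g t - z) (y - z) = (1 - t) * cross (x - z) (y - z).
    by rewrite /g /cross/= /GRing.scale/=; ring.
  rewrite gt subrr; move/eqP; rewrite /cross/= !mul0r subr0 eq_sym mulf_eq0 subr_eq0 eq_sym
    (negbTE t1)/=.
  by rewrite -/(cross _ _) (negbTE xc).
have := @segment_connected R 0 1 (`[0, 1]%classic `&` g @^-1` X).
have -> : X y = (g @^-1` X) 1 by rewrite /g /= subrr scale0r scale1r add0r.
have i1 : `[(0 : R), 1]%classic 1 by rewrite /= in_itv/= ler01 lexx.
move=> H; suff : (`[0, 1]%classic `&` g @^-1` X) 1 by case.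
rewrite H//.
- exists 0; split; first by rewrite /= in_itv/= ler01 lexx.
  by rewrite /g /= subr0 scale0r scale1r addr0.
- exists (g @^-1` X°); first by move/continuousP : cg; apply; exact: open_interior.
  apply/seteqP; split => t [t01 gt]; split => //.
    by apply: opX => //; apply: gz; move: t01; rewrite /= in_itv.
  exact: interior_subset gt.
- exists (g @^-1` X) => //.
  by move/continuous_closedP : cg; apply.
Unshelve. all: by end_near.
Qed.

(** Only edges through [z] may be crossed, so that every triangle reached again has [z] as a
    vertex. *)
Definition adj z : rel 'I_(ntri M) := fun K L =>
  `[< [/\ at_vertex z K, L != K & exists i j, edge L j = edge K i /\ edge K i z] >].

Lemma connect_at_vertex z K L : at_vertex z K -> connect (adj z) K L -> at_vertex z L.
Proof.
move=> zK /connectP[p]; elim: p K zK => [|K' p IH] K zK /=; first by move=> _ ->.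
move=> /andP[/asboolP[_ _ [i [j [E Ez]]]]] pth LE.
apply: (IH K') => //.
exact: (shared_vertex (esym E) zK Ez).
Qed.

(** A component of [adj z] is closed under passing to neighbours across edges at [z]; if none of
    these is a boundary edge, it goes all the way round. *)
Lemma fan_component z K :
  at_vertex z K -> (forall L i, connect (adj z) K L -> edge L i z -> neighbour L i != None) ->
  forall y, exists2 L, connect (adj z) K L & cone z L y.
Proof.
move=> zK h; apply: (@fan_covers [set L | connect (adj z) K L] z K).
- exact: connect0.
- by move=> L; exact: connect_at_vertex.
- move=> L i CL Lz; have := h _ _ CL Lz.
  case E : (neighbour L i) => [L'|//] _; have /neighbourP[L'L [j Ej]] := E.
  exists L', j; split => //; apply: (connect_trans CL); apply: connect1.
  apply/asboolP; split => //; first exact: connect_at_vertex CL.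
  by exists i, j.
Qed.

(** Otherwise the chain of [K] alone would surround [z], putting [z] into [Omega]. The claim is made
    for the chain of each [K], since several chains may meet at a boundary vertex. *)
Lemma boundary_vertex z K : at_vertex z K -> ~ Omega z ->
  exists L i, [/\ connect (adj z) K L, edge L i z & neighbour L i = None].
Proof.
move=> zK Oz; apply: contrapT => no; apply: Oz; apply: nbhs_Omega.
have cov := fan_component zK.
near=> y.
have [L i CL Lz|L CL cL] := cov _ y.
  by apply/eqP => E; apply: no; exists L, i.
exists L.
have : forall K, at_vertex z K -> cone z K y -> tri K y by near: y; exact: near_cone.
by apply => //; exact: connect_at_vertex CL.
Unshelve. all: by end_near.
Qed.

(** No edge at [z] is a boundary edge, so the cones of the chain of [K] fill the plane. An interior
    point of [K'] close to [z] then lies in a triangle of the chain, which can only be [K']. *)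
Lemma interior_vertex z K K' : Omega z -> at_vertex z K -> at_vertex z K' ->
  connect (adj z) K K'.
Proof.
move=> Oz zK zK'.
have cov := fan_component zK.
have [k' k'z] := zK'.
pose m := 3^-1 *: vtx K' k' + 3^-1 *: vtx K' (k' + 1) + 3^-1 *: vtx K' (k' + 2%:R).
have mE l : bary K' l m = 3^-1.
  have -> : m = \sum_k (fun=> 3^-1) k *: vtx K' k by rewrite (sum_I3 _ k').
  rewrite bary_comb// (sum_I3 _ k'); by field.
have cg := @cvg_line z m.
have : \forall e \near (0:R)^'+, connect (adj z) K K'.
  near=> e.
  have e0 : 0 < e by near: e; exact: nbhs_right_gt.
  have e1 : e < 1 by near: e; exact: nbhs_right_lt.
  pose y := (1 - e) *: z + e *: m.
  have [L i CL Lz|L CL cL] := cov _ y.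
    by apply/eqP => E; exact: (boundary_edge E Lz).
  have Ly : tri L y.
    have : forall K, at_vertex z K -> cone z K y -> tri K y.
      by rewrite /y; near: e; exact: cg (near_cone z).
    by apply => //; exact: connect_at_vertex CL.
  have pK' l : 0 < bary K' l y.
    rewrite bary_shrink mE; apply: ltr_wpDl; last by rewrite mulr_gt0// invr_gt0.
    by rewrite mulr_ge0// ?subr_ge0 ?(ltW e1)// -k'z bary_vtxE ler0n.
  have [<-//|LK'] := eqVneq L K'.
  have [l l0] : exists l, bary K' l y = 0.
    apply: (overlap (L := L)) => //; first by rewrite eq_sym.
    by apply/triP => // l; exact: ltW.
  by have := pK' l; rewrite l0 ltxx.
by move/filter_ex => [].
Unshelve. all: by end_near.
Qed.

End Topology.

(** * Shape regularity *)

Section Shape.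
Variables (R : realType) (M : mesh R) (Omega : set (R * R)) (kappa : R).
Hypothesis Mconf : conforming_triangulation M Omega.
Local Notation mu := (@lebesgue_measure R).
Local Notation leb := (mu \x mu)%E.
Local Notation T2 := (measurableTypeR R * measurableTypeR R)%type.
Implicit Types (K L : 'I_(ntri M)) (i j k : 'I_3) (x y z c : R * R).

Lemma Rint01_affine (a b : R) :
  Rintegral mu `[0, 1]%classic (fun t => a + b * t) = a + b / 2.
Proof.
have dG (s : R) : is_derive s (1 : R) (fun t : R => a * t + b / 2 * t ^+ 2) (a + b * s).
  by apply: is_derive_eq; rewrite /GRing.scale/=; field.
rewrite /Rintegral (FTC2_itv _ _ dG) //=.
- by rewrite expr1n expr0n/=; ring.
- move=> t; apply: cvgD; [exact: cvg_cst|apply: cvgM; [exact: cvg_cst|exact: cvg_id]].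
Qed.

Lemma leb_rtriE : leb (@rtri R : set T2) = (2^-1)%:E.
Proof.
have := @rtri_green R (fun u => u.1) (fun=> 1).
have -> : (fun t : R => (1 - t, t).1 - (0 : R, t).1) = (fun t => 1 + (-1) * t).
  by apply/funext => t /=; rewrite subr0 mulN1r.
rewrite Rint01_affine Rintegral_cst ?mul1r; last exact: measurable_rtri.
move=> H.
have : fine (leb (@rtri R : set T2)) = 2^-1.
  rewrite H; first by field.
  - by move=> x; exact: cvg_fst.
  - by move=> x; exact: cvg_cst.
move=> <-; rewrite fineK// ge0_fin_numE//; exact: leb_rtri_fin.
Qed.

Lemma leb_tri K : leb (tri K : set T2) = (`|det K| / 2)%:E.
Proof.
have d0 := det_neq0 Mconf K.
rewrite (tri_ptri 0 d0) leb_ptri; last by rewrite det_cyc.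
by rewrite det_cyc leb_rtriE -EFinM.
Qed.

Lemma area_det K : area K = `|det K| / 2.
Proof. by rewrite /area [leb2 _]leb_tri. Qed.

Definition disc_in c (r : R) K : Prop :=
  [/\ 0 < r, [set x | enorm (x - c) <= r] `<=` tri K &
        forall x y, tri K x -> tri K y -> enorm (x - y) <= kappa * (2%:R * r)].

Lemma enorm_sqr x : enorm x ^+ 2 = edot x x.
Proof. by rewrite /enorm sqr_sqrtr// /edot -!expr2 addr_ge0// sqr_ge0. Qed.

Lemma enorm_ge0 x : 0 <= enorm x.
Proof. exact: sqrtr_ge0. Qed.

Lemma edot_ge0 x : 0 <= edot x x.
Proof. by rewrite /edot -!expr2 addr_ge0// sqr_ge0. Qed.

Lemma enorm_le x (r : R) : 0 <= r -> (enorm x <= r) = (edot x x <= r ^+ 2).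
Proof.
move=> r0; rewrite -enorm_sqr -(@ler_pXn2r _ 2%N)// nnegrE//; exact: enorm_ge0.
Qed.

Lemma cauchy_schwarz2 (a b c d : R) : (a * c + b * d) ^+ 2 <= (a ^+ 2 + b ^+ 2) * (c ^+ 2 + d ^+ 2).
Proof.
rewrite -subr_ge0; have -> : (a ^+ 2 + b ^+ 2) * (c ^+ 2 + d ^+ 2) - (a * c + b * d) ^+ 2 =
  (a * d - b * c) ^+ 2 by ring.
exact: sqr_ge0.
Qed.

(** Between the two opposite points of the disc along the gradient the function changes by [2 * r]
    times the gradient length, and by at most [2 * m]. *)
Lemma disc_affine_bound c r K (a b k m : R) : disc_in c r K ->
  (forall x, tri K x -> `|a * x.1 + b * x.2 + k| <= m) ->
  (a ^+ 2 + b ^+ 2) * r ^+ 2 <= m ^+ 2.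
Proof.
move=> [r0 sub _] h.
have m0 : 0 <= m.
  apply: le_trans (h c _); first exact: normr_ge0.
  by apply: sub; rewrite /= subrr enorm_le ?(ltW r0)// /edot/= !mulr0 addr0 sqr_ge0.
have [n0|n0] := eqVneq (a ^+ 2 + b ^+ 2) 0; first by rewrite n0 mul0r sqr_ge0.
have npos : 0 < a ^+ 2 + b ^+ 2 by rewrite lt_neqAle eq_sym n0 addr_ge0// sqr_ge0.
pose n := Num.sqrt (a ^+ 2 + b ^+ 2).
have n2 : n ^+ 2 = a ^+ 2 + b ^+ 2 by rewrite sqr_sqrtr// ltW.
have np : 0 < n by rewrite sqrtr_gt0.
have nn : n != 0 by rewrite gt_eqF.
have inK (s : R) : s ^+ 2 = 1 -> tri K (c + (s * r / n) *: (a, b)).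
  move=> s1; apply: sub; rewrite /= addrC addKr enorm_le ?(ltW r0)// /edot/= /GRing.scale/=.
  have -> : s * r / n * a * (s * r / n * a) + s * r / n * b * (s * r /
    n * b) = s ^+ 2 * r ^+ 2 * ((a ^+ 2 + b ^+ 2) / n ^+ 2).
    by field.
  by rewrite s1 n2 mulfV// mul1r mulr1.
have h1 := h _ (inK 1 (expr1n _ _)).
have h2 := h _ (inK (-1) (etrans (sqrrN _) (expr1n _ _))).
have : r * n <= m.
  have E : (a * (c + (1 * r / n) *: (a, b)).1 + b * (c + (1 * r / n) *: (a, b)).2 + k) -
     (a * (c + (-1 * r / n) *: (a, b)).1 + b * (c + (-1 * r / n) *: (a, b)).2 + k) = 2 * (r * n).
    rewrite /= /GRing.scale/= -[n in RHS](mulfK nn) -expr2 n2.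
    by field.
  have := le_trans (ler_norm _) h1; have := ler_normlW (le_trans (lexx _) h2).
  move: h1 h2; rewrite !ler_norml => /andP[_ h1] /andP[h2 _] _ _; lra.
move=> rn; rewrite -n2 -exprMn mulrC ler_pXn2r// nnegrE//.
by rewrite mulr_ge0// ltW.
Qed.

(** The coordinate ranges over [0, 1]; subtracting 1/2 centres it, which yields [2 * r] instead of
    [r]. *)
Lemma bary_grad_disc c r K i : disc_in c r K ->
  (bgx K i ^+ 2 + bgy K i ^+ 2) * (2 * r) ^+ 2 <= 1.
Proof.
move=> hd; have d0 := det_neq0 Mconf K.
have : (bgx K i ^+ 2 + bgy K i ^+ 2) * r ^+ 2 <= (2^-1) ^+ 2.
  apply: (@disc_affine_bound c r K _ _ (cross (ea K i) (eb K i) / det K - 2^-1)) => // x Kx.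
  rewrite addrA -baryE.
  have h := (triP x d0).1 Kx.
  have := bary_sum i x d0; have := h i; have := h (i + 1); have := h (i + 2%:R).
  rewrite ler_norml => h1 h2 h3 hs; apply/andP; split; lra.
by rewrite exprMn exprVn; lra.
Qed.

(** Coordinate [i + 1] falls from 1 to 0 along edge [i]. *)
Lemma bary_grad_edge K i : 
  1 <= (bgx K (i + 1) ^+ 2 + bgy K (i + 1) ^+ 2) * enorm (eb K i - ea K i) ^+ 2.
Proof.
have := cauchy_schwarz2 (bgx K (i + 1)) (bgy K (i + 1)) (eb K i - ea K i).1 (eb K i - ea K i).2.
rewrite enorm_sqr /edot -!expr2; apply: le_trans.
have -> : bgx K (i + 1) * (eb K i - ea K i).1 + bgy K (i + 1) * (eb K i - ea K i).2 =
   bary K (i + 1) (eb K i) - bary K (i + 1) (ea K i) by rewrite !baryE/=; ring.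
rewrite (bary_eb Mconf) (bary_ea Mconf) I3_neq eqxx sub0r sqrrN expr1n//.
Qed.

Lemma edge_ge_disc c r K i : disc_in c r K -> 2 * r <= enorm (eb K i - ea K i).
Proof.
move=> hd; have [r0 _ _] := hd.
rewrite -(@ler_pXn2r _ 2%N)// ?nnegrE ?enorm_ge0//; last by rewrite mulr_ge0// ltW.
have h1 := bary_grad_disc (i + 1) hd; have h2 := bary_grad_edge K i.
have e0 : 0 <= enorm (eb K i - ea K i) ^+ 2 by exact: sqr_ge0.
have r2 : 0 <= (2 * r) ^+ 2 by exact: sqr_ge0.
nra.
Qed.

Lemma det_grad K i : (bgx K i ^+ 2 + bgy K i ^+ 2) * det K ^+ 2 = enorm (eb K i - ea K i) ^+ 2.
Proof.
have d0 := det_neq0 Mconf K.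
by rewrite enorm_sqr /bgx /bgy /edot/=; field.
Qed.

(** [|det K|] is edge length times height. The height is the inverse gradient length of the
    coordinate, and both factors are at least [2 * r]. *)
Lemma area_ge_disc c r K : disc_in c r K -> 2 * r ^+ 2 <= area K.
Proof.
move=> hd; have [r0 _ _] := hd; rewrite area_det.
suff : 4 * r ^+ 2 <= `|det K| by lra.
have h1 := bary_grad_disc 0 hd; have h2 := edge_ge_disc 0 hd; have h3 := det_grad K 0.
have h4 : (2 * r) ^+ 2 <= enorm (eb K 0 - ea K 0) ^+ 2.
  by rewrite ler_pXn2r// nnegrE ?enorm_ge0// mulr_ge0// ltW.
rewrite -(@ler_pXn2r _ 2%N)// ?nnegrE ?normr_ge0//; last by rewrite mulr_ge0// sqr_ge0.
rewrite real_normK ?num_real// (_ : (4 * r ^+ 2) ^+ 2 = (2 * r) ^+ 2 * (2 * r) ^+ 2); last by ring.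
rewrite -h3 in h4.
apply: (@le_trans _ _ ((bgx K 0 ^+ 2 + bgy K 0 ^+ 2) * det K ^+ 2 * (2 * r) ^+ 2)).
  by rewrite ler_pM2r// exprn_gt0// mulr_gt0.
rewrite mulrAC -[leRHS]mul1r ler_wpM2r// sqr_ge0//.
Qed.

(** Lagrange's identity for the two edge vectors at vertex 0. *)
Lemma det_le_diam K (D : R) : 0 <= D ->
  (forall x y, tri K x -> tri K y -> enorm (x - y) <= D) -> `|det K| <= D ^+ 2.
Proof.
move=> D0 h; rewrite -(@ler_pXn2r _ 2%N)// ?nnegrE ?normr_ge0// ?exprn_ge0//.
rewrite real_normK ?num_real//.
have h1 := h _ _ (tri_vtx K 1) (tri_vtx K 0); have h2 := h _ _ (tri_vtx K 2%:R) (tri_vtx K 0).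
rewrite !enorm_le// in h1 h2.
apply: (le_trans (y := edot (vtx K 1 - vtx K 0) (vtx K 1 - vtx K 0) *
  edot (vtx K 2%:R - vtx K 0) (vtx K 2%:R - vtx K 0))).
  rewrite -subr_ge0 (_ : _ - _ = (edot (vtx K 1 - vtx K 0) (vtx K 2%:R - vtx K 0)) ^+ 2);
    first exact: sqr_ge0.
  by rewrite /det /cross /edot; ring.
by rewrite [leRHS]expr2; apply: ler_pM => //; exact: edot_ge0.
Qed.

(** The coordinate is nonnegative at the point of the disc lowest along its gradient; so at the
    centre it is at least [r] times the gradient length, more than it can lose on the way to [y]. *)
Lemma bary_gt0_disc c r K i y : disc_in c r K -> edot (y - c) (y - c) < r ^+ 2 -> 0 < bary K i y.
Proof.
move=> hd yc; have [r0 sub _] := hd; have d0 := det_neq0 Mconf K.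
set a := bgx K i; set b := bgy K i.
have npos : 0 < a ^+ 2 + b ^+ 2.
  have : 0 < (a ^+ 2 + b ^+ 2) * det K ^+ 2.
    rewrite det_grad; apply: lt_le_trans (_ : 0 < (2 * r) ^+ 2) _;
      first by rewrite exprn_gt0// mulr_gt0.
    by rewrite ler_pXn2r// ?nnegrE ?enorm_ge0// ?(edge_ge_disc i hd)// mulr_ge0// ltW.
  by rewrite pmulr_lgt0// exprn_even_gt0//= d0.
pose n := Num.sqrt (a ^+ 2 + b ^+ 2).
have n2 : n ^+ 2 = a ^+ 2 + b ^+ 2 by rewrite sqr_sqrtr// ltW.
have np : 0 < n by rewrite sqrtr_gt0.
have nn : n != 0 by rewrite gt_eqF.
have fc : r * n <= bary K i c.
  have : 0 <= bary K i (c - (r / n) *: (a, b)).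
    apply: (triP _ d0).1; apply: sub;
      rewrite /= addrC addKr enorm_le ?(ltW r0)// /edot/= /GRing.scale/=.
    have -> : - (r / n * a) * - (r / n * a) + - (r / n * b) * - (r /
      n * b) = r ^+ 2 * ((a ^+ 2 + b ^+ 2) / n ^+ 2).
      by field.
    by rewrite n2 mulfV ?mulr1// gt_eqF.
  rewrite !baryE -/a -/b /= /GRing.scale/=.
  have -> : r * n = r / n * (a ^+ 2 + b ^+ 2) by rewrite -n2; field.
  lra.
have : `|bary K i y - bary K i c| < r * n.
  rewrite -(@ltr_pXn2r _ 2%N)// ?nnegrE ?normr_ge0// ?mulr_ge0 ?ltW//.
  rewrite real_normK ?num_real//.
  have -> : bary K i y - bary K i c = a * (y - c).1 + b * (y - c).2 by rewrite !baryE/= -/a -/b;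
    ring.
  apply: le_lt_trans (cauchy_schwarz2 _ _ _ _) _.
  have -> : (r * n) ^+ 2 = (a ^+ 2 + b ^+ 2) * r ^+ 2 by rewrite -n2; ring.
  by rewrite ltr_pM2l// !expr2.
by rewrite ltr_norml => /andP[h _]; lra.
Qed.

Lemma leb_oo_box (a b c d : R) : a <= b -> c <= d ->
  leb (`]a, b[%classic `*` `]c, d[%classic : set T2) = ((b - a) * (d - c))%:E.
Proof.
move=> ab cd; transitivity (mu `]a, b[%classic * mu `]c, d[%classic)%E.
  exact: product_measure1E.
rewrite !lebesgue_measure_itv/= !lte_fin.
case: ltP => [_|h]; last by rewrite mul0e (_ : b - a = 0) ?mul0r//; lra.
case: ltP => [_|h]; last by rewrite mule0 (_ : d - c = 0) ?mulr0//; lra.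
by rewrite -!EFinD -EFinM.
Qed.

Lemma leb_cc_box (a b c d : R) : a <= b -> c <= d ->
  leb (`[a, b]%classic `*` `[c, d]%classic : set T2) = ((b - a) * (d - c))%:E.
Proof.
move=> ab cd; transitivity (mu `[a, b]%classic * mu `[c, d]%classic)%E.
  exact: product_measure1E.
rewrite !lebesgue_measure_itv/= !lte_fin.
case: ltP => [_|h]; last by rewrite mul0e (_ : b - a = 0) ?mul0r//; lra.
case: ltP => [_|h]; last by rewrite mule0 (_ : d - c = 0) ?mulr0//; lra.
by rewrite -!EFinD -EFinM.
Qed.

(* Shrink the triangles of the fan towards [z] to the size of the smallest one:
   they contain disjoint squares of area [rho ^ 2] inside a square of side
   [4 * kappa * rho]. *)
Lemma fan_card (r : 'I_(ntri M) -> R) (c : 'I_(ntri M) -> R * R) z :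
  (forall K, disc_in (c K) (r K) K) ->
  (#|[pred K | `[< @at_vertex R M z K >]]|%:R : R) <= 16 * kappa ^+ 2.
Proof.
move=> hd; set P := [pred K | _].
have [K0 PK0|none] := pickP P; last first.
  by rewrite (eq_card0 none) mulr_ge0// sqr_ge0.
have [Km PKm Kmin] : exists2 Km, P Km & forall K, P K -> r Km <= r K.
  by case: (Order.TotalTheory.arg_minP r PK0) => Km PKm Kmin; exists Km.
set rho := r Km.
have rho0 : 0 < rho by have [] := hd Km.
pose s K := rho / r K.
have s0 K : 0 < s K by rewrite divr_gt0//; have [] := hd K.
have s1 K : P K -> s K <= 1.
  by move=> PK; rewrite ler_pdivrMr ?mul1r; [exact: Kmin|have [] := hd K].
pose c' K : R * R := z + s K *: (c K - z).
(* After shrinking, every disc has radius [rho]. A square of side [rho] has half diagonal less than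
   [rho] and fits inside; the shrunk triangles have diameter at most [2 * kappa * rho], which sizes
   the box [B] below. *)
pose Q K : set T2 := `](c' K).1 - rho / 2, (c' K).1 + rho / 2[%classic `*`
   `](c' K).2 - rho / 2, (c' K).2 + rho / 2[%classic.
have mQ K : measurable (Q K) by exact: measurableX.
have QK K x : P K -> Q K x -> exists y, [/\ x = (1 - s K) *: z + s K *: y, tri K y & forall i,
  0 < bary K i y].
  move=> PK; rewrite /Q /= !in_itv/= => -[/andP[x1 x2] /andP[x3 x4]].
  have [r0 _ _] := hd K.
  have rn : r K != 0 by rewrite gt_eqF.
  have rhon : rho != 0 by rewrite gt_eqF.
  pose y : R * R := z + (s K)^-1 *: (x - z).
  have yp i : 0 < bary K i y.
    apply: (bary_gt0_disc _ (hd K)).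
    have -> : edot (y - c K) (y - c K) =
      ((x.1 - (c' K).1) ^+ 2 + (x.2 - (c' K).2) ^+ 2) * (s K)^-1 ^+ 2.
      by rewrite /edot /y /c' /s/= /GRing.scale/=; field; rewrite rn rhon.
    have -> : r K ^+ 2 = rho ^+ 2 * (s K)^-1 ^+ 2 by rewrite /s; field; rewrite rn rhon.
    rewrite ltr_pM2r ?exprn_gt0 ?invr_gt0//.
    have h1 : 0 < (rho / 2 - (x.1 - (c' K).1)) * (rho / 2 + (x.1 - (c' K).1)).
      by apply: mulr_gt0; rewrite /c' /=; lra.
    have h2 : 0 < (rho / 2 - (x.2 - (c' K).2)) * (rho / 2 + (x.2 - (c' K).2)).
      by apply: mulr_gt0; rewrite /c' /=; lra.
    have h3 : 0 < rho ^+ 2 by rewrite exprn_gt0.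
    move: h1 h2 h3; generalize (x.1 - (c' K).1) (x.2 - (c' K).2) => u v; lra.
  exists y; split => //.
    by apply: pair_eqP; rewrite /y /s/= /GRing.scale/=; field; rewrite rn rhon.
  by apply/triP => [|i]; [exact: det_neq0 Mconf K|exact/ltW].
(* As [s K <= 1], a point of the square is a convex combination of the vertex [z] and an interior
   point of [K]; it is thus interior to [K], and [overlap] makes the squares disjoint. *)
have pos K x : P K -> Q K x -> forall i, 0 < bary K i x.
  move=> PK Qx i; have [y [-> _ yp]] := QK _ _ PK Qx.
  rewrite bary_shrink; apply: ltr_wpDl; last by rewrite mulr_gt0.
  have [k kz] := asboolP _ PK.
  by rewrite mulr_ge0 ?subr_ge0 ?s1// -kz (bary_vtxE Mconf) ler0n.
have tQ : trivIset [set` P] Q.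
  apply/trivIsetP => K L /= PK PL KL; apply/seteqP; split => x // -[QKx QLx].
  have pK := pos _ _ PK QKx; have pL := pos _ _ PL QLx.
  have [i i0] : exists i, bary K i x = 0.
    apply: (overlap Mconf KL (x := x)).
      exact: ((triP x (det_neq0 Mconf K)).2 (fun i => ltW (pK i))).
    exact: ((triP x (det_neq0 Mconf L)).2 (fun i => ltW (pL i))).
  by have := pK i; rewrite i0 ltxx.
pose B : set T2 := `[z.1 - 2 * kappa * rho, z.1 + 2 * kappa * rho]%classic `*`
  `[z.2 - 2 * kappa * rho, z.2 + 2 * kappa * rho]%classic.
have QB K : P K -> Q K `<=` B.
  move=> PK x Qx; have [y [-> Ky _]] := QK _ _ PK Qx.
  have [k kz] := asboolP _ PK.
  have [r0 _ hdiam] := hd K.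
  have := hdiam _ _ Ky (tri_vtx K k); rewrite kz => yz.
  have b0 : 0 <= kappa * (2 * r K) by apply: le_trans yz; exact: enorm_ge0.
  rewrite enorm_le// /edot in yz.
  have E : s K * (kappa * (2 * r K)) = 2 * kappa * rho by rewrite /s; field; rewrite gt_eqF.
  have y1 : `|(y - z).1| <= kappa * (2 * r K).
    rewrite -(@ler_pXn2r _ 2%N)// ?nnegrE// real_normK ?num_real//; apply: le_trans yz.
    by rewrite expr2 lerDl -expr2 sqr_ge0.
  have y2 : `|(y - z).2| <= kappa * (2 * r K).
    rewrite -(@ler_pXn2r _ 2%N)// ?nnegrE// real_normK ?num_real//; apply: le_trans yz.
    by rewrite [leRHS]addrC expr2 lerDl -expr2 sqr_ge0.
  have sK := s0 K.
  move: y1 y2; rewrite !ler_norml => /andP[a1 a2] /andP[a3 a4].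
  rewrite /B /= !in_itv/= -E /GRing.scale/=; move: a1 a2 a3 a4; rewrite /= => a1 a2 a3 a4.
  by split; apply/andP; split; nra.
have mB : measurable B by exact: measurableX.
have mU : measurable (\big[setU/set0]_(K < ntri M | P K) Q K) by exact: bigsetU_measurable.
have : (leb (\big[setU/set0]_(K < ntri M | P K) Q K) <= leb B)%E.
  apply: le_measure; rewrite ?inE//.
  elim/big_ind : _ => // A1 A2 h1 h2 x [/h1|/h2]//.
rewrite [leLHS](_ : _ = \sum_(K < ntri M | P K) leb (Q K))%E; last exact: measure_bigsetU_ord_cond.
have lQ K : leb (Q K) = (rho ^+ 2)%:E.
  have h1 : (c' K).1 - rho / 2 <= (c' K).1 + rho / 2 by lra.
  have h2 : (c' K).2 - rho / 2 <= (c' K).2 + rho / 2 by lra.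
  by rewrite [LHS](leb_oo_box h1 h2); congr EFin; field.
have -> : leb B = ((4 * kappa * rho) ^+ 2)%:E.
  have k0 : 0 <= 2 * kappa * rho.
    have [_ _ /(_ _ _ (tri_vtx Km 0) (tri_vtx Km 0))] := hd Km.
    rewrite -/rho => h; have := le_trans (enorm_ge0 _) h; lra.
  have h1 : z.1 - 2 * kappa * rho <= z.1 + 2 * kappa * rho by lra.
  have h2 : z.2 - 2 * kappa * rho <= z.2 + 2 * kappa * rho by lra.
  by rewrite [LHS](leb_cc_box h1 h2); congr EFin; ring.
rewrite (eq_bigr (fun=> (rho ^+ 2)%:E)); last by move=> K _; exact: lQ.
rewrite sumEFin lee_fin sumr_const => h.
have {}h : #|P|%:R * rho ^+ 2 <= 16 * kappa ^+ 2 * rho ^+ 2.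
  rewrite mulr_natl (_ : 16 * kappa ^+ 2 * rho ^+ 2 = (4 * kappa * rho) ^+ 2)//.
  by ring.
by rewrite -(ler_pM2r (exprn_gt0 2 rho0)).
Qed.

End Shape.

(** * Matching the two sides of an edge, and cancellation of antisymmetric sums *)

Section EdgeInvolution.
Variables (R : realType) (M : mesh R) (Omega : set (R * R)).
Hypotheses (Oopen : open Omega) (Oreg : Omega = (closure Omega)°).
Hypothesis Mconf : conforming_triangulation M Omega.
Implicit Types (K L : 'I_(ntri M)) (i j k : 'I_3) (x y z : R * R).

Lemma edge_inj K i j : edge K i = edge K j -> i = j.
Proof.
move=> E; have [] := edge_eq_bary Mconf E (x := ea K i).
  by rewrite (bary_ea Mconf) I3_neq.
have [] := edge_eq_bary Mconf E (x := eb K i).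
  by rewrite (bary_eb Mconf) I3_neq.
rewrite (bary_ea Mconf) (bary_eb Mconf) => /eqP h1 _ /eqP h2 _; move: h1 h2.
rewrite !pnatr_eq0 !eqb0.
by elim/I3_ind: i {E}; elim/I3_ind: j; rewrite !I3E.
Qed.

Definition shared_index K i L : 'I_3 := odflt 0 [pick j | `[< edge L j = edge K i >]].

Lemma shared_indexP K i L : neighbour K i = Some L -> edge L (shared_index K i L) = edge K i.
Proof.
move=> /(neighbourP Mconf)[_ [j E]]; rewrite /shared_index; case: pickP => [k /asboolP//|h].
by have := h j; case: asboolP.
Qed.

(** Passes to the same edge seen from the neighbour; boundary edges are fixed points. *)
Definition flip (e : 'I_(ntri M) * 'I_3) :=
  if neighbour e.1 e.2 is Some L then (L, shared_index e.1 e.2 L) else e.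

Lemma flipK : involutive flip.
Proof.
move=> [K i]; rewrite /flip/=; case E : (neighbour K i) => [L|]; last by rewrite E.
have sE := shared_indexP E; have [LK _] := (neighbourP Mconf _ _ _).1 E.
rewrite /= (neighbour_sym Mconf LK sE); congr pair.
apply: (edge_inj (K := K)); rewrite -sE shared_indexP//.
exact: (neighbour_sym Mconf LK sE).
Qed.

(** Reindexing by [flip] turns the sum into its own negative. All cancellations across interior
    edges are instances of this. *)
Lemma sum_flip0 (T : 'I_(ntri M) -> 'I_3 -> R) :
  (forall K i, neighbour K i = None -> T K i = 0) ->
  (forall K i L j, neighbour K i = Some L -> edge L j = edge K i -> T L j = - T K i) ->
  \sum_K \sum_i T K i = 0.
Proof.
move=> T0 Topp; rewrite pair_big/=.
set S := \sum_p _.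
suff : S = - S by move/eqP; rewrite -addr_eq0 -mulr2n mulrn_eq0/= => /eqP.
rewrite {1}/S (reindex_inj (inv_inj flipK))/= -sumrN; apply: eq_bigr => -[K i] _.
rewrite /flip/=; case E : (neighbour K i) => [L|] /=; last by rewrite T0// oppr0.
by rewrite (Topp K i)//; exact: shared_indexP.
Qed.

(** [|det K| * bary K i x] is the edge length times the signed distance of [x] from the edge,
    positive on the side of [K]. From the two sides the squares agree and the signs are opposite. *)
Lemma orient_opp K i L j x : neighbour K i = Some L -> edge L j = edge K i ->
  `|det L| * bary L j x = - (`|det K| * bary K i x).
Proof.
move=> /(neighbourP Mconf)[LK _] E.
have dK := det_neq0 Mconf K; have dL := det_neq0 Mconf L.
have opp := opposite Mconf x LK E.
have sq : (`|det L| * bary L j x) ^+ 2 = (`|det K| * bary K i x) ^+ 2.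
  rewrite !exprMn !real_normK ?num_real// -!exprMn /bary ![det _ * _]mulrC !mulfVK//.
  case: (edge_eqP Mconf E) => -[-> ->] //.
  by rewrite -sqrrN; congr (_ ^+ 2); rewrite /cross; ring.
have : (`|det L| * bary L j x) * (`|det K| * bary K i x) <= 0.
  rewrite mulrACA; apply: mulr_ge0_le0 => //; exact: mulr_ge0.
move: sq => /eqP; rewrite eqf_sqr => /orP[/eqP -> | /eqP //].
rewrite -expr2 => h; have /eqP : (`|det K| * bary K i x) ^+ 2 = 0.
  by apply/eqP; rewrite eq_le h sqr_ge0.
by rewrite sqrf_eq0 => /eqP ->; rewrite oppr0.
Qed.

End EdgeInvolution.

(** * The Friedrichs inequality and nodal interpolation *)

Section Friedrichs.
Variables (R : realType) (M : mesh R) (Omega : set (R * R)).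
Hypotheses (Oopen : open Omega) (Oreg : Omega = (closure Omega)°).
Hypothesis Mconf : conforming_triangulation M Omega.
Local Notation mu := (@lebesgue_measure R).
Local Notation leb := (mu \x mu)%E.
Local Notation T2 := (measurableTypeR R * measurableTypeR R)%type.
Implicit Types (K L : 'I_(ntri M)) (i j k : 'I_3) (x y z : R * R).

Definition edge_mean K i (f : R * R -> R) : R :=
  Rintegral mu `[0, 1]%classic (fun t => f ((1 - t) *: ea K i + t *: eb K i)).

Lemma integrable_tri K (f : R * R -> R) : continuous f ->
  leb.-integrable (tri K : set T2) (EFin \o f).
Proof.
move=> cf; rewrite (tri_ptri 0 (det_neq0 Mconf K)).
by apply: integrable_ptri => //; rewrite det_cyc (det_neq0 Mconf).
Qed.

Lemma measurable_tri K : measurable (tri K : set T2).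
Proof. by rewrite (tri_ptri 0 (det_neq0 Mconf K)); exact: measurable_ptri. Qed.

Lemma rt0_green_tri K i phi D1 D2 : C1grad phi D1 D2 ->
  Rintegral leb (tri K : set T2)
    (fun x => (x - vtx K i).1 * D1 x + (x - vtx K i).2 * D2 x + 2 * phi x) =
  `|det K| * edge_mean K i phi.
Proof.
move=> h; rewrite (tri_ptri i (det_neq0 Mconf K)).
rewrite (rt0_green _ _ h); last by rewrite det_cyc (det_neq0 Mconf).
rewrite det_cyc; congr (_ * _); apply: eq_Rintegral => t _; congr phi.
by rewrite /ea /eb; apply: pair_eqP; rewrite /= /GRing.scale/=; ring.
Qed.

Lemma edge_mean_sym K i L j f : continuous f -> edge L j = edge K i ->
  edge_mean L j f = edge_mean K i f.
Proof.
move=> cf E; rewrite /edge_mean.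
case: (edge_eqP Mconf E) => -[-> ->]; first reflexivity.
rewrite -[RHS]Rintegral01_onem.
  apply: eq_Rintegral => t _; congr f; by rewrite subKr addrC.
by move=> t; apply: continuous_comp; [exact: continuous_segment|exact: cf].
Qed.

(** The origin is the combination of the vertices with weights [bary K i 0], so the field [x] is the
    same combination of the fields [x - vtx K i], to which [rt0_green_tri] applies. *)
Lemma radial_green_tri K phi D1 D2 : C1grad phi D1 D2 ->
  Rintegral leb (tri K : set T2) (fun x => x.1 * D1 x + x.2 * D2 x + 2 * phi x) =
  \sum_i (`|det K| * bary K i 0) * edge_mean K i phi.
Proof.
move=> h; have [c0 c1 c2 _] := h.
have d0 := det_neq0 Mconf K.
pose F i x := (x - vtx K i).1 * D1 x + (x - vtx K i).2 * D2 x + 2 * phi x.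
have cF i : continuous (F i).
  move=> x; apply: cvgD; [apply: cvgD|]; apply: cvgM; try exact: cvg_cst.
  - by apply: (@cvgB _ _ _ _ _ (fun x : R * R => x.1) (fun=> (vtx K i).1));
      [exact: cvg_fst|exact: cvg_cst].
  - exact: c1.
  - by apply: (@cvgB _ _ _ _ _ (fun x : R * R => x.2) (fun=> (vtx K i).2));
      [exact: cvg_snd|exact: cvg_cst].
  - exact: c2.
  - exact: c0.
have cZ (a : R) f : continuous f -> continuous (fun x : R * R => a * f x).
  by move=> cf x; apply: cvgM; [exact: cvg_cst|exact: cf].
have cD f g : continuous f -> continuous g -> continuous (fun x : R * R => (f x + g x : R)).
  by move=> cf cg x; apply: cvgD; [exact: cf|exact: cg].
have mK := measurable_tri K.
transitivity (Rintegral leb (tri K : set T2)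
    (fun x => bary K 0 0 * F 0 x + bary K 1 0 * F 1 x + bary K 2%:R 0 * F 2%:R x)).
  apply: eq_Rintegral => x _; rewrite /F /=.
  have s1 := bary_sum 0 0 d0; rewrite !I3E in s1.
  have r0 := bary_recon 0 0 d0; rewrite !I3E in r0.
  have r1 := congr1 fst r0; have r2 := congr1 snd r0; rewrite /= /GRing.scale/= in r1 r2.
  have -> : bary K 0 0 = 1 - bary K 1 0 - bary K 2%:R 0 by rewrite -s1; ring.
  move: r1 r2; have -> : bary K 0 0 = 1 - bary K 1 0 - bary K 2%:R 0 by rewrite -s1; ring.
  move=> r1 r2.
  have x1E : x.1 = x.1 - ((1 - bary K 1 0 - bary K 2%:R 0) * (vtx K 0).1 +
    bary K 1 0 * (vtx K 1).1 + bary K 2%:R 0 * (vtx K 2%:R).1) by rewrite -r1 subr0.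
  have x2E : x.2 = x.2 - ((1 - bary K 1 0 - bary K 2%:R 0) * (vtx K 0).2 +
    bary K 1 0 * (vtx K 1).2 + bary K 2%:R 0 * (vtx K 2%:R).2) by rewrite -r2 subr0.
  rewrite [in LHS]x1E [in LHS]x2E {x1E x2E r1 r2 s1 r0}.
  move: (bary K 1 0) (bary K 2%:R 0) (D1 x) (D2 x) (phi x) => b1 b2 u1 u2 u.
  by move: (vtx K 0) (vtx K 1) (vtx K 2%:R) => v0 v1 v2; ring.
rewrite RintegralD//; last 2 first.
- by apply: integrable_tri; do !apply: cD; apply: cZ.
- by apply: integrable_tri; apply: cZ.
rewrite RintegralD//; last 2 first.
- by apply: integrable_tri; apply: cZ.
- by apply: integrable_tri; apply: cZ.
rewrite !RintegralZl//; try (by apply: integrable_tri).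
rewrite !(rt0_green_tri _ _ h) (sum_I3 _ 0) !I3E.
move: (edge_mean K 0 phi) (edge_mean K 1 phi) (edge_mean K 2%:R phi) `|det K| => m0 m1 m2 d.
by move: (bary K 0 0) (bary K 1 0) (bary K 2%:R 0) => b0 b1 b2; ring.
Qed.

Lemma edge_mean0 K i f : (forall x, edge K i x -> f x = 0) -> edge_mean K i f = 0.
Proof.
move=> f0; rewrite /edge_mean.
rewrite (@eq_Rintegral _ _ _ _ _ (fun=> 0)) ?Rintegral_cst ?mul0r// => t /[!inE]/=;
  rewrite in_itv/= => t01.
by apply: f0; exists t.
Qed.

Lemma eq_edge_mean K i f g : (forall x, edge K i x -> f x = g x) ->
  edge_mean K i f = edge_mean K i g.
Proof.
move=> fg; apply: eq_Rintegral => t /[!inE]/=; rewrite in_itv/= => t01.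
by apply: fg; exists t.
Qed.

Definition aff1 (a b k : R) (x : R * R) : R := a * x.1 + b * x.2 + k.

Lemma continuous_aff1 (a b k : R) : continuous (aff1 a b k).
Proof. exact: continuous_affine. Qed.

Lemma Rintegral_tri_cst K (r : R) : Rintegral leb (tri K : set T2) (fun=> r) = r * area K.
Proof. by rewrite Rintegral_cst//; exact: measurable_tri. Qed.

(* Green's formula for the field [w ^ 2 * x], whose boundary terms cancel. *)
Lemma friedrichs (D : R) (a b k : 'I_(ntri M) -> R) :
  (forall K x, tri K x -> edot x x <= D ^+ 2) ->
  (forall K i, neighbour K i = None ->
    forall x, edge K i x -> aff1 (a K) (b K) (k K) x = 0) ->
  (forall K i L, neighbour K i = Some L ->
    forall x, edge K i x -> aff1 (a K) (b K) (k K) x = aff1 (a L) (b L) (k L) x) ->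
  \sum_K Rintegral leb (tri K : set T2) (fun x => aff1 (a K) (b K) (k K) x ^+ 2) <=
  D ^+ 2 * \sum_K area K * (a K ^+ 2 + b K ^+ 2).
Proof.
move=> hD bdry inner.
pose w K := aff1 (a K) (b K) (k K).
have C1w K : C1grad (w K) (fun=> a K) (fun=> b K) by exact: C1grad_affine.
have C1w2 K := C1gradM (C1w K) (C1w K).
have cw K : continuous (w K) by exact: continuous_aff1.
have cw2 K : continuous (fun x => w K x * w K x) by have [] := C1w2 K.
have sum0 : \sum_K \sum_i (`|det K| * bary K i 0) * edge_mean K i (fun x => w K x * w K x) = 0.
  apply: (sum_flip0 Mconf).
  - move=> K i nb; rewrite edge_mean0 ?mulr0// => x Kx.
    by rewrite /w (bdry _ _ nb _ Kx) mul0r.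
  - move=> K i L j nb E.
    have EE : edge_mean L j (fun x => w L x * w L x) = edge_mean K i (fun x => w K x * w K x).
      rewrite (edge_mean_sym (cw2 L) E); apply: eq_edge_mean => x Kx.
      by rewrite /w (inner _ _ _ nb _ Kx).
    by rewrite (orient_opp Mconf _ nb E) EE mulNr.
apply: (@le_trans _ _ (D ^+ 2 * (\sum_K area K * (a K ^+ 2 + b K ^+ 2)) +
  \sum_K \sum_i (`|det K| * bary K i 0) * edge_mean K i (fun x => w K x * w K x)));
  last by rewrite sum0 addr0.
rewrite mulr_sumr -big_split/=; apply: ler_sum => K _.
rewrite -(radial_green_tri K (C1w2 K)).
rewrite (_ : D ^+ 2 * (area K * _) = D ^+ 2 * (a K ^+ 2 + b K ^+ 2) * area K);
  last by rewrite mulrCA mulrC.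
rewrite -Rintegral_tri_cst.
have mK := measurable_tri K.
have cR : continuous (fun x => x.1 * (w K x * a K + w K x * a K) + x.2 * (w K x * b K +
  w K x * b K) + 2 * (w K x * w K x)).
  move=> x; apply: cvgD; [apply: cvgD|]; apply: cvgM; try exact: cvg_cst.
  - exact: cvg_fst.
  - by apply: cvgD; apply: cvgM; try exact: cvg_cst; exact: cw.
  - exact: cvg_snd.
  - by apply: cvgD; apply: cvgM; try exact: cvg_cst; exact: cw.
  - exact: cw2.
rewrite -RintegralD//; last 2 first.
- by apply: integrable_tri; exact: cst_continuous.
- exact: integrable_tri.
apply: le_Rintegral => //.
- by apply: integrable_tri => x; exact: cw2.
- apply: integrable_tri => x; apply: cvgD; [exact: cvg_cst|exact: cR].
- move=> x Kx; have := hD _ _ Kx; rewrite -/(w K) /edot.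
  move=> xD; set W := w K x.
  (* The divergence contributes twice [W ^+ 2]; one copy is the left-hand side, the other completes
     the square of [W] plus the radial derivative, whose own square is at most [D ^+ 2] times that
     of the gradient. *)
  suff : 0 <= D ^+ 2 * (a K ^+ 2 + b K ^+ 2) + 2 * (W * (x.1 * a K + x.2 * b K)) + W ^+ 2 by lra.
  have h : (x.1 * a K + x.2 * b K) ^+ 2 <= D ^+ 2 * (a K ^+ 2 + b K ^+ 2).
    apply: le_trans (cauchy_schwarz2 _ _ _ _) _; rewrite ler_wpM2r//.
    by rewrite addr_ge0// sqr_ge0.
  move: h; set V := x.1 * a K + _; have := sqr_ge0 (W + V); rewrite sqrrD.
  move: (D ^+ 2 * _) => Q; rewrite mulr2n; lra.
Qed.

End Friedrichs.

(** * Continuous piecewise affine functions with prescribed vertex values *)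

Section NodalInterpolation.
Variables (R : realType) (M : mesh R) (Omega : set (R * R)).
Hypotheses (Oopen : open Omega) (Oreg : Omega = (closure Omega)°).
Hypothesis Mconf : conforming_triangulation M Omega.
Variable nu : R * R -> R.
Implicit Types (K L : 'I_(ntri M)) (i j k : 'I_3) (x y z : R * R).

(** The interpolant is kept as an affine function on the whole plane; its coefficients are those of
    the barycentric coordinates weighted by the values of [nu] at the vertices. *)
Definition interp_gx K : R := \sum_i nu (vtx K i) * bgx K i.
Definition interp_gy K : R := \sum_i nu (vtx K i) * bgy K i.
Definition interp_cst K : R := \sum_i nu (vtx K i) * (cross (ea K i) (eb K i) / det K).
Definition interp K : R * R -> R := aff1 (interp_gx K) (interp_gy K) (interp_cst K).

Lemma interp_bary K x : interp K x = \sum_i nu (vtx K i) * bary K i x.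
Proof.
rewrite /interp /aff1 /interp_gx /interp_gy /interp_cst !mulr_suml -!big_split/=.
by apply: eq_bigr => i _; rewrite baryE; ring.
Qed.

Lemma interp_edge K i x : bary K i x = 0 ->
  interp K x = nu (ea K i) * bary K (i + 1) x + nu (eb K i) * bary K (i + 2%:R) x.
Proof. by move=> h; rewrite interp_bary (sum_I3 _ i) h mulr0 add0r. Qed.

Lemma edge_ea K i : edge K i (ea K i).
Proof. by exists 0; rewrite ?lexx ?ler01// subr0 scale1r scale0r addr0. Qed.

Lemma edge_eb K i : edge K i (eb K i).
Proof. by exists 1; rewrite ?lexx ?ler01// subrr scale1r scale0r add0r. Qed.

(** On an edge only the values at its two ends enter, and these are common to both triangles. *)
Lemma interp_shared K i L x : neighbour K i = Some L -> edge K i x ->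
  interp K x = interp L x.
Proof.
move=> /(neighbourP Mconf)[_ [j E]] /(edgeP Mconf)[h _].
have [hL _] := edge_eq_bary Mconf (esym E) h.
rewrite (interp_edge h) (interp_edge hL).
have := bary_sum i x (det_neq0 Mconf K); rewrite h add0r => s1.
have xE := bary_line Mconf h.
have -> : bary L (j + 1) x = bary L (j + 1) (bary K (i + 1) x *: ea K i + bary K (i +
  2%:R) x *: eb K i).
  by rewrite -xE.
have -> : bary L (j + 2%:R) x = bary L (j + 2%:R) (bary K (i + 1) x *: ea K i + bary K (i +
  2%:R) x *: eb K i).
  by rewrite -xE.
rewrite !bary_aff//.
by case: (edge_eqP Mconf (esym E)) => -[-> ->];
  rewrite !(bary_ea Mconf) !(bary_eb Mconf) !I3_neq !eqxx !mulr0 !mulr1 ?addr0 ?add0r// addrC.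
Qed.

Hypothesis nu_out : forall z, ~ Omega z -> nu z = 0.

Lemma interp_boundary K i x : neighbour K i = None -> edge K i x -> interp K x = 0.
Proof.
move=> nb /(edgeP Mconf)[h _]; rewrite (interp_edge h).
rewrite !nu_out ?mul0r ?addr0//; apply: (boundary_edge Oopen Mconf nb).
  exact: edge_eb.
exact: edge_ea.
Qed.

Lemma interp_vtx K i : interp K (vtx K i) = nu (vtx K i).
Proof.
rewrite interp_bary (bigD1 i)//= (bary_vtxE Mconf) eqxx mulr1 big1 ?addr0// => j ji.
by rewrite (bary_vtxE Mconf) (negbTE ji) mulr0.
Qed.

Lemma interp_agree K L x : tri K x -> tri L x -> interp K x = interp L x.
Proof.
move=> Kx Lx; have [->//|KL] := eqVneq K L.
case: (Mconf) => _ _ /(_ _ _ KL)[h|[i [j [E h]]]|[i [j [E h]]]].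
- by have : (tri K `&` tri L) x by []; rewrite h.
- have : (tri K `&` tri L) x by []; rewrite h /= => ->.
  by rewrite interp_vtx E interp_vtx.
- have : (tri K `&` tri L) x by []; rewrite h => Ex.
  have nb : neighbour K i = Some L by apply/(neighbourP Mconf); rewrite eq_sym; split=> //;
    exists j.
  exact: interp_shared nb Ex.
Qed.

(** Interior points of triangles and of shared edges belong to [Omega]; what remains are edges
    without neighbour and vertices outside [Omega]. *)
Lemma interp_out K x : tri K x -> ~ Omega x -> interp K x = 0.
Proof.
move=> Kx Ox; have bK := (triP x (det_neq0 Mconf K)).1 Kx.
have [[i i0]|pos] := pselect (exists i, bary K i x = 0); last first.
  case: Ox; apply: (interior_Omega Oreg Mconf (K := K)) => i.
  by rewrite lt_neqAle bK andbT eq_sym; apply/eqP => h; apply: pos; exists i.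
have Ex : edge K i x by apply/(edgeP Mconf).
case E : (neighbour K i) => [L|]; last exact: interp_boundary E Ex.
have s1 := bary_sum i x (det_neq0 Mconf K); rewrite i0 add0r in s1.
have xE := bary_line Mconf i0.
rewrite (interp_edge i0).
have [h1|h1] := eqVneq (bary K (i + 1) x) 0.
  have xb : x = eb K i by rewrite xE h1 (_ : bary K (i + 2%:R) x = 1) ?scale0r ?scale1r ?add0r//;
    lra.
  by rewrite h1 mulr0 add0r -xb (nu_out Ox) mul0r.
have [h2|h2] := eqVneq (bary K (i + 2%:R) x) 0.
  have xb : x = ea K i by rewrite xE h2 (_ : bary K (i + 1) x = 1) ?scale0r ?scale1r ?addr0//; lra.
  by rewrite h2 mulr0 addr0 -xb (nu_out Ox) mul0r.
case: Ox; apply: (shared_edge_Omega Oreg Mconf E i0).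
  by rewrite lt_neqAle eq_sym h1 bK.
by rewrite lt_neqAle eq_sym h2 bK.
Qed.

(** By [interp_agree] the triangle picked does not matter; off the mesh the value 0 is arbitrary. *)
Definition interp_fun x : R := if [pick K | `[< tri K x >]] is Some K then interp K x else 0.

Lemma interp_funE K x : tri K x -> interp_fun x = interp K x.
Proof.
move=> Kx; rewrite /interp_fun; case: pickP => [L /asboolP Lx|/(_ K)]; first exact: interp_agree.
by case: asboolP.
Qed.

(** Pasting over finitely many closed triangles. *)
Lemma interp_fun_continuous : {within closure Omega, continuous interp_fun}.
Proof.
have -> : closure Omega = \big[setU/set0]_(K <- enum 'I_(ntri M)) tri K.
  rewrite big_enum; apply/seteqP; split => [x /(closure_tri Mconf)[K Kx]|].
    by rewrite (bigD1 K)//=; left.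
  elim/big_ind : _ => // [A B hA hB x [/hA|/hB]//|K _]; exact: (tri_closure Mconf).
have : closed (\big[setU/set0]_(K <- enum 'I_(ntri M)) tri K) /\
   {within \big[setU/set0]_(K <- enum 'I_(ntri M)) tri K, continuous interp_fun}.
  elim: (enum _) => [|K s [cs IH]].
    rewrite big_nil; split; first exact: closed0.
    by apply: continuous_subspace0.
  rewrite big_cons; split; first by apply: closedU => //; exact: (tri_closed Mconf).
  apply: withinU_continuous => //; first exact: (tri_closed Mconf).
  have H : {in tri K, interp K =1 interp_fun}.
    by move=> x /[!inE] Kx; rewrite (interp_funE Kx).
  by apply: (subspace_eq_continuous H); apply: continuous_subspaceT; exact: continuous_aff1.
by case.
Qed.

End NodalInterpolation.

(** * Bounds by the jumps *)

Section Estimate.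
Variables (R : realType) (M : mesh R) (Omega : set (R * R)).
Hypotheses (Oopen : open Omega) (Oreg : Omega = (closure Omega)°).
Hypothesis Mconf : conforming_triangulation M Omega.
Variables (kappa : R) (rad : 'I_(ntri M) -> R) (ctr : 'I_(ntri M) -> R * R).
Hypothesis kappa1 : 1 <= kappa.
Hypothesis discs : forall K, disc_in kappa (ctr K) (rad K) K.
Variables (ga gb gk : 'I_(ntri M) -> R).
Local Notation mu := (@lebesgue_measure R).
Local Notation leb := (mu \x mu)%E.
Local Notation T2 := (measurableTypeR R * measurableTypeR R)%type.
Implicit Types (K L : 'I_(ntri M)) (i j k : 'I_3) (x y z : R * R).

Definition pw K x : R := aff1 (ga K) (gb K) (gk K) x.

Definition elen K i : R := enorm (eb K i - ea K i).

Definition jsq K i : R :=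
  if neighbour K i is Some L then (ga K - ga L) ^+ 2 + (gb K - gb L) ^+ 2
  else ga K ^+ 2 + gb K ^+ 2.

Definition jest : R := \sum_K Num.sqrt (area K) * \sum_i elen K i * jsq K i.

Definition energy : R := \sum_K area K * (ga K ^+ 2 + gb K ^+ 2).

Lemma rad_gt0 K : 0 < rad K. Proof. by have [] := discs K. Qed.

Lemma elen_ge K i : 2 * rad K <= elen K i.
Proof. exact: (edge_ge_disc Mconf i (discs K)). Qed.

Lemma elen_gt0 K i : 0 < elen K i.
Proof. by apply: lt_le_trans (elen_ge K i); rewrite mulr_gt0 ?rad_gt0. Qed.

Lemma elen_le K i : elen K i <= 2 * kappa * rad K.
Proof.
have [_ _ h] := discs K; rewrite mulrAC mulrC; apply: le_trans (h _ _ _ _) _ => //; exact: tri_vtx.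
Qed.

Lemma area_ge K : 2 * rad K ^+ 2 <= area K.
Proof. exact: (area_ge_disc Mconf (discs K)). Qed.

Lemma area_gt0 K : 0 < area K.
Proof. by apply: lt_le_trans (area_ge K); rewrite mulr_gt0// exprn_gt0// rad_gt0. Qed.

Lemma area_le K : area K <= 2 * kappa ^+ 2 * rad K ^+ 2.
Proof.
have [r0 _ h] := discs K.
have k0 : 0 <= kappa * (2 * rad K) by rewrite mulr_ge0 ?mulr_ge0//;
  [exact: le_trans kappa1|exact: ltW].
have := det_le_diam k0 h; rewrite (area_det Mconf) => hd.
rewrite ler_pdivrMr//; apply: le_trans hd _; rewrite le_eqVlt; apply/orP; left; apply/eqP; ring.
Qed.

Lemma sqrt_area_ge K : rad K <= Num.sqrt (area K).
Proof.
rewrite -(@ler_pXn2r _ 2%N)// ?nnegrE ?sqrtr_ge0// ?(ltW (rad_gt0 K))//.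
rewrite sqr_sqrtr; last exact/ltW/area_gt0.
by apply: le_trans (area_ge K); rewrite ler_peMl// ?sqr_ge0// ler1n.
Qed.

Lemma sqrt_area_le K : Num.sqrt (area K) <= 2 * kappa * rad K.
Proof.
have k0 : 0 <= 2 * kappa * rad K.
  by rewrite mulr_ge0 ?mulr_ge0 ?(le_trans _ kappa1)//; exact/ltW/rad_gt0.
rewrite -(@ler_pXn2r _ 2%N)// ?nnegrE ?sqrtr_ge0//.
rewrite sqr_sqrtr; last exact/ltW/area_gt0.
apply: le_trans (area_le K) _; rewrite !exprMn ler_wpM2r ?sqr_ge0//.
rewrite ler_wpM2r ?sqr_ge0//; lra.
Qed.

Lemma jsq_ge0 K i : 0 <= jsq K i.
Proof. by rewrite /jsq; case: neighbour => [L|]; rewrite addr_ge0 ?sqr_ge0. Qed.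

Lemma elen_shared K i L j : edge L j = edge K i -> elen K i = elen L j.
Proof.
move=> Ej; rewrite /elen; case: (edge_eqP Mconf Ej) => -[-> ->] //.
by rewrite /enorm /edot; congr Num.sqrt; rewrite /=; ring.
Qed.

Lemma elen_sqr K i : elen K i ^+ 2 = edot (eb K i - ea K i) (eb K i - ea K i).
Proof. exact: enorm_sqr. Qed.

Local Opaque area elen.

Lemma sqrB_le (x y : R) : (x - y) ^+ 2 <= 2 * x ^+ 2 + 2 * y ^+ 2.
Proof. by have := sqr_ge0 (x + y); lra. Qed.

(** Each edge term is shared out between its two triangles. The 12 is 3 edges times 4; the 36 is 4
    times 9, a crude count of the pairs of local edge indices through which a given triangle can be
    a neighbour. *)
Lemma jest_le_energy : jest <= (12 * kappa ^+ 2 + 36 * kappa ^+ 3) * energy.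
Proof.
pose e K := ga K ^+ 2 + gb K ^+ 2.
have e0 K : 0 <= e K by rewrite addr_ge0 ?sqr_ge0.
have k0 : 0 < kappa by apply: lt_le_trans kappa1.
pose nb K i L : R := (neighbour K i == Some L)%:R.
have step K i : Num.sqrt (area K) * (elen K i * jsq K i) <=
   4 * kappa ^+ 2 * (area K * e K) + 4 * kappa ^+ 3 * \sum_L nb K i L * (area L * e L).
  have s0 := sqrtr_ge0 (area K); have s1 := sqrt_area_le K; have l1 := elen_le K i;
    have l2 := elen_gt0 K i.
  have r0 := rad_gt0 K; have a1 := area_ge K.
  have own : Num.sqrt (area K) * elen K i <= 2 * kappa ^+ 2 * area K.
    apply: (@le_trans _ _ ((2 * kappa * rad K) * (2 * kappa * rad K)));
      first by rewrite ler_pM// ltW.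
    rewrite (_ : _ * _ = 2 * kappa ^+ 2 * (2 * rad K ^+ 2)); last by ring.
    by rewrite ler_wpM2l// mulr_ge0// sqr_ge0.
  have ownE : 0 <= area K * e K by rewrite mulr_ge0// ltW// area_gt0.
  rewrite /jsq; case E : (neighbour K i) => [L|]; last first.
    rewrite -/(e K) [leLHS]mulrA; apply: (@le_trans _ _ (2 * kappa ^+ 2 * area K * e K));
      first by rewrite ler_wpM2r.
    rewrite big1 ?mulr0 ?addr0; last by move=> L _; rewrite /nb E mul0r.
    by rewrite -mulrA ler_wpM2r//; have := sqr_ge0 kappa; lra.
  rewrite (bigD1 L)//= /nb E eqxx mul1r big1 ?addr0; last first.
    by move=> L' LL'; rewrite (_ : (Some L == Some L') = false) ?mul0r//; apply/negbTE;
      rewrite eq_sym; apply: contra LL' => /eqP[->].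
  have [_ [j Ej]] := (neighbourP Mconf _ _ _).1 E.
  have EL := elen_shared Ej.
  (* The common edge compares the sizes of the two triangles: its length dominates [2 * rad K] and
     is at most [2 * kappa * rad L]. *)
  have other : Num.sqrt (area K) * elen K i <= 2 * kappa ^+ 3 * area L.
    apply: (@le_trans _ _ (kappa * elen K i * elen K i)).
      rewrite ler_wpM2r ?(ltW l2)//; apply: le_trans s1 _;
        rewrite mulrAC mulrC ler_wpM2l ?(ltW k0)//.
      exact: elen_ge.
    rewrite EL; have lL := elen_le L j; have lL0 := elen_gt0 L j.
    apply: (@le_trans _ _ (kappa * ((2 * kappa * rad L) * (2 * kappa * rad L)))).
      by rewrite -mulrA ler_wpM2l ?(ltW k0)// ler_pM// ltW.
    rewrite (_ : kappa * _ = 2 * kappa ^+ 3 * (2 * rad L ^+ 2)); last by ring.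
    by rewrite ler_wpM2l ?area_ge// mulr_ge0// exprn_ge0// ltW.
  have jle : (ga K - ga L) ^+ 2 + (gb K - gb L) ^+ 2 <= 2 * e K + 2 * e L.
    apply: le_trans (lerD (sqrB_le (ga K) (ga L)) (sqrB_le (gb K) (gb L))) _.
    by rewrite /e !mulrDr addrACA.
  rewrite [leLHS]mulrA; apply: (@le_trans _ _ (Num.sqrt (area K) * elen K i * (2 * e K + 2 * e L))).
    by rewrite ler_wpM2l// mulr_ge0// ltW.
  have p1 : Num.sqrt (area K) * elen K i * e K <= 2 * kappa ^+ 2 * area K *
    e K by rewrite ler_wpM2r.
  have p2 : Num.sqrt (area K) * elen K i * e L <= 2 * kappa ^+ 3 * area L *
    e L by rewrite ler_wpM2r.
  rewrite mulrDr; apply: lerD.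
    by rewrite mulrCA [leRHS](_ : _ = 2 * (2 * kappa ^+ 2 * area K * e K)) ?ler_wpM2l//; ring.
  by rewrite mulrCA [leRHS](_ : _ = 2 * (2 * kappa ^+ 3 * area L * e L)) ?ler_wpM2l//; ring.
have bound : jest <= \sum_K \sum_i (4 * kappa ^+ 2 * (area K * e K) +
  4 * kappa ^+ 3 * \sum_L nb K i L * (area L * e L)).
  by apply: ler_sum => K _; rewrite mulr_sumr; apply: ler_sum => i _; exact: step.
apply: le_trans bound _.
rewrite (eq_bigr (fun K => 12 * kappa ^+ 2 * (area K * e K) +
  4 * kappa ^+ 3 * \sum_i \sum_L nb K i L * (area L * e L))); last first.
  move=> K _; rewrite big_split/= sumr_const card_ord; congr (_ + _).
    by rewrite -mulr_natl; ring.
  by rewrite mulr_sumr.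
rewrite big_split/= -!mulr_sumr [leRHS]mulrDl; apply: lerD; first by [].
rewrite (_ : 36 * kappa ^+ 3 = 4 * kappa ^+ 3 * 9); last by ring.
rewrite -[leRHS]mulrA ler_wpM2l//; first by rewrite mulr_ge0// exprn_ge0// ltW.
have -> : \sum_K \sum_i \sum_L nb K i L * (area L * e L) =
   \sum_L (\sum_K \sum_i nb K i L) * (area L * e L).
  under eq_bigr do rewrite exchange_big/=.
  rewrite exchange_big/=; apply: eq_bigr => L _; rewrite mulr_suml; apply: eq_bigr => K _.
  by rewrite mulr_suml.
rewrite /energy mulr_sumr; apply: ler_sum => L _; rewrite ler_wpM2r//.
  by rewrite mulr_ge0// ltW// area_gt0.
(* Being neighbours is symmetric, so the triangles next to [L] are counted through the three edges
   of [L]; the index [i] stays in the sum, whence 3 times 3. *)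
apply: (@le_trans _ _ (\sum_K \sum_i \sum_j (neighbour L j == Some K)%:R)).
  apply: ler_sum => K _; apply: ler_sum => i _; rewrite /nb.
  case: eqP => [E|_]; last by apply: sumr_ge0 => j _; rewrite ler0n.
  have [LK [j Ej]] := (neighbourP Mconf _ _ _).1 E.
  rewrite (bigD1 j)//= (neighbour_sym Mconf LK Ej) eqxx lerDl.
  by apply: sumr_ge0 => j' _; rewrite ler0n.
rewrite exchange_big/=.
apply: (@le_trans _ _ (\sum_(i : 'I_3) \sum_(j : 'I_3) 1)).
  apply: ler_sum => i _; rewrite exchange_big/=; apply: ler_sum => j _.
  case E : (neighbour L j) => [K|].
    rewrite (bigD1 K)//= eqxx big1 ?addr0// => K' KK'.
    by rewrite (_ : (Some K == Some K') = false)//; apply/negbTE; rewrite eq_sym;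
      apply: contra KK' => /eqP[->].
  by rewrite big1.
by rewrite !sumr_const !card_ord -mulrnA ler_nat.
Qed.

Definition mid K i : R * R := 2^-1 *: ea K i + 2^-1 *: eb K i.

Hypothesis continuity_mid : forall K i,
  if neighbour K i is Some L then pw K (mid K i) = pw L (mid K i)
  else pw K (mid K i) = 0.

(** A bound for the squared jump of [pw] at an end of edge [i], with outside value 0 at the
    boundary. [bnd] adds up all three edges, so that a path may leave [K] through any of them. *)
Definition bsq K i : R := elen K i ^+ 2 / 4 * jsq K i.
Definition bnd K : R := \sum_i Num.sqrt (bsq K i).

Lemma bsq_ge0 K i : 0 <= bsq K i.
Proof. by rewrite mulr_ge0 ?jsq_ge0// divr_ge0// sqr_ge0. Qed.

Lemma bnd_ge0 K : 0 <= bnd K.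
Proof. by apply: sumr_ge0 => i _; exact: sqrtr_ge0. Qed.

Lemma edge_endpoint K i z : at_vertex z K -> edge K i z -> z = ea K i \/ z = eb K i.
Proof.
move=> zK Ez; have iz := (edge_vertex_bary Mconf i zK).1 Ez.
case: zK => k kz; have := (vertex_eq Mconf kz i).1 iz.
rewrite -kz /ea /eb; elim/I3_ind: i {Ez iz}; elim/I3_ind: k {kz}; rewrite !I3E ?eqxx//;
  by [left|right].
Qed.

Lemma sqrt_bnd K i (u : R) : u ^+ 2 <= bsq K i -> `|u| <= bnd K.
Proof.
move=> h; apply: (@le_trans _ _ (Num.sqrt (bsq K i))).
  by rewrite -sqrtr_sqr ler_wsqrtr.
rewrite /bnd (bigD1 i)//= lerDl; apply: sumr_ge0 => j _; exact: sqrtr_ge0.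
Qed.

Lemma half_edge_cs K i z (a b : R) : z = ea K i \/ z = eb K i ->
  (a * (z.1 - (mid K i).1) + b * (z.2 - (mid K i).2)) ^+ 2 <= elen K i ^+ 2 / 4 * (a ^+ 2 + b ^+ 2).
Proof.
move=> hz; apply: le_trans (cauchy_schwarz2 _ _ _ _) _.
rewrite mulrC ler_wpM2r ?addr_ge0 ?sqr_ge0//.
rewrite elen_sqr /edot /mid; case: hz => ->; rewrite /= /GRing.scale/= le_eqVlt; apply/orP; left;
  apply/eqP; by field.
Qed.

(** The difference of the two affine functions vanishes at the midpoint, so at an end it is the
    gradient jump applied to half the edge. *)
Lemma vertex_jump K i L z : neighbour K i = Some L -> z = ea K i \/ z = eb K i ->
  `|pw K z - pw L z| <= bnd K.
Proof.
move=> E hz; apply: (@sqrt_bnd _ i); rewrite /bsq /jsq E.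
have := continuity_mid K i; rewrite E => h.
have := half_edge_cs (ga K - ga L) (gb K - gb L) hz; congr (_ ^+ 2 <= _).
have {}h : pw K (mid K i) - pw L (mid K i) = 0 by rewrite h subrr.
by rewrite -[RHS]subr0 -[X in _ = _ - X]h /pw /aff1; ring.
Qed.

Lemma vertex_boundary K i z : neighbour K i = None -> z = ea K i \/ z = eb K i ->
  `|pw K z| <= bnd K.
Proof.
move=> E hz; apply: (@sqrt_bnd _ i); rewrite /bsq /jsq E.
have := continuity_mid K i; rewrite E => h.
have := half_edge_cs (ga K) (gb K) hz; congr (_ ^+ 2 <= _).
by rewrite -[RHS]subr0 -[X in _ = _ - X]h /pw /aff1; ring.
Qed.

(** Telescoping; each crossing is charged to the triangle being left, hence [belast]. *)
Lemma path_bound z K p : path (adj z) K p ->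
  `|pw K z - pw (last K p) z| <= \sum_(L <- belast K p) bnd L.
Proof.
elim: p K => [|K' p IH] K /=; first by rewrite subrr normr0 big_nil.
move=> /andP[/asboolP[zK KK' [i [j [E Ez]]]] pth]; rewrite big_cons.
have nb : neighbour K i = Some K' by apply/(neighbourP Mconf); split=> //; exists j.
have -> : pw K z - pw (last K' p) z = (pw K z - pw K' z) + (pw K' z - pw (last K' p) z) by ring.
apply: le_trans (ler_normD _ _) _; rewrite lerD ?IH//.
by apply: (vertex_jump nb); exact: edge_endpoint.
Qed.

Definition fan z : pred 'I_(ntri M) := [pred K | `[< @at_vertex R M z K >]].
Lemma fanP z K : reflect (at_vertex z K) (K \in fan z).
Proof. by rewrite /fan inE; exact: asboolP. Qed.

Definition fan_sum z : R := \sum_(L in fan z) bnd L.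

Lemma uniq_fan_sum z (s : seq 'I_(ntri M)) : uniq s -> (forall L, L \in s -> at_vertex z L) ->
  \sum_(L <- s) bnd L <= fan_sum z.
Proof.
move=> us hs; rewrite big_uniq//= /fan_sum big_mkcond [leRHS]big_mkcond/=.
apply: ler_sum => L _; case: ifP => [/hs zL|_].
  by rewrite (introT (fanP z L) zL).
by case: ifP => // _; exact: bnd_ge0.
Qed.

Lemma path_at_vertex z K p : at_vertex z K -> path (adj z) K p ->
  forall L, L \in K :: p -> at_vertex z L.
Proof.
elim: p K => [|K' p IH] K zK /=; first by move=> _ L; rewrite inE => /eqP ->.
move=> /andP[a pth] L; rewrite inE => /predU1P[-> //|].
apply: IH => //; apply: (connect_at_vertex Mconf zK); exact: connect1.
Qed.

Definition nodal z : R :=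
  if `[< Omega z >] then (if [pick K in fan z] is Some K then pw K z else 0) else 0.

(** At an interior vertex a path leads to the triangle that defines [nodal z]; otherwise a path
    leads to a boundary edge, where the function itself is a jump. Paths are shortened to have no
    repetition, so each triangle of the fan is charged at most once. *)
Lemma nodal_bound z K : at_vertex z K -> `|pw K z - nodal z| <= fan_sum z.
Proof.
move=> zK; rewrite /nodal; case: asboolP => Oz.
  case: pickP => [K' /fanP zK'|/(_ K)/fanP//].
  have /connectP[p0 pth0 ->] := interior_vertex Oopen Mconf Oz zK zK'.
  case: (shortenP pth0) => p pth us _.
  apply: le_trans (path_bound pth) _; apply: uniq_fan_sum.
    by move: us; rewrite lastI rcons_uniq => /andP[].
  by move=> L Lp; apply: (path_at_vertex zK pth); rewrite lastI mem_rcons inE Lp orbT.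
rewrite subr0; have [L [i [/connectP[p0 pth0 LE] Ez nb]]] := boundary_vertex Oreg Mconf zK Oz.
move: LE Ez nb; case: (shortenP pth0) => p pth us _ LE Ez nb.
have zL : at_vertex z L.
  by apply: (path_at_vertex zK pth); rewrite LE mem_last.
have -> : pw K z = (pw K z - pw L z) + pw L z by ring.
apply: le_trans (ler_normD _ _) _.
(* The triangles left on the way pay for the crossings, the last one for its boundary edge; together
   they are [K :: p]. *)
apply: (@le_trans _ _ (\sum_(L <- K :: p) bnd L)); last first.
  by apply: uniq_fan_sum => //; exact: path_at_vertex.
rewrite lastI -cats1 big_cat big_seq1/=.
rewrite lerD//; first by rewrite LE; exact: path_bound.
rewrite -LE; apply: (vertex_boundary nb); exact: edge_endpoint.
Qed.

Lemma sum_sqr_le (I : finType) (P : pred I) (x : I -> R) :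
  (\sum_(i in P) x i) ^+ 2 <= #|P|%:R * \sum_(i in P) x i ^+ 2.
Proof.
set S := \sum_(i in P) x i ^+ 2.
have E (i : I) : \sum_(j in P) (x i ^+ 2 / 2 + x j ^+ 2 / 2) = #|P|%:R * (x i ^+ 2 / 2) + S / 2.
  by rewrite big_split/= sumr_const -mulr_suml mulr_natl.
rewrite expr2 big_distrlr/=.
apply: (@le_trans _ _ (\sum_(i in P) \sum_(j in P) (x i ^+ 2 / 2 + x j ^+ 2 / 2))).
  apply: ler_sum => i _; apply: ler_sum => j _.
  have := sqr_ge0 (x i - x j); lra.
rewrite (eq_bigr _ (fun (i : I) _ => E i)) big_split/= sumr_const -mulr_sumr -mulr_suml -/S.
by rewrite -[S / 2 *+ _]mulr_natl -mulrDr -splitr.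
Qed.

Lemma sum3_sqr_le (x : 'I_3 -> R) : (\sum_i x i) ^+ 2 <= 3 * \sum_i x i ^+ 2.
Proof.
rewrite !(sum_I3 _ 0) !I3E; have := sqr_ge0 (x 0 - x 1); have := sqr_ge0 (x 0 - x 2%:R).
have := sqr_ge0 (x 1 - x 2%:R); lra.
Qed.

Definition dv K i : R := pw K (vtx K i) - nodal (vtx K i).

(** One factor [elen] is traded for [Num.sqrt (area K)], which produces the weights of [jest]. *)
Lemma bsq_le K i : bsq K i <= kappa / 2 * (Num.sqrt (area K) * (elen K i * jsq K i)).
Proof.
have k0 : 0 <= kappa by apply: le_trans kappa1.
rewrite /bsq !mulrA ler_wpM2r ?jsq_ge0//.
have l1 := elen_le K i; have l0 := elen_gt0 K i; have s1 := sqrt_area_ge K.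
rewrite expr2 mulrAC ler_wpM2r ?(ltW l0)//.
rewrite ler_pdivrMr//; apply: le_trans l1 _.
have : kappa * rad K <= kappa * Num.sqrt (area K) by rewrite ler_wpM2l.
lra.
Qed.

(** The constant is 48 times 144 divided by 2: 48 is the fan size 16 times the 3 edges in [bnd], 144
    is 16 times the 9 pairs of vertex indices by which a triangle enters the fan of another, and
    [kappa / 2] comes from [bsq_le]. *)
Lemma dv_sum : \sum_K \sum_i dv K i ^+ 2 <= 3456 * kappa ^+ 5 * jest.
Proof.
have k0 : 0 <= kappa by apply: le_trans kappa1.
pose G L := \sum_i bsq L i.
have G0 L : 0 <= G L by apply: sumr_ge0 => i _; exact: bsq_ge0.
have card_le z : (#|fan z|%:R : R) <= 16 * kappa ^+ 2 by exact: (fan_card Mconf z discs).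
have d1 K i : dv K i ^+ 2 <= 48 * kappa ^+ 2 * \sum_(L in fan (vtx K i)) G L.
  have zK : at_vertex (vtx K i) K by exists i.
  apply: (@le_trans _ _ (fan_sum (vtx K i) ^+ 2)).
    by rewrite -real_normK ?num_real// ler_pXn2r// ?nnegrE ?normr_ge0 ?nodal_bound// sumr_ge0//
      => L _; exact: bnd_ge0.
  apply: le_trans (sum_sqr_le _ _) _.
  apply: (@le_trans _ _ (16 * kappa ^+ 2 * \sum_(L in fan (vtx K i)) bnd L ^+ 2)).
    by rewrite ler_wpM2r// sumr_ge0// => L _; exact: sqr_ge0.
  rewrite (_ : 48 * kappa ^+ 2 = 16 * kappa ^+ 2 * 3); last by ring.
  rewrite -[leRHS]mulrA ler_wpM2l ?mulr_ge0 ?sqr_ge0// mulr_sumr; apply: ler_sum => L _.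
  apply: le_trans (sum3_sqr_le _) _; rewrite ler_wpM2l//.
  by apply: ler_sum => j _; rewrite sqr_sqrtr// bsq_ge0.
have cnt L : \sum_(K : 'I_(ntri M)) \sum_i (L \in fan (vtx K i))%:R <= 144 * kappa ^+ 2 :> R.
  apply: (@le_trans _ _ (\sum_(K : 'I_(ntri M)) \sum_(i : 'I_3) \sum_(l : 'I_3) (vtx K i == vtx L
    l)%:R)).
    apply: ler_sum => K _; apply: ler_sum => i _.
    case: fanP => [[l lE]|_]; last by apply: sumr_ge0 => l _; rewrite ler0n.
    by rewrite (bigD1 l)//= lE eqxx lerDl; apply: sumr_ge0 => ? _; rewrite ler0n.
  rewrite exchange_big/=.
  apply: (@le_trans _ _ (\sum_(i : 'I_3) \sum_(l : 'I_3) 16 * kappa ^+ 2)).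
    apply: ler_sum => i _; rewrite exchange_big/=; apply: ler_sum => l _.
    apply: le_trans (card_le (vtx L l));
      rewrite -natr_sum ler_nat -sum1_card big_mkcond [leqRHS]big_mkcond/=.
    apply: leq_sum => K _; case: eqP => // E.
    by rewrite (introT (fanP (vtx L l) K)) //; exists i.
  rewrite !sumr_const !card_ord -mulrnA -mulr_natl.
  by rewrite le_eqVlt; apply/orP; left; apply/eqP; ring.
apply: (@le_trans _ _ (\sum_K \sum_i 48 * kappa ^+ 2 * \sum_(L in fan (vtx K i)) G L)).
  by apply: ler_sum => K _; apply: ler_sum => i _; exact: d1.
have -> : \sum_(K : 'I_(ntri M)) \sum_i 48 * kappa ^+ 2 * \sum_(L in fan (vtx K i)) G L =
   48 * kappa ^+ 2 * \sum_L (\sum_(K : 'I_(ntri M)) \sum_i (L \in fan (vtx K i))%:R) * G L.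
  rewrite mulr_sumr.
  under eq_bigr => K _ do under eq_bigr => i _ do rewrite big_mkcond/= mulr_sumr.
  under eq_bigr do rewrite exchange_big/=.
  rewrite exchange_big/=; apply: eq_bigr => L _; rewrite mulr_suml mulr_sumr; apply: eq_bigr => K _.
  rewrite mulr_suml mulr_sumr; apply: eq_bigr => i _.
  by case: ifP => _; rewrite ?mul1r ?mul0r.
apply: (@le_trans _ _ (48 * kappa ^+ 2 * (144 * kappa ^+ 2 * \sum_L G L))).
  rewrite ler_wpM2l ?mulr_ge0 ?sqr_ge0// mulr_sumr; apply: ler_sum => L _.
  by rewrite ler_wpM2r.
apply: (@le_trans _ _ (48 * kappa ^+ 2 * (144 * kappa ^+ 2 * (kappa / 2 * jest)))).
  rewrite ler_wpM2l ?mulr_ge0 ?sqr_ge0// ler_wpM2l ?mulr_ge0 ?sqr_ge0// /jest mulr_sumr.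
  apply: ler_sum => L _; rewrite !mulr_sumr; apply: ler_sum => i _; exact: bsq_le.
by rewrite le_eqVlt; apply/orP; left; apply/eqP; field.
Qed.

Definition hx K : R := interp_gx nodal K.
Definition hy K : R := interp_gy nodal K.
Definition hk K : R := interp_cst nodal K.

Lemma interpE K x : aff1 (hx K) (hy K) (hk K) x = \sum_i nodal (vtx K i) * bary K i x.
Proof. exact: interp_bary. Qed.

Lemma pw_interp K x : pw K x = \sum_i pw K (vtx K i) * bary K i x.
Proof.
have d0 := det_neq0 Mconf K.
rewrite {1}(bary_recon 0 x d0) (sum_I3 _ 0) !I3E.
have := bary_sum 0 x d0; rewrite !I3E => s1.
have -> : bary K 0 x = 1 - bary K 1 x - bary K 2%:R x by rewrite -s1; ring.
rewrite /pw /aff1 /= /GRing.scale/=.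
by move: (bary K 1 x) (bary K 2%:R x) => b1 b2; ring.
Qed.

Lemma diffE K x : pw K x - aff1 (hx K) (hy K) (hk K) x = \sum_i dv K i * bary K i x.
Proof.
by rewrite interpE pw_interp -sumrB; apply: eq_bigr => i _; rewrite /dv mulrBl.
Qed.

(** Both sides of [diffE] are affine; their values at 0 and at the unit vectors isolate the
    gradients. *)
Lemma diff_gradE K : ga K - hx K = \sum_i dv K i * bgx K i /\ gb K - hy K = \sum_i dv K i * bgy K i.
Proof.
have h x := diffE K x.
have h0 := h 0; have h1 := h (1, 0); have h2 := h (0, 1).
split.
  transitivity ((pw K (1, 0) - aff1 (hx K) (hy K) (hk K) (1,
    0)) - (pw K 0 - aff1 (hx K) (hy K) (hk K) 0)).
    by rewrite /pw /aff1/=; ring.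
  rewrite h0 h1 -sumrB; apply: eq_bigr => i _; rewrite !baryE/=; ring.
transitivity ((pw K (0, 1) - aff1 (hx K) (hy K) (hk K) (0,
  1)) - (pw K 0 - aff1 (hx K) (hy K) (hk K) 0)).
  by rewrite /pw /aff1/=; ring.
rewrite h0 h2 -sumrB; apply: eq_bigr => i _; rewrite !baryE/=; ring.
Qed.

(** The area is at most [2 * kappa ^+ 2 * rad K ^+ 2], each squared coordinate gradient at most the
    inverse of [4 * rad K ^+ 2], and squaring a sum of three terms costs 3. *)
Lemma diff_energy K : area K * ((ga K - hx K) ^+ 2 + (gb K - hy K) ^+ 2) <=
  3 / 2 * kappa ^+ 2 * \sum_i dv K i ^+ 2.
Proof.
have [-> ->] := diff_gradE K.
have r0 := rad_gt0 K.
have r2 : 0 < rad K ^+ 2 by rewrite exprn_gt0.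
have S0 : 0 <= \sum_i dv K i ^+ 2 by apply: sumr_ge0 => i _; exact: sqr_ge0.
have key : ((\sum_i dv K i * bgx K i) ^+ 2 +
  (\sum_i dv K i * bgy K i) ^+ 2) * (4 * rad K ^+ 2) <= 3 * \sum_i dv K i ^+ 2.
  apply: (@le_trans _ _ ((3 * \sum_i (dv K i * bgx K i) ^+ 2 +
    3 * \sum_i (dv K i * bgy K i) ^+ 2) * (4 * rad K ^+ 2))).
    rewrite ler_wpM2r ?(ltW (mulr_gt0 _ r2))//.
    by apply: lerD; exact: sum3_sqr_le.
  rewrite -mulrDr -big_split/= -mulrA ler_wpM2l// mulr_suml; apply: ler_sum => i _.
  have := bary_grad_disc Mconf i (discs K) => h.
  rewrite (_ : _ * _ = dv K i ^+ 2 * ((bgx K i ^+ 2 + bgy K i ^+ 2) * (2 * rad K) ^+ 2));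
    last by ring.
  by rewrite ler_piMr// sqr_ge0.
have a1 := area_le K; have a0 := area_gt0 K.
set V := _ + _ in key *.
have V0 : 0 <= V by rewrite addr_ge0// sqr_ge0.
apply: (@le_trans _ _ (2 * kappa ^+ 2 * rad K ^+ 2 * V)); first by rewrite ler_wpM2r.
rewrite (_ : _ * V = kappa ^+ 2 / 2 * (V * (4 * rad K ^+ 2))); last by field.
apply: le_trans (ler_wpM2l _ key) _; first by rewrite divr_ge0// sqr_ge0.
by rewrite le_eqVlt; apply/orP; left; apply/eqP; field.
Qed.

Hypothesis orthogonal_nodal : \sum_K area K * (ga K * hx K + gb K * hy K) = 0.

(** Pythagoras: the mixed term vanishes, so the squared distance is the sum of both energies. *)
Lemma energy_le_diff : energy <= \sum_K area K * ((ga K - hx K) ^+ 2 + (gb K - hy K) ^+ 2).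
Proof.
have -> : \sum_K area K * ((ga K - hx K) ^+ 2 + (gb K - hy K) ^+ 2) =
  energy + \sum_K area K * (hx K ^+ 2 + hy K ^+ 2) - 2 * \sum_K area K * (ga K * hx K +
    gb K * hy K).
  by rewrite /energy mulr_sumr -big_split/= -sumrB; apply: eq_bigr => K _; ring.
rewrite orthogonal_nodal mulr0 subr0 lerDl; apply: sumr_ge0 => K _.
by rewrite mulr_ge0 ?addr_ge0 ?sqr_ge0// ltW// area_gt0.
Qed.

Lemma diff_energy_sum : \sum_K area K * ((ga K - hx K) ^+ 2 + (gb K - hy K) ^+ 2) <=
  5184 * kappa ^+ 7 * jest.
Proof.
apply: (@le_trans _ _ (3 / 2 * kappa ^+ 2 * \sum_K \sum_i dv K i ^+ 2)).
  by rewrite mulr_sumr; apply: ler_sum => K _; exact: diff_energy.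
apply: le_trans (ler_wpM2l _ dv_sum) _; first by rewrite mulr_ge0 ?sqr_ge0// divr_ge0.
by rewrite le_eqVlt; apply/orP; left; apply/eqP; field.
Qed.

(* The gradient is orthogonal to that of the nodal interpolant, so that only the
   vertex differences [dv] remain. *)
Lemma energy_le_jest : energy <= 5184 * kappa ^+ 7 * jest.
Proof. exact: le_trans energy_le_diff diff_energy_sum. Qed.

Lemma nodal_out z : ~ Omega z -> nodal z = 0.
Proof. by rewrite /nodal; case: asboolP. Qed.

Definition mass : R := \sum_K Rintegral leb (tri K : set T2) (fun x => pw K x ^+ 2).

(** Split v as w plus (v - w). The 8 is 2 from the split times 4 from bounding the gradient of w by
    those of v and v - w; the 12 is 2 from the split, 3 from three vertices and 2 from the area
    bound. *)
Lemma mass_le_jest (D : R) : (forall K x, tri K x -> edot x x <= D ^+ 2) ->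
  mass <= D ^+ 2 * (8 * (5184 * kappa ^+ 7) + 12 * (3456 * kappa ^+ 5)) * jest.
Proof.
move=> hD.
have k0 : 0 <= kappa by apply: le_trans kappa1.
(* All points are within [|D|] of the origin, so the diameter is at most [2 * |D|]. *)
have areaD K : area K <= 2 * D ^+ 2.
  have h : `|det K| <= (2 * `|D|) ^+ 2.
    apply: det_le_diam => [|x y Kx Ky]; first by rewrite mulr_ge0.
    rewrite enorm_le ?mulr_ge0// exprMn real_normK ?num_real//.
    have := hD _ _ Kx; have := hD _ _ Ky; rewrite /edot/=.
    have := sqr_ge0 (x.1 + y.1); have := sqr_ge0 (x.2 + y.2); lra.
  by move: h; rewrite (area_det Mconf) exprMn real_normK ?num_real//; lra.
have fr := friedrichs Mconf hD (fun K i nb x => interp_boundary Oopen Mconf nodal_out nb (x := x))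
  (fun K i L nb x => interp_shared Mconf nodal nb (x := x)).
have hE : \sum_K area K * (hx K ^+ 2 + hy K ^+ 2) <= 4 * (5184 * kappa ^+ 7 * jest).
  apply: (@le_trans _ _ (2 * energy + 2 * \sum_K area K * ((ga K - hx K) ^+ 2 +
    (gb K - hy K) ^+ 2))).
    rewrite /energy !mulr_sumr -big_split/=; apply: ler_sum => K _.
    rewrite !(mulrCA 2) -mulrDr ler_wpM2l//; first exact/ltW/area_gt0.
    have := sqrB_le (ga K) (ga K - hx K); have := sqrB_le (gb K) (gb K - hy K).
    by rewrite !subKr; lra.
  have := energy_le_jest; have := diff_energy_sum;
    move: (5184 * _ * _) energy (\sum_K _) => ? ? ?; lra.
have one K : Rintegral leb (tri K : set T2) (fun x => pw K x ^+ 2) <=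
   2 * Rintegral leb (tri K : set T2) (fun x => aff1 (hx K) (hy K) (hk K) x ^+ 2) +
   12 * D ^+ 2 * \sum_i dv K i ^+ 2.
  have cpw : continuous (fun x => pw K x ^+ 2).
    by move=> x; apply: cvgM; exact: continuous_aff1.
  have cw : continuous (fun x => aff1 (hx K) (hy K) (hk K) x ^+ 2).
    by move=> x; apply: cvgM; exact: continuous_aff1.
  set S := \sum_i _; have S0 : 0 <= S by apply: sumr_ge0 => i _; exact: sqr_ge0.
  apply: (@le_trans _ _ (2 * Rintegral leb (tri K : set T2) (fun x =>
    aff1 (hx K) (hy K) (hk K) x ^+ 2) + (6 * S) * area K)).
    rewrite -(Rintegral_tri_cst Mconf) -RintegralZl; last 2 first.
    - exact: (measurable_tri Mconf K).
    - exact: (integrable_tri Mconf).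
    rewrite -RintegralD; last 3 first.
    - exact: (measurable_tri Mconf K).
    - by apply: (integrable_tri Mconf) => x; apply: cvgM; [exact: cvg_cst|exact: cw].
    - by apply: (integrable_tri Mconf) => x; exact: cvg_cst.
    apply: le_Rintegral.
    - exact: (measurable_tri Mconf K).
    - exact: (integrable_tri Mconf).
    - apply: (integrable_tri Mconf) => x; apply: cvgD; last exact: cvg_cst.
      by apply: cvgM; [exact: cvg_cst|exact: cw].
    - move=> x Kx; have bK := (triP x (det_neq0 Mconf K)).1 Kx.
      have := diffE K x; set w := aff1 _ _ _ x => dE.
      have dle : (pw K x - w) ^+ 2 <= 3 * S.
        rewrite dE; apply: le_trans (sum3_sqr_le _) _; rewrite ler_wpM2l//; apply: ler_sum => i _.
        rewrite exprMn ler_piMr ?sqr_ge0// expr_le1//.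
        have := bary_sum i x (det_neq0 Mconf K); have := bK i; have := bK (i + 1);
          have := bK (i + 2%:R); lra.
      have := sqrB_le (pw K x - w) (- w); rewrite opprK subrK sqrrN.
      move: dle; clear dE; clearbody w S; move: (pw K x) => v; lra.
  rewrite lerD2l; have := areaD K; move: (area K) => A hA.
  have : S * A <= S * (2 * D ^+ 2) by rewrite ler_wpM2l.
  lra.
apply: (@le_trans _ _ (\sum_K (2 * Rintegral leb (tri K : set T2) (fun x =>
  aff1 (hx K) (hy K) (hk K) x ^+ 2) +
   12 * D ^+ 2 * \sum_i dv K i ^+ 2))); first by apply: ler_sum => K _; exact: one.
rewrite big_split/= -!mulr_sumr.
have D0 : 0 <= D ^+ 2 by exact: sqr_ge0.
have s1 := ler_wpM2l D0 hE; have s2 := ler_wpM2l D0 dv_sum.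
have s3 := le_trans fr s1.
have gen (u v J E k7 k5 : R) : E * u <= E * (k5 * J) -> v <= E * (4 * (k7 * J)) ->
    2 * v + 12 * E * u <= E * (8 * k7 + 12 * k5) * J.
  move=> h1 h2.
  rewrite (_ : E * _ * J = 2 * (E * (4 * (k7 * J))) + 12 * (E * (k5 * J))); last by ring.
  by rewrite lerD ?ler_wpM2l// -mulrA ler_wpM2l.
exact: gen s2 s3.
Qed.

End Estimate.

(** * Fields in H(div) with prescribed edge fluxes *)

Section Gluing.
Variables (R : realType) (M : mesh R) (Omega : set (R * R)).
Hypothesis Oopen : open Omega.
Hypothesis Mconf : conforming_triangulation M Omega.
Local Notation mu := (@lebesgue_measure R).
Local Notation leb := (mu \x mu)%E.
Local Notation T2 := (measurableTypeR R * measurableTypeR R)%type.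
Implicit Types (K L : 'I_(ntri M)) (i j k : 'I_3) (x y z : R * R).

Lemma measurable_edge K i : measurable (edge K i : set T2).
Proof.
apply: closed_measurable2; apply: compact_closed; first exact: norm_hausdorff.
have -> : edge K i = (fun t : R => (1 - t) *: ea K i + t *: eb K i) @` `[0, 1]%classic.
  apply/seteqP; split => [x [t t01 ->]|x [t]]; first by exists t; rewrite //= in_itv.
  by rewrite /= in_itv/= => t01 <-; exists t.
apply: continuous_compact; last exact: segment_compact.
exact/continuous_subspaceT/continuous_segment.
Qed.

(** The affine map taking the second axis to the line of the edge pulls the edge back into a null
    line. *)
Lemma leb_edge K i : leb (edge K i : set T2) = 0%E.
Proof.
pose p := vtx K i - ea K i; pose q := eb K i - ea K i.
have dE : p.1 * q.2 - p.2 * q.1 = - det K.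
  by rewrite -(det_cyc K i) /p /q /cross /ea /eb /=; ring.
have d1 : p.1 * q.2 - p.2 * q.1 != 0 by rewrite dE oppr_eq0 (det_neq0 Mconf).
have := leb2_affine (ea K i).1 (ea K i).2 d1 (measurable_edge K i).
set f := (X in X @^-1` _); set A := _ @^-1` _ => AE.
have A0 : leb A = 0%E.
  have mA : measurable A.
    by rewrite /A -[X in measurable X]setTI; apply: measurable_affine_pair => //;
      exact: measurable_edge.
  have m0 : leb ([set 0] `*` setT : set T2) = 0%E.
    rewrite [LHS](_ : _ = (mu [set 0%R] * mu setT)%E); last exact: product_measure1E.
    by rewrite lebesgue_measure_set1 mul0e.
  apply: (subset_measure0 mA _ _ m0); first exact: measurableX.
  move=> u /(edgeP Mconf)[h _]; split => //=; move: h.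
  rewrite /bary /f/= => /eqP; rewrite mulf_eq0 invr_eq0 (negbTE (det_neq0 Mconf K)) orbF => /eqP h.
  have : u.1 * (p.1 * q.2 - p.2 * q.1) = 0.
    apply: oppr_inj; rewrite oppr0; apply: etrans h; rewrite /p /q /cross/=.
    by move: (vtx K i) (ea K i) (eb K i) => [v1 v2] [a1 a2] [b1 b2] /=; ring.
  by move/eqP; rewrite mulf_eq0 (negbTE d1) orbF => /eqP.
move: AE; rewrite A0 => /esym/eqP; rewrite mule_eq0 eqe invr_eq0 normr_eq0 (negbTE d1)/=.
by move/eqP.
Qed.

Lemma leb_overlap K L : K != L -> leb (tri K `&` tri L : set T2) = 0%E.
Proof.
move=> KL; have edge0 i : tri K `&` tri L `<=` edge K i -> leb (tri K `&` tri L : set T2) = 0%E.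
  move=> h; have mI : measurable (tri K `&` tri L : set T2) by apply: measurableI;
    exact: (measurable_tri Mconf).
  exact: (subset_measure0 mI (measurable_edge K i) h (leb_edge K i)).
case: (Mconf) => _ _ /(_ _ _ KL)[->|[i [j [_ E]]]|[i [j [_ E]]]].
- by rewrite measure0.
- apply: (edge0 (i + 1)) => x; rewrite E => ->; exists 1; rewrite ?ler01 ?lexx//.
  rewrite subrr scale0r add0r scale1r /eb; congr vtx.
  by elim/I3_ind: i {E}; rewrite !I3E.
- by apply: (edge0 i); rewrite E.
Qed.

(* The overlaps are counted twice, but they are null sets. *)
Definition glue (F : 'I_(ntri M) -> R * R -> R) x : R := \sum_K (F K \_ (tri K)) x.

Lemma measurable_glue (F : 'I_(ntri M) -> R * R -> R) : (forall K, continuous (F K)) ->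
  measurable_fun setT (glue F : T2 -> R).
Proof.
move=> cF; apply: measurable_sum => K; apply/measurable_restrict => //.
  exact: (measurable_tri Mconf).
by apply: measurable_funTS; exact: continuous_measurable_fun2.
Qed.

Lemma integrable_restrict_tri (D : set T2) K (f : R * R -> R) : continuous f -> measurable D ->
  leb.-integrable D (EFin \o (f \_ (tri K))).
Proof.
move=> cf mD; have mK := measurable_tri Mconf K.
rewrite -restrict_EFin; apply/integrable_restrict => //.
by apply: integrableS (@integrable_tri _ _ _ Mconf K f cf) => //; exact: measurableI.
Qed.

Lemma Rintegral_glue (F : 'I_(ntri M) -> R * R ->
  R) (D : set T2) : (forall K, continuous (F K)) -> measurable D ->
  Rintegral leb D (glue F) = \sum_K Rintegral leb (D `&` tri K) (F K).
Proof.
move=> cF mD; pose f K x : \bar R := ((F K \_ (tri K)) x)%:E.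
have iF K : leb.-integrable D (f K) by exact: integrable_restrict_tri.
rewrite /Rintegral.
have -> : (\int[leb]_(x in D) (glue F x)%:E = \int[leb]_(x in D) (\sum_K f K x))%E.
  by apply: eq_integral => x _; rewrite /glue -sumEFin.
rewrite integral_sum// -sum_fine//.
  by apply: eq_bigr => K _; rewrite [RHS]Rintegral_mkcondr.
by move=> K _; exact: integrable_fin_num.
Qed.

Lemma Rintegral_glue_tri (F : 'I_(ntri M) -> R * R -> R) K : (forall K, continuous (F K)) ->
  Rintegral leb (tri K : set T2) (glue F) = Rintegral leb (tri K : set T2) (F K).
Proof.
move=> cF; have mK L := measurable_tri Mconf L.
rewrite Rintegral_glue// (bigD1 K)//= setIid big1 ?addr0// => L LK.
rewrite /Rintegral null_set_integral//; first exact: measurableI.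
- apply/measurable_EFinP; by apply: measurable_funTS; exact: continuous_measurable_fun2.
- by apply: leb_overlap; rewrite eq_sym.
Qed.

(** Meant for [D = Omega], which need not contain the closed triangles: test functions vanish on
    what is missing. *)
Lemma Rintegral_glue_supp (F : 'I_(ntri M) -> R * R ->
  R) (D : set T2) : (forall K, continuous (F K)) -> measurable D ->
  (forall K x, ~ D x -> F K x = 0) ->
  Rintegral leb D (glue F) = \sum_K Rintegral leb (tri K : set T2) (F K).
Proof.
move=> cF mD F0; rewrite Rintegral_glue//; apply: eq_bigr => K _.
rewrite setIC Rintegral_mkcondr; apply: eq_Rintegral => x _.
by rewrite patchE; case: ifPn => // /negP; rewrite inE => /F0 ->.
Qed.

Lemma glueM F G x : glue F x * G x = glue (fun K y => F K y * G y) x.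
Proof.
rewrite /glue mulr_suml; apply: eq_bigr => K _; rewrite !patchE.
by case: ifP; rewrite ?mul0r.
Qed.

Lemma glueD F G x : glue F x + glue G x = glue (fun K y => F K y + G K y) x.
Proof.
rewrite /glue -big_split; apply: eq_bigr => K _; rewrite !patchE/=.
by case: ifP; rewrite ?addr0.
Qed.

Lemma integrable_glue (F : 'I_(ntri M) -> R * R -> R) (D : set T2) :
  (forall K, continuous (F K)) -> measurable D -> leb.-integrable D (EFin \o glue F).
Proof.
move=> cF mD; have -> : EFin \o glue F = (fun x => \sum_K ((F K \_ (tri K)) x)%:E)%E.
  by apply/funext => x; rewrite sumEFin.
by apply: integrable_sum => // K _; exact: integrable_restrict_tri.
Qed.

Lemma glue_square_integrable (F : 'I_(ntri M) -> R * R -> R) (D : set T2) :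
  (forall K, continuous (F K)) -> measurable D ->
  square_integrable D (fun x => (glue F x)%:C).
Proof.
move=> cF mD; have mg := measurable_glue cF; split.
- exact: measurable_funTS.
- exact: measurable_cst.
(* Cauchy-Schwarz for the sum in [glue] costs the number of triangles, which is harmless because
   only finiteness is claimed. *)
pose G K x := (ntri M)%:R * (F K x * F K x).
have cG K : continuous (G K) by move=> x; apply: cvgM; [exact: cvg_cst|apply: cvgM; exact: cF].
have /(integrable_lty mD) : leb.-integrable D (EFin \o glue G) by exact: integrable_glue.
apply: le_lt_trans.
have gle x : abs2 (glue F x)%:C <= glue G x.
  rewrite /abs2 /= expr0n addr0.
  apply: le_trans (sum_sqr_le predT _) _; rewrite cardT size_enum_ord mulr_sumr.
  by apply: ler_sum => K _; rewrite !patchE; case: ifP; rewrite ?expr2 ?mulr0.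
have mabs : measurable_fun (D : set T2) (fun x : T2 => abs2 (glue F x)%:C).
  have -> : (fun x : T2 => abs2 (glue F x)%:C) = fun x => glue F x ^+ 2.
    by apply/funext => x; rewrite /abs2/= expr0n addr0.
  by apply: measurable_funX; exact: measurable_funTS.
apply: (@ge0_le_integral _ _ _ leb D mD) => //.
- by move=> x _; rewrite lee_fin addr_ge0 ?sqr_ge0.
- exact/measurable_EFinP.
- apply/measurable_EFinP; apply: measurable_funTS; exact: measurable_glue.
by move=> x _; rewrite /= lee_fin.
Qed.

Lemma cint2_real (D : set (R * R)) (f : R * R -> R) :
  cint2 D (fun x => (f x)%:C) = (Rintegral leb D f)%:C.
Proof.
rewrite /cint2; congr (_ +i* _); by rewrite /Rintegral integral0.
Qed.

Lemma ndot_real (a b : R) (n : R * R) : ndot (a%:C, b%:C) n = (a * n.1 + b * n.2)%:C.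
Proof. by rewrite /ndot/= -!rmorphM -rmorphD. Qed.

Lemma cint_edge_real K i (f : R * R -> R) :
  cint_edge K i (fun x => (f x)%:C) = (elen K i * edge_mean K i f)%:C.
Proof.
rewrite /cint_edge /cint_seg; congr (_ +i* _).
by rewrite /rint_seg /Rintegral integral0 mulr0.
Qed.

Lemma Rintegral_tri_sum K (f : 'I_3 -> R * R -> R) : (forall i, continuous (f i)) ->
  Rintegral leb (tri K : set T2) (fun x => \sum_i f i x) =
  \sum_i Rintegral leb (tri K : set T2) (f i).
Proof.
move=> cf; have mK := measurable_tri Mconf K; have If i := @integrable_tri _ _ _ Mconf K _ (cf i).
rewrite /Rintegral.
have -> : (\int[leb]_(x in tri K) (\sum_i f i x)%:E = \int[leb]_(x in tri K) (\sum_i (f i x)%:E))%E.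
  by apply: eq_integral => x _; rewrite sumEFin.
rewrite (@integral_sum _ _ _ leb (tri K : set T2) mK _ (fun i x => (f i x)%:E))//.
by rewrite -sum_fine// => i _; apply: integrable_fin_num => //; exact: If.
Qed.

Section Flux.
Variable theta : 'I_(ntri M) -> 'I_3 -> R.

(* [x - vtx K i] has constant normal component on edge [i] and none on the other
   two; [theta K i] is the total flux through edge [i]. *)
Definition flux1 K x : R := \sum_i theta K i / `|det K| * (x - vtx K i).1.
Definition flux2 K x : R := \sum_i theta K i / `|det K| * (x - vtx K i).2.
Definition fluxd K x : R := \sum_i theta K i / `|det K| * 2.

Lemma flux_green K phi D1 D2 : C1grad phi D1 D2 ->
  Rintegral leb (tri K : set T2)
    (fun x => flux1 K x * D1 x + flux2 K x * D2 x + fluxd K x * phi x) =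
  \sum_i theta K i * edge_mean K i phi.
Proof.
move=> h; have [c0 c1 c2 _] := h; have mK := measurable_tri Mconf K.
pose G i x := (x - vtx K i).1 * D1 x + (x - vtx K i).2 * D2 x + 2 * phi x.
have cG i : continuous (G i).
  move=> x; apply: cvgD; [apply: cvgD|]; apply: cvgM; try exact: cvg_cst.
  - by apply: (@cvgB _ _ _ _ _ (fun x : R * R => x.1) (fun=> (vtx K i).1));
      [exact: cvg_fst|exact: cvg_cst].
  - exact: c1.
  - by apply: (@cvgB _ _ _ _ _ (fun x : R * R => x.2) (fun=> (vtx K i).2));
      [exact: cvg_snd|exact: cvg_cst].
  - exact: c2.
  - exact: c0.
transitivity (Rintegral leb (tri K : set T2) (fun x => \sum_i theta K i / `|det K| * G i x)).
  apply: eq_Rintegral => x _; rewrite /flux1 /flux2 /fluxd !mulr_suml -!big_split/=.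
  by apply: eq_bigr => i _; rewrite /G; ring.
rewrite Rintegral_tri_sum; last by move=> i x; apply: cvgM; [exact: cvg_cst|exact: cG].
apply: eq_bigr => i _; rewrite RintegralZl//; last by apply: (integrable_tri Mconf); exact: cG.
by rewrite (rt0_green_tri Mconf K i h) mulrA divfK// normr_eq0 (det_neq0 Mconf).
Qed.

Lemma continuous_flux1 K : continuous (flux1 K).
Proof.
have -> : flux1 K = aff1 (\sum_i theta K i / `|det K|) 0 (- \sum_i theta K i /
  `|det K| * (vtx K i).1).
  apply/funext => x; rewrite /flux1 /aff1 mul0r addr0 mulr_suml -sumrB.
  by apply: eq_bigr => i _; rewrite -mulrBr.
exact: continuous_aff1.
Qed.

Lemma continuous_flux2 K : continuous (flux2 K).
Proof.
have -> : flux2 K = aff1 0 (\sum_i theta K i / `|det K|) (- \sum_i theta K i /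
  `|det K| * (vtx K i).2).
  apply/funext => x; rewrite /flux2 /aff1 mul0r add0r mulr_suml -sumrB.
  by apply: eq_bigr => i _; rewrite -mulrBr.
exact: continuous_aff1.
Qed.

Lemma continuous_fluxd K : continuous (fluxd K).
Proof. exact: cst_continuous. Qed.

Hypothesis theta_opp : forall K i L j, neighbour K i = Some L -> edge L j = edge K i ->
  theta L j = - theta K i.

Lemma derive_out (A : set (R * R)) (phi : R * R -> R) x w : closed A ->
  (forall y, ~ A y -> phi y = 0) -> ~ A x -> 'D_w phi x = 0.
Proof.
move=> cA phi0 Ax; rewrite (@near_eq_derive _ _ _ phi (cst 0)) ?derive_cst//.
have : nbhs x (~` A) by apply: open_nbhs_nbhs; split => //; exact: closed_openC.
by apply: filterS => y; exact: phi0.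
Qed.

Lemma flux_pair (D1 D2 : R * R -> R) x :
  glue flux1 x * D1 x + glue flux2 x * D2 x =
  glue (fun K y => flux1 K y * D1 y + flux2 K y * D2 y) x.
Proof. by rewrite !glueM glueD. Qed.

(** Summing [flux_green] over the triangles leaves edge terms: those of shared edges cancel by
    antisymmetry of [theta], and on boundary edges the test function is 0. *)
Lemma flux_Hdiv :
  Hdiv Omega (fun x => ((glue flux1 x)%:C, (glue flux2 x)%:C)) (fun x => (glue fluxd x)%:C).
Proof.
have mO : measurable (Omega : set T2) by exact: open_measurable2.
split.
- exact: (glue_square_integrable continuous_flux1).
- exact: (glue_square_integrable continuous_flux2).
- exact: (glue_square_integrable continuous_fluxd).
move=> phi [sm [A [cA AO phi0]]].
have closedA : closed A by apply: compact_closed => //; exact: norm_hausdorff.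
have h := smooth_C1grad sm; have [c0 c1 c2 _] := h.
have phiO x : ~ Omega x -> phi x = 0 by move=> Ox; apply: phi0 => /AO.
have dphiO x w : ~ Omega x -> 'D_w phi x = 0.
  by move=> Ox; apply: (derive_out (A := A)) => // /AO.
pose P K x := flux1 K x * 'D_(e1 R) phi x + flux2 K x * 'D_(e2 R) phi x.
pose Q K x := fluxd K x * phi x.
have cP K : continuous (P K).
  by move=> x; apply: cvgD; apply: cvgM;
    [exact: continuous_flux1|exact: c1|exact: continuous_flux2|exact: c2].
have cQ K : continuous (Q K) by move=> x; apply: cvgM; [exact: continuous_fluxd|exact: c0].
transitivity (Rintegral leb Omega (glue P))%:C.
  rewrite -cint2_real; congr cint2; apply/funext => x.
  rewrite ndot_real; congr (_%:C).
  exact: (flux_pair ('D_(e1 R) phi) ('D_(e2 R) phi)).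
transitivity (- (Rintegral leb Omega (glue Q))%:C); last first.
  rewrite -cint2_real; congr (- cint2 _ _); apply/funext => x.
  by rewrite -rmorphM -glueM.
rewrite !Rintegral_glue_supp//; last 2 first.
- by move=> K x Ox; rewrite /Q phiO// mulr0.
- by move=> K x Ox; rewrite /P !dphiO// !mulr0 addr0.
rewrite -rmorphN; congr (_%:C); apply/eqP; rewrite -addr_eq0 -big_split/=; apply/eqP.
transitivity (\sum_K \sum_i theta K i * edge_mean K i phi).
  apply: eq_bigr => K _; rewrite -(flux_green K h) -RintegralD//;
    first exact: (measurable_tri Mconf).
  - by apply: (integrable_tri Mconf); exact: cP.
  - by apply: (integrable_tri Mconf); exact: cQ.
apply: (sum_flip0 Mconf) => [K i nb|K i L j nb E].
  by rewrite edge_mean0 ?mulr0// => x Kx; apply: phiO; exact: (boundary_edge Oopen Mconf nb).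
by rewrite (theta_opp nb E) mulNr (edge_mean_sym Mconf c0 E).
Qed.

Hypothesis elen0 : forall K i, elen K i != 0.

(** The edge value is a density, flux over length. Fluxes through boundary edges are unconstrained,
    which is what later makes v vanish at boundary midpoints. *)
Lemma skel_P0_flux : skel_P0 Omega (fun K i => (theta K i / elen K i)%:C).
Proof.
exists (fun x => ((glue flux1 x)%:C, (glue flux2 x)%:C)), (fun x => (glue fluxd x)%:C).
split; first exact: flux_Hdiv.
move=> K phi sm; have h := smooth_C1grad sm; have [c0 c1 c2 _] := h.
have mK := measurable_tri Mconf K.
transitivity (\sum_i theta K i * edge_mean K i phi)%:C.
  rewrite rmorph_sum/=; apply: eq_bigr => i _.
  have -> : (fun x => (theta K i / elen K i)%:C * (phi x)%:C) = (fun x =>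
    (theta K i / elen K i * phi x)%:C).
    by apply/funext => x; rewrite -rmorphM.
  rewrite cint_edge_real /edge_mean RintegralZl//; last first.
    by apply: integrable_itv01 => t; apply: continuous_comp; [exact: continuous_segment|exact: c0].
  by rewrite mulrA [elen _ _ * _]mulrC divfK.
pose P L x := flux1 L x * 'D_(e1 R) phi x + flux2 L x * 'D_(e2 R) phi x.
pose Q L x := fluxd L x * phi x.
have cP L : continuous (P L).
  by move=> x; apply: cvgD; apply: cvgM;
    [exact: continuous_flux1|exact: c1|exact: continuous_flux2|exact: c2].
have cQ L : continuous (Q L) by move=> x; apply: cvgM; [exact: continuous_fluxd|exact: c0].
transitivity ((Rintegral leb (tri K : set T2) (glue P))%:C +
  (Rintegral leb (tri K : set T2) (glue Q))%:C); last first.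
  rewrite -!cint2_real; congr (cint2 _ _ + cint2 _ _); apply/funext => x;
    last by rewrite -rmorphM -glueM.
  by rewrite ndot_real (flux_pair ('D_(e1 R) phi) ('D_(e2 R) phi)).
rewrite -rmorphD -(flux_green K h) !Rintegral_glue_tri// -RintegralD//.
- by apply: (integrable_tri Mconf); exact: cP.
- by apply: (integrable_tri Mconf); exact: cQ.
Qed.
End Flux.
End Gluing.

(** * Consequences of the second equation *)

Section AffineComplex.
Variable R : realType.
Implicit Types (c z : R[i]) (x : R * R).

Definition caff c1 c2 c0 x : R[i] := c1 * (x.1)%:C + c2 * (x.2)%:C + c0.

Lemma Re_caff c1 c2 c0 x :
  complex.Re (caff c1 c2 c0 x) = aff1 (complex.Re c1) (complex.Re c2) (complex.Re c0) x.
Proof. by case: c1 c2 c0 => [a a'] [b b'] [d d']; rewrite /aff1 /=; ring. Qed.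

Lemma Im_caff c1 c2 c0 x :
  complex.Im (caff c1 c2 c0 x) = aff1 (complex.Im c1) (complex.Im c2) (complex.Im c0) x.
Proof. by case: c1 c2 c0 => [a a'] [b b'] [d d']; rewrite /aff1 /=; ring. Qed.

Lemma polyP0_cst c : Defs.polyP 0 (fun _ : R * R => c).
Proof.
exists (fun _ _ => c) => x.
by rewrite big_ord1 big_mkcond big_ord1/= !expr0 !mulr1.
Qed.

Lemma polyP1_caff c1 c2 c0 : Defs.polyP 1 (caff c1 c2 c0).
Proof.
exists (fun k l => if k == 1%N then c1 else if l == 1%N then c2 else c0) => x.
rewrite !big_ord_recr big_ord0 /= !(big_mkcond (fun _ => _ <= _)%N) /= !big_ord_recr !big_ord0 /=.
by rewrite !expr0 !expr1 !mulr1 !add0r addr0 /caff; ring.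
Qed.

Lemma polyP1E (f : R * R -> R[i]) : Defs.polyP 1 f -> exists c1 c2 c0, f = caff c1 c2 c0.
Proof.
move=> [c fE]; exists (c 1%N 0%N), (c 0%N 1%N), (c 0%N 0%N); apply/funext => x; rewrite fE.
rewrite !big_ord_recr big_ord0 /= !(big_mkcond (fun _ => _ <= _)%N) /= !big_ord_recr !big_ord0 /=.
by rewrite !expr0 !expr1 !mulr1 !add0r addr0 /caff; ring.
Qed.

Lemma derive_aff1 (a b k : R) x w : 'D_w (aff1 a b k) x = w.1 * a + w.2 * b.
Proof. by have [_ _ _ h] := C1grad_affine a b k; have dw := h x w; rewrite derive_val. Qed.

Lemma cpartial_caff w c1 c2 c0 x :
  cpartial w (caff c1 c2 c0) x = (w.1)%:C * c1 + (w.2)%:C * c2.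
Proof.
rewrite /cpartial (_ : (fun y => complex.Re _) =
  aff1 (complex.Re c1) (complex.Re c2) (complex.Re c0)); last exact/funext/Re_caff.
rewrite (_ : (fun y => complex.Im _) = aff1 (complex.Im c1) (complex.Im c2) (complex.Im c0));
  last exact/funext/Im_caff.
rewrite !derive_aff1; apply/eqP; rewrite eq_complex; apply/andP.
by case: c1 c2 => [a a'] [b b'] /=; split; apply/eqP; ring.
Qed.

Lemma cgrad_caff c1 c2 c0 x : cgrad (caff c1 c2 c0) x = (c1, c2).
Proof. by rewrite /cgrad !cpartial_caff /= !mul1r !mul0r addr0 add0r. Qed.

Lemma cdiv_rt0 a1 a2 b x :
  cdiv (fun y : R * R => (a1 + b * y.1%:C, a2 + b * y.2%:C)) x = b + b.
Proof.
rewrite /cdiv (_ : (fun y => _.1) = caff b 0 a1); last by apply/funext => y; rewrite /caff/=; ring.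
rewrite (_ : (fun y => _.2) = caff 0 b a2); last by apply/funext => y; rewrite /caff/=; ring.
by rewrite !cpartial_caff /= !mul1r !mul0r !addr0 add0r.
Qed.

End AffineComplex.

(** * The discrete pairings, and what orthogonality to the trial space yields *)

Section Pairings.
Variables (R : realType) (M : mesh R) (Omega : set (R * R)).
Hypotheses (Oopen : open Omega) (Oreg : Omega = (closure Omega)°).
Hypothesis Mconf : conforming_triangulation M Omega.
Local Notation mu := (@lebesgue_measure R).
Local Notation leb := (mu \x mu)%E.
Local Notation T2 := (measurableTypeR R * measurableTypeR R)%type.
Implicit Types (K L : 'I_(ntri M)) (i j k : 'I_3) (x y z : R * R).

Lemma cint2_cst K (c : R[i]) : cint2 (tri K) (fun=> c) = c * (area K)%:C.
Proof.
rewrite /cint2 !(Rintegral_tri_cst Mconf K); case: c => a b /=.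
by apply/eqP; rewrite eq_complex/=; apply/andP; split; apply/eqP; ring.
Qed.

Lemma elen_pos K i : 0 < elen K i.
Proof.
rewrite lt_neqAle sqrtr_ge0 andbT eq_sym; apply/eqP => h.
have := elen_sqr K i; rewrite h expr0n /edot /= => /esym/eqP.
rewrite -!expr2 paddr_eq0 ?sqr_ge0// !sqrf_eq0 => /andP[/eqP h1 /eqP h2].
move: (ea_neq_eb Mconf K i) => /negP; apply; rewrite eq_sym -subr_eq0; apply/eqP.
exact: pair_eqP.
Qed.

Lemma integrable_edge K i (f : R * R -> R) : continuous f ->
  mu.-integrable `[0, 1]%classic (EFin \o (fun t : R => f ((1 - t) *: ea K i + t *: eb K i))).
Proof.
move=> cf; apply: integrable_itv01 => t.
by apply: continuous_comp; [exact: continuous_segment|exact: cf].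
Qed.

Lemma edge_meanZ K i (f : R * R -> R) (a : R) : continuous f ->
  edge_mean K i (fun x => f x * a) = edge_mean K i f * a.
Proof.
by move=> cf; rewrite /edge_mean RintegralZr//; exact: (integrable_edge K i cf).
Qed.

Lemma rint_edge_mean K i f : rint_edge K i f = elen K i * edge_mean K i f.
Proof. by []. Qed.

Lemma eq_cint_edge K i (f g : R * R -> R[i]) : (forall x, edge K i x -> f x = g x) ->
  cint_edge K i f = cint_edge K i g.
Proof.
move=> fg; rewrite /cint_edge /cint_seg -![rint_seg _ _ _]/(rint_edge K i _) !rint_edge_mean.
by congr ((_ * _) +i* (_ * _)); apply: eq_edge_mean => x /fg ->.
Qed.

Lemma cint_edgeZ K i (f : R * R -> R) (c : R[i]) : continuous f ->
  cint_edge K i (fun x => (f x)%:C * c) = (elen K i * edge_mean K i f)%:C * c.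
Proof.
move=> cf; rewrite /cint_edge /cint_seg -![rint_seg _ _ _]/(rint_edge K i _) !rint_edge_mean.
case: c => a b; rewrite (_ : edge_mean K i (fun x => complex.Re _) = edge_mean K i f * a).
  rewrite (_ : edge_mean K i (fun x => complex.Im _) = edge_mean K i f * b).
    by apply/eqP; rewrite eq_complex/=; apply/andP; split; apply/eqP; ring.
  by rewrite -edge_meanZ//; apply: eq_edge_mean => x _ /=; ring.
by rewrite -edge_meanZ//; apply: eq_edge_mean => x _ /=; ring.
Qed.

(** The midpoint rule is exact on affine functions; this is why edgewise constants detect midpoint
    values. *)
Lemma edge_mean_aff1 K i (a b k : R) : edge_mean K i (aff1 a b k) = aff1 a b k (mid K i).
Proof.
rewrite /edge_mean.
transitivity (Rintegral mu `[0, 1]%classic (fun t => aff1 a b k (ea K i) +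
   (aff1 a b k (eb K i) - aff1 a b k (ea K i)) * t)).
  by apply: eq_Rintegral => t _; rewrite /aff1 /= /GRing.scale/=; ring.
rewrite Rint01_affine /mid /aff1 /= /GRing.scale /=; field; by [].
Qed.

Lemma cint_edge_affine K i (g : R) c1 c2 c0 :
  cint_edge K i (fun x => conjc (caff c1 c2 c0 x) * g%:C) =
  (elen K i * g)%:C * conjc (caff c1 c2 c0 (mid K i)).
Proof.
rewrite /cint_edge /cint_seg -![rint_seg _ _ _]/(rint_edge K i _) !rint_edge_mean.
set f1 := aff1 (complex.Re c1) (complex.Re c2) (complex.Re c0).
set f2 := aff1 (complex.Im c1) (complex.Im c2) (complex.Im c0).
rewrite (_ : edge_mean K i (fun x => complex.Re _) = edge_mean K i f1 * g); last first.
  rewrite -edge_meanZ; last exact: continuous_aff1.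
  by apply: eq_edge_mean => x _; rewrite /f1 -Re_caff; case: (caff _ _ _ x) => a b /=; ring.
rewrite (_ : edge_mean K i (fun x => complex.Im _) = edge_mean K i f2 * (- g)); last first.
  rewrite -edge_meanZ; last exact: continuous_aff1.
  by apply: eq_edge_mean => x _; rewrite /f2 -Im_caff; case: (caff _ _ _ x) => a b /=; ring.
rewrite !edge_mean_aff1 /f1 /f2 -Re_caff -Im_caff; case: (caff _ _ _ _) => a b /=.
by apply/eqP; rewrite eq_complex/=; apply/andP; split; apply/eqP; ring.
Qed.

(** The coordinate grows from edge [i] towards vertex [i], so its gradient points inwards, and its
    length is edge length over [|det K|]. The sign in [outer_normal] absorbs that of [det K]. *)
Lemma normal_bary K i : elen K i *: outer_normal K i =
  (- (`|det K| * bgx K i), - (`|det K| * bgy K i)).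
Proof.
have e0 := elen_pos K i; have d0 := det_neq0 Mconf K.
rewrite /outer_normal -[enorm _]/(elen K i); set nu := (elen K i)^-1 *: (_, _).
have -> : edot nu (vtx K i - ea K i) = - ((elen K i)^-1 * det K).
  by rewrite -(det_cyc K i) /edot /cross /nu /ea /eb /= /GRing.scale /=; ring.
rewrite sgrN sgrM gtr0_sg ?invr_gt0// mul1r opprK.
have -> : `|det K| = Num.sg (det K) * det K by rewrite normrEsg.
by apply: pair_eqP; rewrite /nu /bgx /bgy /= /GRing.scale/=; field; rewrite d0 gt_eqF.
Qed.

Lemma bg_sum0 K : (\sum_i bgx K i = 0) * (\sum_i bgy K i = 0).
Proof.
by rewrite !(sum_I3 _ 0) !I3E /bgx /bgy /ea /eb !I3E; split; ring.
Qed.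

(** Gauss's theorem for the constant field [(s, t)], by pure algebra: edge means are averages of two
    vertex values, normals are coordinate gradients, and these gradients sum to 0. *)
Lemma normal_interp nu K (s t : R) :
  \sum_i elen K i * edge_mean K i (interp nu K) *
     (s * (outer_normal K i).1 + t * (outer_normal K i).2) =
  area K * (s * interp_gx nu K + t * interp_gy nu K).
Proof.
have E i : elen K i * edge_mean K i (interp nu K) *
     (s * (outer_normal K i).1 + t * (outer_normal K i).2) =
   - (`|det K| * 2^-1) * ((nu (ea K i) + nu (eb K i)) * (s * bgx K i + t * bgy K i)).
  have nE := normal_bary K i.
  have n1 : elen K i * (outer_normal K i).1 =
    - (`|det K| * bgx K i) by rewrite -[LHS]/((elen K i *: outer_normal K i).1) nE.
  have n2 : elen K i * (outer_normal K i).2 =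
    - (`|det K| * bgy K i) by rewrite -[LHS]/((elen K i *: outer_normal K i).2) nE.
  have bm j : bary K j (mid K i) = 2^-1 * (j == i + 1)%:R + 2^-1 * (j == i + 2%:R)%:R.
    by rewrite /mid bary_aff ?(bary_ea Mconf) ?(bary_eb Mconf)//; field; by [].
  rewrite edge_mean_aff1 -[aff1 _ _ _ _]/(interp nu K (mid K i)).
  rewrite (@interp_edge _ _ nu K i); last by rewrite bm !I3_neq !mulr0 addr0.
  rewrite !bm !I3_neq !eqxx !mulr1 !mulr0 addr0 add0r.
  transitivity (2^-1 * (nu (ea K i) + nu (eb K i)) * (s * (elen K i * (outer_normal K i).1) +
    t * (elen K i * (outer_normal K i).2))).
    by ring.
  by rewrite n1 n2; ring.
rewrite (eq_bigr _ (fun i _ => E i)) -mulr_sumr (area_det Mconf).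
rewrite /interp_gx /interp_gy !(sum_I3 _ 0) !I3E /ea /eb !I3E.
have [h1 h2] := bg_sum0 K; rewrite !(sum_I3 _ 0) !I3E in h1 h2.
have -> : bgx K 2%:R = - bgx K 0 - bgx K 1 by move: (bgx K _) (bgx K _) (bgx K _) h1 => a b c; lra.
have -> : bgy K 2%:R = - bgy K 0 - bgy K 1 by move: (bgy K _) (bgy K _) (bgy K _) h2 => a b c; lra.
by field.
Qed.

Lemma elen_neq0 K i : elen K i != 0.
Proof. by rewrite gt_eqF ?elen_pos. Qed.

Lemma skel_P0_0 : skel_P0 Omega (fun (_ : 'I_(ntri M)) (_ : 'I_3) => 0).
Proof.
have := @skel_P0_flux R M Omega Oopen Mconf (fun _ _ => 0) _ elen_neq0.
by under eq_fun do under eq_fun do rewrite mul0r; apply=> *; rewrite oppr0.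
Qed.

Lemma skel_S10_interp nu : (forall z, ~ Omega z -> nu z = 0) ->
  @skel_S10 R M Omega (fun x => (interp_fun M nu x)%:C).
Proof.
move=> nu0; exists (fun x => (interp_fun M nu x)%:C) => //; split.
- exact: (interp_fun_continuous Mconf (nu := nu)).
- exact/continuous_subspaceT/cst_continuous.
- move=> K; exists (caff (interp_gx nu K)%:C (interp_gy nu K)%:C (interp_cst nu K)%:C).
    exact: polyP1_caff.
  move=> x /[!inE] Kx; rewrite (interp_funE Mconf nu Kx).
  by rewrite /caff -!rmorphM -!rmorphD.
- move=> x /[!inE] -[cx Ox].
  have [K Kx] := closure_tri Mconf cx.
  by rewrite (interp_funE Mconf nu Kx) (interp_out Oopen Oreg Mconf nu0 Kx Ox).
Qed.

Lemma skel_S10_0 : @skel_S10 R M Omega (fun=> 0).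
Proof.
exists (fun=> 0) => //; split => //.
- exact/continuous_subspaceT/cst_continuous.
- exact/continuous_subspaceT/cst_continuous.
- move=> K; exists (caff 0 0 0); first exact: polyP1_caff.
  by move=> x _; rewrite /caff !mul0r !addr0.
Qed.

Lemma ipL2_0l (f : broken M R[i]) : ipL2 (fun _ _ => 0) f = 0.
Proof.
rewrite /ipL2 big1// => K _; under eq_fun do rewrite mul0r.
by rewrite cint2_cst mul0r.
Qed.

Lemma ipL2v_0l (f : broken M (R[i] * R[i])) : ipL2v (fun _ _ => 0) f = 0.
Proof.
rewrite /ipL2v big1// => K _; under eq_fun do rewrite /hdot /= !mul0r addr0.
by rewrite cint2_cst mul0r.
Qed.

Lemma cint_edge0 K i : cint_edge K i (fun=> 0) = 0.
Proof.
rewrite -[RHS](mulr0 (elen K i *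
  edge_mean K i (cst 0))%:C) -(cint_edgeZ K i 0 (@cst_continuous _ _ 0)).
by apply: eq_cint_edge => x _; rewrite mulr0.
Qed.

Lemma pair_uhat_0l (tau : broken M (R[i] * R[i])) : pair_uhat (fun=> 0) tau = 0.
Proof.
rewrite /pair_uhat big1// => K _; rewrite big1// => i _; under eq_fun do rewrite mul0r.
exact: cint_edge0.
Qed.

Lemma pair_shat_0r (v : broken M R[i]) : pair_shat v (fun _ _ => 0) = 0.
Proof.
rewrite /pair_shat big1// => K _; rewrite big1// => i _; under eq_fun do rewrite mulr0.
exact: cint_edge0.
Qed.

Lemma ipL2_cst (f g : 'I_(ntri M) -> R[i]) :
  ipL2 (fun K (_ : R * R) => f K) (fun K _ => g K) = \sum_K f K * conjc (g K) * (area K)%:C.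
Proof. by apply: eq_bigr => K _; exact: cint2_cst. Qed.

Lemma ipL2v_cst (f g : 'I_(ntri M) -> R[i] * R[i]) :
  ipL2v (fun K (_ : R * R) => f K) (fun K _ => g K) = \sum_K hdot (f K) (g K) * (area K)%:C.
Proof. by apply: eq_bigr => K _; exact: cint2_cst. Qed.

Lemma area_pos K : 0 < area K.
Proof. by rewrite (area_det Mconf) divr_gt0// normr_gt0 (det_neq0 Mconf). Qed.

Lemma mul_conjc (z : R[i]) : z * conjc z = (abs2 z)%:C.
Proof.
case: z => a b; apply/eqP; rewrite /abs2 eq_complex/=; apply/andP; split; apply/eqP; ring.
Qed.

Lemma abs2_ge0 (z : R[i]) : 0 <= abs2 z.
Proof. by rewrite addr_ge0 ?sqr_ge0. Qed.

Lemma abs2_eq0 (z : R[i]) : abs2 z = 0 -> z = 0.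
Proof.
case: z => a b /eqP; rewrite /abs2 /= paddr_eq0 ?sqr_ge0// !sqrf_eq0 => /andP[/eqP -> /eqP ->].
by [].
Qed.

Lemma hdot_self (p : R[i] * R[i]) : hdot p p = (abs2 p.1 + abs2 p.2)%:C.
Proof. by rewrite /hdot !mul_conjc -rmorphD. Qed.

Lemma sum_area_eq0 (a : 'I_(ntri M) -> R) : (forall K, 0 <= a K) ->
  \sum_K (a K)%:C * (area K)%:C = 0 -> forall K, a K = 0.
Proof.
move=> a0 /eqP; under eq_bigr do rewrite -rmorphM.
rewrite -rmorph_sum eq_complex/= => /andP[/eqP h _] K.
have aa L : 0 <= a L * area L by rewrite mulr_ge0// ltW// area_pos.
have /eqP := psumr_eq0P (fun L _ => aa L) h (i := K) isT.
by rewrite mulf_eq0 (gt_eqF (area_pos K)) orbF => /eqP.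
Qed.

Section Orthogonality.
Variable X : test M.
Hypothesis VX : in_Vh X.
Hypothesis orth : forall W, in_Uh Omega W -> bform W X = 0.

(** The piecewise constant trial components are free, so the quantities to be annihilated can
    themselves be inserted, which leaves a weighted sum of squares. *)
Lemma test_const : exists v1 v2 v0 : 'I_(ntri M) -> R[i],
  X = Test (fun K => caff (v1 K) (v2 K) (v0 K)) (fun K _ => (v1 K, v2 K)).
Proof.
have [w1 w1E] := choice (fun K => polyP1E (VX.1 K)).
have [w2 w2E] := choice w1E; have [v0 vE] := choice w2E.
have [al /choice[be tE]] := choice (VX.2).
have tv_E : tv X = fun K => caff (w1 K) (w2 K) (v0 K) by apply/funext => K; exact: vE.
have tt_E : ttau X = fun K x => ((al K).1 + be K * x.1%:C, (al K).2 + be K * x.2%:C).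
  by apply/funext => K; apply/funext => x; exact: tE.
have div_E : bdiv (ttau X) = fun K _ => be K + be K.
  by apply/funext => K; apply/funext => x; rewrite /bdiv tt_E cdiv_rt0.
have grad_E : bgrad (tv X) = fun K _ => (w1 K, w2 K).
  by apply/funext => K; apply/funext => x; rewrite /bgrad tv_E cgrad_caff.
have be0 K : be K = 0.
  (* The divergence of [a + b x] is [2 b]; it is tested with itself. *)
  have := orth (W := Trial (fun K _ => be K + be K) (fun _ _ => 0) (fun=> 0) (fun _ _ => 0)).
  rewrite /in_Uh /bform /= !ipL2v_0l pair_uhat_0l pair_shat_0r div_E ipL2_cst.
  rewrite add0r !addr0 subr0 => h.
  have {h} : \sum_L (be L + be L) * conjc (be L + be L) * (area L)%:C = 0.
    apply/eqP; rewrite -oppr_eq0 h//; split => //=; last exact: skel_P0_0.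
    - by move=> L; exact: polyP0_cst.
    - by split => L; exact: polyP0_cst.
    - exact: skel_S10_0.
  under eq_bigr do rewrite mul_conjc.
  move/(sum_area_eq0 (fun L => abs2_ge0 _))/(_ K)/abs2_eq0/eqP.
  by rewrite -mulr2n mulrn_eq0/= => /eqP.
have tt_E' : ttau X = fun K _ => al K.
  apply/funext => K; apply/funext => x; rewrite tt_E be0 !mul0r !addr0; by case: (al K).
have alE K : al K = (w1 K, w2 K).
  (* The difference of tau and grad v, a constant on each triangle now that the divergence is known
     to vanish. *)
  pose r K := ((al K).1 - w1 K, (al K).2 - w2 K).
  have := orth (W := Trial (fun _ _ => 0) (fun K _ => r K) (fun=> 0) (fun _ _ => 0)).
  rewrite /in_Uh /bform /= !ipL2_0l pair_uhat_0l pair_shat_0r tt_E' grad_E !ipL2v_cst.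
  rewrite !addr0 subr0 -sumrB => h.
  have {h} : \sum_L hdot (r L) (r L) * (area L)%:C = 0.
    rewrite -[RHS]h; last first.
      split => //=; [| |exact: skel_S10_0|exact: skel_P0_0].
        by move=> L; exact: polyP0_cst.
      by split => L; exact: polyP0_cst.
    apply: eq_bigr => L _; rewrite -mulrBl; congr (_ * _).
    by rewrite /hdot /r /= !rmorphB; ring.
  under eq_bigr do rewrite hdot_self.
  move/(sum_area_eq0 (fun L => addr_ge0 (abs2_ge0 _) (abs2_ge0 _)))/(_ K)/eqP.
  rewrite paddr_eq0 ?abs2_ge0// => /andP[/eqP/abs2_eq0/eqP h1 /eqP/abs2_eq0/eqP h2].
  by move: h1 h2; rewrite /r/= !subr_eq0 => /eqP <- /eqP <-; case: (al K).
exists w1, w2, v0; case: (X) tv_E tt_E' => v t /= -> ->; congr Test.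
by apply/funext => K; apply/funext => x; rewrite alE.
Qed.

End Orthogonality.

Lemma conjcM (z w : R[i]) : conjc (z * w) = conjc z * conjc w.
Proof. exact: rmorphM. Qed.

Lemma conjcD (z w : R[i]) : conjc (z + w) = conjc z + conjc w.
Proof. exact: rmorphD. Qed.

Section ConstantTest.
Variables v1 v2 v0 : 'I_(ntri M) -> R[i].
Let X := Test (fun K => caff (v1 K) (v2 K) (v0 K)) (fun K (_ : R * R) => (v1 K, v2 K)).
Hypothesis orth : forall W, in_Uh Omega W -> bform W X = 0.

(** The trace of an interpolant that vanishes outside [Omega] is an admissible test; [normal_interp]
    turns its boundary integrals into the gradient product on each triangle. *)
Lemma orth_uhat nu : (forall z, ~ Omega z -> nu z = 0) ->
  \sum_K (area K)%:C * (v1 K * (interp_gx nu K)%:C + v2 K * (interp_gy nu K)%:C) = 0.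
Proof.
move=> nu0.
have := orth (W := Trial (fun _ _ => 0) (fun _ _ => 0) (fun x =>
  (interp_fun M nu x)%:C) (fun _ _ => 0)).
rewrite /in_Uh /bform /= !ipL2_0l !ipL2v_0l pair_shat_0r !subr0 add0r addr0 => h.
(* [bform] is conjugate-linear in the test argument; after conjugation the bars fall on real numbers
   only. *)
apply: (can_inj (@conjcK R)); rewrite conjc0 rmorph_sum/= -[RHS]h; last first.
  split => //=; [| |exact: skel_S10_interp|exact: skel_P0_0].
    by move=> L; exact: polyP0_cst.
  by split => L; exact: polyP0_cst.
apply: eq_bigr => K _.
have E i : cint_edge K i (fun x =>
  (interp_fun M nu x)%:C * conjc (ndot (v1 K, v2 K) (outer_normal K i))) =
   conjc (v1 K) * (elen K i * edge_mean K i (interp nu K) * (1 * (outer_normal K i).1 +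
     0 * (outer_normal K i).2))%:C +
   conjc (v2 K) * (elen K i * edge_mean K i (interp nu K) * (0 * (outer_normal K i).1 +
     1 * (outer_normal K i).2))%:C.
  transitivity (cint_edge K i (fun x =>
    (interp nu K x)%:C * conjc (ndot (v1 K, v2 K) (outer_normal K i)))).
    by apply: eq_cint_edge => x /(edge_tri Mconf) Kx; rewrite (interp_funE Mconf nu Kx).
  rewrite cint_edgeZ; last exact: continuous_aff1.
  by rewrite /ndot conjcD !conjcM !conjc_real !mul1r !mul0r add0r addr0 !rmorphM; ring.
rewrite (eq_bigr _ (fun i _ => E i)) big_split/= -!mulr_sumr -!rmorph_sum/= !normal_interp.
by rewrite !mul1r !mul0r add0r addr0 conjcM conjcD !conjcM !conjc_real !rmorphM; ring.
Qed.

(** The length in the line integral cancels the denominator of the density [theta / elen], leaving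
    the flux times the midpoint value. *)
Lemma orth_shat (theta : 'I_(ntri M) -> 'I_3 -> R) :
  (forall K i L j, neighbour K i = Some L -> edge L j = edge K i -> theta L j = - theta K i) ->
  \sum_K \sum_i (theta K i)%:C * caff (v1 K) (v2 K) (v0 K) (mid K i) = 0.
Proof.
move=> opp.
have := orth (W := Trial (fun _ _ => 0) (fun _ _ => 0) (fun=> 0) (fun K i =>
  (theta K i / elen K i)%:C)).
rewrite /in_Uh /bform /= !ipL2_0l !ipL2v_0l pair_uhat_0l !subr0 !add0r => h.
apply: (can_inj (@conjcK R)); rewrite conjc0 rmorph_sum/= -[RHS]h; last first.
  split => //=; [| |exact: skel_S10_0|exact: (skel_P0_flux Oopen Mconf opp elen_neq0)].
    by move=> L; exact: polyP0_cst.
  by split => L; exact: polyP0_cst.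
apply: eq_bigr => K _; rewrite rmorph_sum/=; apply: eq_bigr => i _.
by rewrite cint_edge_affine conjcM conjc_real [elen _ _ * _]mulrC divfK ?elen_neq0.
Qed.

End ConstantTest.
End Pairings.

(** * Equivalence of the estimators *)

Section Estimators.
Variables (R : realType) (M : mesh R) (Omega : set (R * R)).
Hypotheses (Oopen : open Omega) (Oreg : Omega = (closure Omega)°).
Hypothesis Mconf : conforming_triangulation M Omega.
Local Notation mu := (@lebesgue_measure R).
Local Notation leb := (mu \x mu)%E.
Local Notation T2 := (measurableTypeR R * measurableTypeR R)%type.
Implicit Types (K L : 'I_(ntri M)) (i j k : 'I_3) (x y z : R * R).

Lemma mid_shared K i L j : edge L j = edge K i -> mid L j = mid K i.
Proof. by move=> E; rewrite /mid; case: (edge_eqP Mconf E) => -[-> ->] //; rewrite addrC. Qed.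

(* The antisymmetric multiplier is the jump at the midpoint itself. *)
Lemma continuity_of_orthogonality (ga gb gk : 'I_(ntri M) -> R) :
  (forall theta : 'I_(ntri M) -> 'I_3 -> R,
    (forall K i L j, neighbour K i = Some L -> edge L j = edge K i ->
      theta L j = - theta K i) ->
    \sum_K \sum_i theta K i * pw ga gb gk K (mid K i) = 0) ->
  forall K i, if neighbour K i is Some L
    then pw ga gb gk K (mid K i) = pw ga gb gk L (mid K i)
    else pw ga gb gk K (mid K i) = 0.
Proof.
move=> orth; pose p := pw ga gb gk.
pose theta K i := p K (mid K i) - (if neighbour K i is Some L then p L (mid K i) else 0).
have opp K i L j : neighbour K i = Some L -> edge L j = edge K i -> theta L j = - theta K i.
  move=> nb E; have [LK _] := (neighbourP Mconf _ _ _).1 nb.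
  by rewrite /theta nb (neighbour_sym Mconf LK E) (mid_shared E) opprB.
(* On a shared edge this is half the difference of the squared midpoint values, hence antisymmetric.
   Removing it from the vanishing sum leaves only nonnegative multiples of [theta K i ^+ 2]. *)
pose T K i := if neighbour K i is Some _ then theta K i * p K (mid K i) - theta K i ^+ 2 / 2 else 0.
have T0 : \sum_K \sum_i T K i = 0.
  apply: (sum_flip0 Mconf) => [K i|K i L j nb E]; first by rewrite /T => ->.
  have [LK _] := (neighbourP Mconf _ _ _).1 nb.
  rewrite /T nb (neighbour_sym Mconf LK E) (opp K i L j nb E) (mid_shared E) /theta nb.
  by move: (p K _) (p L _) => a b; field.
pose S K i := theta K i * p K (mid K i) - T K i.
have SE K i : S K i = if neighbour K i is Some _ then theta K i ^+ 2 / 2 else theta K i ^+ 2.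
  rewrite /S /T; case E : (neighbour K i) => [L|]; first by rewrite subKr.
  by rewrite subr0 /theta E subr0 expr2.
have S0 K i : 0 <= S K i.
  by rewrite SE; case: neighbour => [L|]; rewrite ?divr_ge0 ?sqr_ge0.
have sS : \sum_K \sum_i S K i = 0.
  transitivity (\sum_K \sum_i theta K i * p K (mid K i) - \sum_K \sum_i T K i).
    by rewrite -sumrB; apply: eq_bigr => K _; rewrite -sumrB.
  by rewrite T0 subr0; exact: orth.
move=> K i.
have th0 : theta K i = 0.
  have h1 := psumr_eq0P (fun L _ => sumr_ge0 _ (fun j _ => S0 L j)) sS (i := K) isT.
  have := psumr_eq0P (fun j _ => S0 K j) h1 (i := i) isT.
  rewrite SE; case: neighbour => [L|] /eqP.
    by rewrite mulf_eq0 invr_eq0 pnatr_eq0 orbF sqrf_eq0 => /eqP.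
  by rewrite sqrf_eq0 => /eqP.
move: th0; rewrite /theta; case: neighbour => [L|]; last by rewrite subr0.
by move/eqP; rewrite subr_eq0 => /eqP.
Qed.

Lemma jump_estimator_cst (v1 v2 : 'I_(ntri M) -> R[i]) :
  jump_estimator2 (fun K (_ : R * R) => (v1 K, v2 K)) =
  jest (fun K => complex.Re (v1 K)) (fun K => complex.Re (v2 K)) +
  jest (fun K => complex.Im (v1 K)) (fun K => complex.Im (v2 K)).
Proof.
rewrite /jest -big_split/=; apply: eq_bigr => K _; rewrite -mulrDr; congr (_ * _).
rewrite -big_split/=; apply: eq_bigr => i _; rewrite -mulrDr rint_edge_mean.
congr (_ * _).
have cst (r : R) : edge_mean K i (fun=> r) = r.
  rewrite /edge_mean Rintegral_cst//= lebesgue_measure_itv/= lte_fin ltr01 oppr0 adde0.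
  by rewrite mulr1.
rewrite -[RHS]cst; apply: eq_edge_mean => x _; rewrite /jump /jsq /abs2.
by case: neighbour => [L|] /=; [case: (v1 K) (v2 K) (v1 L) (v2 L) => a b [c d] [e f] [g h]/=|];
  ring.
Qed.

(** As tau = grad v and div tau = 0, the gradient energy occurs twice and the divergence term not at
    all. *)
Lemma normV_cst (v1 v2 v0 : 'I_(ntri M) -> R[i]) :
  complex.Re (ipV (Test (fun K => caff (v1 K) (v2 K) (v0 K)) (fun K (_ : R * R) => (v1 K, v2 K)))
    (Test (fun K => caff (v1 K) (v2 K) (v0 K)) (fun K (_ : R * R) => (v1 K, v2 K)))) =
  mass (fun K => complex.Re (v1 K)) (fun K => complex.Re (v2 K)) (fun K => complex.Re (v0 K)) +
  mass (fun K => complex.Im (v1 K)) (fun K => complex.Im (v2 K)) (fun K => complex.Im (v0 K)) +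
  2 * (energy (fun K => complex.Re (v1 K)) (fun K => complex.Re (v2 K)) +
  energy (fun K => complex.Im (v1 K)) (fun K => complex.Im (v2 K))).
Proof.
set X := Test _ _.
have grad_E : bgrad (tv X) = ttau X.
  by apply/funext => K; apply/funext => x; rewrite /bgrad cgrad_caff.
have div_E : bdiv (ttau X) = fun _ _ => 0.
  apply/funext => K; apply/funext => x; rewrite -[RHS](addr0 0) -(cdiv_rt0 (v1 K) (v2 K) 0 x).
  by congr (cdiv _ x); apply/funext => y; rewrite !mul0r !addr0.
rewrite /ipV grad_E div_E (ipL2_0l Mconf) addr0 (ipL2v_cst Mconf).
under [\sum_K hdot _ _ * _]eq_bigr do rewrite hdot_self -rmorphM.
rewrite -rmorph_sum/=.
have -> : ipL2 (tv X) (tv X) = (mass (fun K => complex.Re (v1 K)) (fun K =>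
  complex.Re (v2 K)) (fun K => complex.Re (v0 K)) +
  mass (fun K => complex.Im (v1 K)) (fun K => complex.Im (v2 K)) (fun K => complex.Im (v0 K)))%:C.
  rewrite /mass -big_split rmorph_sum/=; apply: eq_bigr => K _.
  have mK := measurable_tri Mconf K.
  rewrite -RintegralD//; last 2 first.
  - by apply: (integrable_tri Mconf) => x; apply: cvgM; exact: continuous_aff1.
  - by apply: (integrable_tri Mconf) => x; apply: cvgM; exact: continuous_aff1.
  rewrite -cint2_real; congr cint2; apply/funext => x.
  by rewrite mul_conjc /abs2 Re_caff Im_caff.
have -> : \sum_(i < ntri M) (abs2 (v1 i) + abs2 (v2 i)) * area i =
   energy (fun K => complex.Re (v1 K)) (fun K => complex.Re (v2 K)) +
   energy (fun K => complex.Im (v1 K)) (fun K => complex.Im (v2 K)).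
  by rewrite /energy -big_split/=; apply: eq_bigr => K _; rewrite /abs2; ring.
by rewrite -!rmorphD/=; ring.
Qed.

End Estimators.

Lemma bounded_edot (R : realType) (Omega : set (R * R)) : bounded_set Omega ->
  exists D : R, forall M : mesh R, conforming_triangulation M Omega ->
    forall (K : 'I_(ntri M)) x, tri K x -> edot x x <= D ^+ 2.
Proof.
(* [B] bounds the maximum norm, so the Euclidean square is at most [2 * B ^+ 2]; the factor 2 in
   [2 * B] avoids a square root. *)
move=> /pinfty_ex_gt0[B B0 HB]; exists (2 * B) => M Mconf K x Kx.
have hx : `|x| <= B.
  have cB : closed [set y : R * R | `|y| <= B].
    apply: (closed_comp (f := fun y : R * R => `|y|) (D := [set r | r <= B]));
      last exact: closed_le.
    by move=> y _; exact: norm_continuous.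
  have : closure [set y : R * R | `|y| <= B] x.
    by apply: (closureS _ (tri_closure Mconf Kx)) => y; exact: HB.
  by rewrite -(closure_id _).1.
move: hx; rewrite /Num.norm/= ge_max => /andP[h1 h2]; rewrite /edot -!expr2.
have s1 : x.1 ^+ 2 <= B ^+ 2 by rewrite -[leLHS]real_normK ?num_real// lerXn2r ?nnegrE// ltW.
have s2 : x.2 ^+ 2 <= B ^+ 2 by rewrite -[leLHS]real_normK ?num_real// lerXn2r ?nnegrE// ltW.
by rewrite exprMn; have := sqr_ge0 B; lra.
Qed.

(** The real-valued core, to be applied to real and imaginary parts. The constants are chosen before
    the mesh, and the second equation enters as the two orthogonality relations. *)
Lemma estimator_equivalence (R : realType) (Omega : set (R * R)) (kappa : R) :
  polygonal_domain Omega ->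
  exists A B : R, [/\ 0 < A, 0 < B & forall M : mesh R,
    conforming_triangulation M Omega -> shape_regular M kappa ->
    forall ga gb gk : 'I_(ntri M) -> R,
    (forall theta : 'I_(ntri M) -> 'I_3 -> R,
      (forall K i L j, neighbour K i = Some L -> edge L j = edge K i ->
        theta L j = - theta K i) ->
      \sum_K \sum_i theta K i * pw ga gb gk K (mid K i) = 0) ->
    (forall nu : R * R -> R, (forall z, ~ Omega z -> nu z = 0) ->
      \sum_K area K * (ga K * interp_gx nu K + gb K * interp_gy nu K) = 0) ->
    jest ga gb <= A * energy ga gb /\ mass ga gb gk + 2 * energy ga gb <= B * jest ga gb].
Proof.
move=> [_ Oopen _ Obnd [Oreg _]].
have [D hD] := bounded_edot Obnd.
(* Enlarging [kappa] preserves shape regularity, and [1 <= k] lets different powers be compared. *)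
pose k := Num.max kappa 1.
have k1 : 1 <= k by rewrite le_max lexx orbT.
have k0 : 0 < k by apply: lt_le_trans k1.
have kn n : 0 < k ^+ n by rewrite exprn_gt0.
have pos (n m : nat) : 0 < n.+1%:R * k ^+ m by rewrite mulr_gt0// ltr0n.
exists (12 * k ^+ 2 + 36 * k ^+ 3),
  (D ^+ 2 * (8 * (5184 * k ^+ 7) + 12 * (3456 * k ^+ 5)) + 2 * (5184 * k ^+ 7)); split.
- exact: (addr_gt0 (pos _ _) (pos _ _)).
- apply: ltr_wpDl; last exact: (mulr_gt0 (ltr0n _ 2) (pos _ _)).
  apply: mulr_ge0 (sqr_ge0 _) (addr_ge0 (mulr_ge0 (ler0n _ _) (ltW (pos _ _))) (mulr_ge0 (ler0n _
    _) (ltW (pos _ _)))).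
move=> M Mconf Mreg ga gb gk orth1 orth2.
have /choice[rad /choice[ctr discs]] : forall K, exists r z, @disc_in _ M k z r K.
  move=> K; have [z [r [r0 hr hd]]] := Mreg K; exists r, z; split => // x y Kx Ky.
  by apply: le_trans (hd x y Kx Ky) _; rewrite ler_wpM2r ?mulr_ge0 ?(ltW r0)// le_max lexx.
have cont := continuity_of_orthogonality Mconf orth1.
have orthn := orth2 _ (@nodal_out _ M Omega ga gb gk).
split; first exact: (jest_le_energy Mconf k1 discs).
rewrite [leRHS]mulrDl lerD//; first exact: (mass_le_jest Oopen Oreg Mconf k1 discs cont orthn (hD
  M Mconf)).
rewrite -mulrA ler_wpM2l//; exact: (energy_le_jest Oopen Oreg Mconf k1 discs cont orthn).
Qed.

Lemma Re_mulC (R : realType) (a : R) (z : R[i]) : complex.Re (a%:C * z) = a * complex.Re z.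
Proof. by case: z => u v /=; ring. Qed.

Lemma Im_mulC (R : realType) (a : R) (z : R[i]) : complex.Im (a%:C * z) = a * complex.Im z.
Proof. by case: z => u v /=; ring. Qed.

Lemma Re_sum (R : realType) (I : finType) (F : I -> R[i]) :
  complex.Re (\sum_i F i) = \sum_i complex.Re (F i).
Proof. by apply: big_morph => // -[a b] [c d]. Qed.

Lemma Im_sum (R : realType) (I : finType) (F : I -> R[i]) :
  complex.Im (\sum_i F i) = \sum_i complex.Im (F i).
Proof. by apply: big_morph => // -[a b] [c d]. Qed.

Theorem theorem15 (R : realType) (Omega : set (R * R)) (kappa : R)
    (hOmega : polygonal_domain Omega) :
  exists c C : R, [/\ 0 < c, 0 < C &
    forall (M : mesh R),
      conforming_triangulation M Omega -> shape_regular M kappa ->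
    forall (lambda : R[i]) (U : trial M) (eps : test M),
      discrete_solution Omega lambda U eps ->
      jump_estimator2 (bgrad (tv eps)) = jump_estimator2 (ttau eps) /\
      c * Num.sqrt (jump_estimator2 (ttau eps)) <= normV eps
        <= C * Num.sqrt (jump_estimator2 (ttau eps))].
Proof.
have [A [B [A0 B0 equiv]]] := estimator_equivalence kappa hOmega.
have [_ Oopen _ _ [Oreg _]] := hOmega.
(* The squared norm is mass plus twice the energy, for real and imaginary parts together. It
   dominates the energy, hence the jumps divided by [A], and is at most [B] times the jumps. *)
exists (Num.sqrt A^-1), (Num.sqrt B); split; rewrite ?sqrtr_gt0 ?invr_gt0//.
move=> M Mconf Mreg lambda U eps [_ Veps _ _ orth].
have [v1 [v2 [v0 E]]] := test_const Oopen Mconf Veps orth.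
rewrite {eps Veps}E in orth *.
split.
  by congr jump_estimator2; apply/funext => K; apply/funext => x; exact: cgrad_caff.
have [|nu nu0|lRe uRe] := equiv M Mconf Mreg (fun K => complex.Re (v1 K))
    (fun K => complex.Re (v2 K)) (fun K => complex.Re (v0 K)).
- move=> theta opp; rewrite -[RHS]/(complex.Re (0 : R[i])) -(orth_shat Oopen Mconf orth opp) Re_sum.
  by apply: eq_bigr => K _; rewrite Re_sum; apply: eq_bigr => i _; rewrite Re_mulC Re_caff.
- rewrite -[RHS]/(complex.Re (0 : R[i])) -(orth_uhat Oopen Oreg Mconf orth nu0) Re_sum.
  by apply: eq_bigr => K _; rewrite Re_mulC; case: (v1 K) (v2 K) => a b [a' b'] /=; ring.
have [|nu nu0|lIm uIm] := equiv M Mconf Mreg (fun K => complex.Im (v1 K))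
    (fun K => complex.Im (v2 K)) (fun K => complex.Im (v0 K)).
- move=> theta opp; rewrite -[RHS]/(complex.Im (0 : R[i])) -(orth_shat Oopen Mconf orth opp) Im_sum.
  by apply: eq_bigr => K _; rewrite Im_sum; apply: eq_bigr => i _; rewrite Im_mulC Im_caff.
- rewrite -[RHS]/(complex.Im (0 : R[i])) -(orth_uhat Oopen Oreg Mconf orth nu0) Im_sum.
  by apply: eq_bigr => K _; rewrite Im_mulC; case: (v1 K) (v2 K) => a b [a' b'] /=; ring.
have mass_ge0 ga gb gk : 0 <= mass (M:=M) ga gb gk.
  by apply: sumr_ge0 => K _; apply: Rintegral_ge0 => x _; exact: sqr_ge0.
have energy_ge0 ga gb : 0 <= energy (M:=M) ga gb.
  by apply: sumr_ge0 => K _; rewrite mulr_ge0 ?addr_ge0 ?sqr_ge0// ltW// (area_pos Mconf).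
rewrite (jump_estimator_cst v1 v2) /normV (normV_cst Mconf).
have /= mRe := mass_ge0 (fun K => complex.Re (v1 K)) (fun K => complex.Re (v2 K)) (fun K =>
  complex.Re (v0 K)).
have /= mIm := mass_ge0 (fun K => complex.Im (v1 K)) (fun K => complex.Im (v2 K)) (fun K =>
  complex.Im (v0 K)).
have eRe := energy_ge0 (fun K => complex.Re (v1 K)) (fun K => complex.Re (v2 K)).
have eIm := energy_ge0 (fun K => complex.Im (v1 K)) (fun K => complex.Im (v2 K)).
move: lRe uRe lIm uIm mRe mIm eRe eIm; clear -A0 B0.
move: (mass _ _ _) (mass _ _ _) (energy _ _) (energy _ _) (jest _ _) (jest _ _).
move=> m1 m2 n1 n2 j1 j2 l1 u1 l2 u2 hm1 hm2 hn1 hn2.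
rewrite -!sqrtrM ?invr_ge0 ?(ltW A0) ?(ltW B0)//.
by apply/andP; split; apply: ler_wsqrtr; [rewrite mulrC ler_pdivrMr//; nra|lra].
Qed.
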